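(* Let $p$ be a prime. The function $\kappa(v)\kappa_p(v)$, where $\kappa(v)=\rho_\infty\left(\frac12+\frac{v+1}{v-1}\right)$ and $\kappa_p(v)=\rho_p\left(\frac12+\frac{v+1}{v-1}\right)$, belongs to $C(S^1)+H^\infty(\mathcal{U})$.
   Context: $\rho_\infty(z):=\dfrac{\pi^{-z/2}\Gamma(z/2)}{\pi^{-(1-z)/2}\Gamma((1-z)/2)}$ and $\rho_p(z):=\dfrac{1-p^{z-1}}{1-p^{-z}}$. $\mathcal{U}$ is the open unit disk and $S^1$ its boundary; $\kappa$ and $\kappa_p$ are defined on $S^1\setminus\{1\}$, where they have modulus $1$. $H^\infty(\mathcal{U})$ is the space of bounded holomorphic functions on $\mathcal{U}$, identified with the subspace of $L^\infty(S^1)$ of their boundary values; $C(S^1)$ is the space of continuous complex valued functions on $S^1$. The sum is taken in $L^\infty(S^1)$. *)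

(* Defs.v *)
From mathcomp Require Export all_boot all_order all_algebra.
From mathcomp.real_closed Require Export complex.
From mathcomp Require Export all_classical all_reals all_analysis.
Export Order.TTheory GRing.Theory Num.Theory.
Export numFieldNormedType.Exports.

Set Implicit Arguments.
Unset Strict Implicit.
Unset Printing Implicit Defensive.

(* R[i]^o is R[i] with the topology and complex normed-space structure given by
   the modulus; derivability over R[i] is complex differentiability. *)
Local Open Scope classical_set_scope.
Local Open Scope complex_scope.
Local Open Scope ring_scope.

Section SpecialFunctions.
Context {R : realType}.
Implicit Types z : R[i].

Definition cexp z : R[i] :=
  (expR (complex.Re z))%:C * (cos (complex.Im z) +i* sin (complex.Im z)).

(* a ^ z for a real a > 0, with the real logarithm. *)
Definition cpow (a : R) z : R[i] := cexp (z * (ln a)%:C).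

(* Euler's limit definition of Gamma on the whole plane:
   Gamma z = lim_n  n! n^z / (z (z + 1) ... (z + n)).
   At the poles z = 0, -1, -2, ... the value is 0 since x / 0 = 0. *)
Definition Gamma z : R[i] :=
  lim (((n`!)%:R * cpow n%:R z / \prod_(0 <= k < n.+1) (z + k%:R) : R[i]^o)
         @[n --> \oo]).

Definition rho_infty z : R[i] :=
  (cpow pi (- z / 2) * Gamma (z / 2)) /
  (cpow pi (- (1 - z) / 2) * Gamma ((1 - z) / 2)).

Definition rho_p (p : nat) z : R[i] :=
  (1 - cpow p%:R (z - 1)) / (1 - cpow p%:R (- z)).

(* The values of kappa and kappa_p at v = 1 are irrelevant: functions on the
   circle are only considered up to null sets. *)
Definition kappa (v : R[i]) : R[i] := rho_infty (1 / 2 + (v + 1) / (v - 1)).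

Definition kappa_p (p : nat) (v : R[i]) : R[i] :=
  rho_p p (1 / 2 + (v + 1) / (v - 1)).

End SpecialFunctions.

Section Circle.
Context {R : realType}.
Implicit Types f g : R[i] -> R[i].

Definition cis (t : R) : R[i] := cos t +i* sin t.

Definition unit_circle : set R[i]^o := [set v | `|v| = 1].

Definition unit_disk : set R[i] := [set z | `|z| < 1].

(* Arc length on the circle is Lebesgue measure of the angle in [0, 2 pi]. *)
Definition angles : set R := `[0, 2 * pi]%classic.

Definition ae_circle (P : R[i] -> Prop) : Prop :=
  {ae (@lebesgue_measure R), forall t, angles t -> P (cis t)}.

(* f represents an element of L^oo(S^1); two functions represent the same
   element when they agree ae_circle. *)
Definition Linfty_circle f : Prop :=
  [/\ measurable_fun angles (fun t => complex.Re (f (cis t))),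
      measurable_fun angles (fun t => complex.Im (f (cis t)))
    & exists M : R, ae_circle (fun v => `|f v| <= M%:C)].

Definition continuous_circle f : Prop :=
  {within unit_circle, continuous (f : R[i]^o -> R[i]^o)}.

Definition Hinfty_disk (F : R[i] -> R[i]) : Prop :=
  (forall z, unit_disk z -> derivable (F : R[i]^o -> R[i]^o) z 1) /\
  exists M : R, forall z, unit_disk z -> `|F z| <= M%:C.

(* Radial limits; for bounded holomorphic F they exist almost everywhere
   (Fatou), and F is determined by them. *)
Definition boundary_value (F : R[i] -> R[i]) f : Prop :=
  ae_circle (fun v =>
    (F (r%:C * v) : R[i]^o) @[r --> (1 : R)^'-] --> (f v : R[i]^o)).

Definition Hinfty_circle f : Prop :=
  Linfty_circle f /\ exists F, Hinfty_disk F /\ boundary_value F f.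

Definition C_plus_Hinfty f : Prop :=
  Linfty_circle f /\
  exists g h, [/\ continuous_circle g, Hinfty_circle h
                & ae_circle (fun v => f v = g v + h v)].

End Circle.

(* Main.v *)
Require Import Defs.
From mathcomp Require Import ring lra measurable_realfun.

(** With z = 1/2 + (v + 1) / (v - 1), the unit disk becomes the half-plane
Re z < 1/2 and the punctured circle the critical line Re z = 1/2; the point
v = 1 goes to infinity. The product rho_infty z * rho_p z has to be split into
a bounded holomorphic function on the half-plane and a continuous function on
the line that tends to 0 at infinity.

On the critical line rho_infty is the Mellin transform of the function
x |-> 2 cos (2 pi x) on the positive reals. This is the local functional
equation: the Gaussian is its own cosine transform, so Fubini relates its
Mellin transforms at z and at 1 - z by the factor cos_mellin z
(cos_mellin_gauss), and the Mellin transform of the Gaussian is a Gamma factor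
by Euler's limit (euler_gamma_cvg); this gives rho_inftyE. All integrals are
written in the variable y = ln x, so that x^z dx / x becomes e^(z y) dy.

On the critical line rho_p z is a geometric series in p^(-z), a combination of
the powers p^(-(m - 1) z) for m >= 0, and multiplication by e^(- z a) replaces
cos (2 pi e^y) by cos (2 pi e^(y + a)) in the Mellin integral. Each of the
resulting integrals is cut at y = 0 (split_mell).

- The half y > 0, once integrated by parts, is holomorphic for Re z < 1, and for
  Re z <= 1/2 its modulus is at most a constant times e^(- a / 2). For
  a = (m - 1) ln p these bounds are summable, and the sum right_total is bounded
  and holomorphic on the half-plane: this is the part in H^oo.
- The half y < 0 is a Laplace transform, holomorphic for Re z > 0, and on the
  line it is O(1 / |z|) (left_mell_decay): as a function of v it is continuous
  on the whole circle, with value 0 at v = 1. The partial sums of the series of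
  these halves converge uniformly on the circle (left_part_approx), so that the
  limit is continuous too.

The estimate behind both halves is chirp_integral_bound: the integrals of
e^(y/2) cos (2 pi e^y + s y + t) over segments are bounded uniformly in s, t and
the segment. This is van der Corput's method: first derivative test away from
the stationary point of the phase, trivial bound in a window around it. *)

Set Implicit Arguments.
Unset Strict Implicit.
Import Normc.
Local Open Scope classical_set_scope.
Local Open Scope complex_scope.
Local Open Scope ring_scope.

(** * Modulus, limits and the exponential on the complex numbers *)

Section ComplexBasics.
Context {R : realType}.
Implicit Types z w : R[i].

Lemma normcP z : `|z| = (normc z)%:C.
Proof. by []. Qed.

Lemma normc_ge0 z : 0 <= normc z.
Proof. by case: z => a b; rewrite sqrtr_ge0. Qed.

Lemma normc_real (x : R) : normc x%:C = `|x|.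
Proof. by rewrite /= expr0n addr0 sqrtr_sqr. Qed.

Lemma le_Re_normc z : `|complex.Re z| <= normc z.
Proof. by rewrite -lecR; exact: normc_ge_Re. Qed.

Lemma le_Im_normc z : `|complex.Im z| <= normc z.
Proof. by case: z => a b /=; rewrite -sqrtr_sqr ler_wsqrtr// lerDr sqr_ge0. Qed.

Lemma normc_le_ReIm z : normc z <= `|complex.Re z| + `|complex.Im z|.
Proof.
rewrite {1}(complexE z); apply: le_trans (le_normcD _ _) _.
by rewrite normcM normc_real normc_real /= expr0n expr1n add0r sqrtr1 mul1r.
Qed.

Lemma cexpD z w : cexp (z + w) = cexp z * cexp w.
Proof.
case: z => a b; case: w => c d; rewrite /cexp /= expRD cosD sinD.
by apply/eqP; rewrite eq_complex /=; apply/andP; split; apply/eqP; ring.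
Qed.

Lemma cexp0 : cexp 0 = 1 :> R[i].
Proof. by rewrite /cexp /= expR0 cos0 sin0 mulr1. Qed.

Lemma normc_cexp z : normc (cexp z) = expR (complex.Re z).
Proof.
rewrite /cexp normcM normc_real ger0_norm ?expR_ge0//=.
by rewrite cos2Dsin2 sqrtr1 mulr1.
Qed.

Lemma cexp_neq0 z : cexp z != 0.
Proof.
apply/eqP => /(congr1 (@normc R)); rewrite normc_cexp normc0 => h.
by have := expR_gt0 (complex.Re z); rewrite h ltxx.
Qed.

Lemma cexpN z : cexp (- z) = (cexp z)^-1.
Proof.
apply: (mulIf (cexp_neq0 z)); rewrite mulVf ?cexp_neq0//.
by rewrite -cexpD addNr cexp0.
Qed.

Lemma cexp_real (x : R) : cexp x%:C = (expR x)%:C.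
Proof. by rewrite /cexp /= cos0 sin0 complexr0 mulr1. Qed.

Lemma normcB z w : normc (z - w) = normc (w - z).
Proof. by rewrite -normcN opprB. Qed.

Lemma Re_le_normc z : complex.Re z <= normc z.
Proof. exact: le_trans (ler_norm _) (le_Re_normc z). Qed.

Lemma cvgc_normc T (F : set_system T) {FF : Filter F} (f : T -> R[i]) (l : R[i]) :
  f x @[x --> F] --> (l : R[i]^o) <-> normc (f x - l) @[x --> F] --> (0 : R).
Proof.
have n0 x : `|0 - normc (f x - l)| = normc (l - f x).
  by rewrite sub0r normrN ger0_norm ?normc_ge0// normcB.
split=> [/(@cvgrPdist_lt _ R[i]^o T F FF f l) h|/cvgrPdist_lt h].
  apply/cvgrPdist_lt => e e0.
  have /h : (0 : R[i]^o) < e%:C by rewrite ltcR.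
  by apply: filterS => x; rewrite n0 -ltcR; apply.
apply: (proj2 (@cvgrPdist_lt _ R[i]^o T F FF f l)) => -[e e'].
rewrite ltcE/= => /andP[/eqP -> e0].
have := h _ e0; apply: filterS => x.
by rewrite n0 -ltcR; apply.
Qed.

Lemma cvgc_ReIm T (F : set_system T) {FF : Filter F} (f : T -> R[i]) (l : R[i]) :
  f x @[x --> F] --> (l : R[i]^o) <->
  (complex.Re (f x) @[x --> F] --> complex.Re l) /\
  (complex.Im (f x) @[x --> F] --> complex.Im l).
Proof.
rewrite cvgc_normc; split=> [h|[hr hi]].
  have h' (g : R[i] -> R) : additive g -> (forall z, `|g z| <= normc z) ->
    g (f x) @[x --> F] --> g l.
    move=> gB gle; apply/cvgrPdist_lt => e e0.
    move/cvgrPdist_lt : h => /(_ _ e0); apply: filterS => x.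
    rewrite sub0r normrN ger0_norm ?normc_ge0// normcB; apply: le_lt_trans.
    by rewrite -gB.
  split; apply: h'; [|exact: le_Re_normc| |exact: le_Im_normc];
    by case=> [a b] [c d].
apply: (@squeeze_cvgr _ _ _ _ (fun=> 0) (fun x =>
   `|complex.Re (f x) - complex.Re l| + `|complex.Im (f x) - complex.Im l|)).
- apply: nearW => x; rewrite normc_ge0/=; apply: le_trans (normc_le_ReIm _) _.
  by case: (f x) => a b; case: (l).
- exact: cvg_cst.
- rewrite -[X in _ --> X](addr0 (0 : R)); apply: cvgD.
    apply/norm_cvg0P; rewrite -(subrr (complex.Re l)).
    by apply: cvgB => //; exact: cvg_cst.
  apply/norm_cvg0P; rewrite -(subrr (complex.Im l)).
  by apply: cvgB => //; exact: cvg_cst.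
Qed.

Lemma cvg_near_eq T (F : set_system T) {FF : Filter F} (u v : T -> R[i]) (l : R[i]) :
  (\forall x \near F, u x = v x) -> v x @[x --> F] --> (l : R[i]^o) ->
  u x @[x --> F] --> (l : R[i]^o).
Proof.
move=> uv /cvgc_ReIm[re im]; apply/cvgc_ReIm; split.
  by apply: cvg_trans re; apply: near_eq_cvg; apply: filterS uv => x /= ->.
by apply: cvg_trans im; apply: near_eq_cvg; apply: filterS uv => x /= ->.
Qed.

Section CvgC.
Context {T : Type} {F : set_system T} {FF : Filter F}.
Implicit Types (f g : T -> R[i]) (a b : R[i]).

Lemma ccvg_cst a : (fun=> a) x @[x --> F] --> (a : R[i]^o).
Proof. exact: (@cvg_cst R[i]^o). Qed.

Lemma ccvgM f g a b : f x @[x --> F] --> (a : R[i]^o) ->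
  g x @[x --> F] --> (b : R[i]^o) -> f x * g x @[x --> F] --> (a * b : R[i]^o).
Proof. by move=> fa gb; exact: (@cvgM R[i] _ _ _ _ _ _ _ fa gb). Qed.

Lemma ccvgD f g a b : f x @[x --> F] --> (a : R[i]^o) ->
  g x @[x --> F] --> (b : R[i]^o) -> f x + g x @[x --> F] --> (a + b : R[i]^o).
Proof. by move=> fa gb; exact: (@cvgD R[i] R[i]^o _ _ _ f g a b fa gb). Qed.

Lemma ccvgB f g a b : f x @[x --> F] --> (a : R[i]^o) ->
  g x @[x --> F] --> (b : R[i]^o) -> f x - g x @[x --> F] --> (a - b : R[i]^o).
Proof. by move=> fa gb; exact: (@cvgB R[i] R[i]^o _ _ _ f g a b fa gb). Qed.

End CvgC.

Lemma expR_taylor1 (x : R) : `|expR x - 1| <= `|x| * expR `|x|.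
Proof.
have h (y : R) : expR y - 1 <= y * expR y.
  have : 1 - y <= expR (- y) by exact: expR_ge1Dx.
  by rewrite -(ler_pM2r (expR_gt0 y)) -expRD addNr expR0; lra.
have [x0|x0] := leP 0 x.
  by rewrite !ger0_norm// subr_ge0 -expR0 ler_expR.
have e1 : expR x - 1 <= 0 by rewrite subr_le0 -expR0 ler_expR ltW.
rewrite ler0_norm// ltr0_norm//.
have h1 := expR_ge1Dx x; have h2 : 1 <= expR (- x).
  by rewrite -expR0 ler_expR; lra.
by nra.
Qed.

Lemma expR_taylor2 (x : R) : `|expR x - 1 - x| <= x ^+ 2 * expR `|x|.
Proof.
have h (y : R) : expR y - 1 <= y * expR y.
  have : 1 - y <= expR (- y) by exact: expR_ge1Dx.
  by rewrite -(ler_pM2r (expR_gt0 y)) -expRD addNr expR0; lra.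
rewrite ger0_norm; last by have := expR_ge1Dx x; lra.
have hx := h x.
have h1 := expR_taylor1 x.
have h2 := ler_norm (x * (expR x - 1)).
apply: (@le_trans _ _ (x * (expR x - 1))); first by lra.
apply: le_trans h2 _; rewrite normrM -(real_normK (num_real x)) expr2 -mulrA.
by rewrite ler_wpM2l.
Qed.

Lemma mean_value_bound (f df : R -> R) (k x : R) : f 0 = 0 ->
  (forall y : R, is_derive y 1 f (df y)) -> (forall y : R, `|y| <= `|x| -> `|df y| <= k) ->
  `|f x| <= k * `|x|.
Proof.
move=> f0 fd dfk.
have cf D : {within D, continuous f}%classic.
  apply: continuous_subspaceT => y.
  by have [fy _] := fd y; apply: differentiable_continuous; exact/derivable1_diffP.
have [x0|x0] := leP 0 x.
  have [c] := MVT_segment x0 (fun y _ => fd y) (cf _).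
  rewrite in_itv/= f0 !subr0 => /andP[c0 cx] ->.
  by rewrite normrM ler_wpM2r// dfk// !ger0_norm//.
have [c] := MVT_segment (ltW x0) (fun y _ => fd y) (cf _).
rewrite in_itv/= f0 !sub0r => /andP[xc c0] h.
by rewrite -normrN h mulrN normrN normrM ler_wpM2r// dfk// !ler0_norm ?lerN2// ltW.
Qed.

Lemma sin_le_id (x : R) : `|sin x| <= `|x|.
Proof.
rewrite -[leRHS]mul1r; apply: (@mean_value_bound sin cos); first exact: sin0.
by move=> y _; exact: cos_max.
Qed.

Lemma cos_sub1_le (x : R) : `|cos x - 1| <= `|x|.
Proof.
rewrite -[leRHS]mul1r.
apply: (@mean_value_bound (fun x => cos x - 1) (fun x => - sin x)).
- by rewrite cos0 subrr.
- by move=> y; apply: is_derive_eq; rewrite subr0.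
- by move=> y _; rewrite normrN; exact: sin_max.
Qed.

Lemma sin_sub_id_le (x : R) : `|sin x - x| <= x ^+ 2.
Proof.
rewrite -(real_normK (num_real x)) expr2.
apply: (@mean_value_bound (fun x => sin x - x) (fun x => cos x - 1)).
- by rewrite sin0 subrr.
- by move=> y yx; apply: le_trans yx; exact: cos_sub1_le.
Qed.

Lemma cos_sub1_le2 (x : R) : `|cos x - 1| <= x ^+ 2.
Proof.
rewrite -(real_normK (num_real x)) expr2.
apply: (@mean_value_bound (fun x => cos x - 1) (fun x => - sin x)).
- by rewrite cos0 subrr.
- by move=> y; apply: is_derive_eq; rewrite subr0.
- by move=> y yx; rewrite normrN; apply: le_trans yx; exact: sin_le_id.
Qed.

(** This quadratic remainder is what allows differentiating a Laplace transform
under the integral sign by a direct estimate. The real and imaginary parts each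
split into two real remainders of size at most |z|^2 e^|z|, hence the 4. *)
Lemma cexp_taylor2 z :
  normc (cexp z - 1 - z) <= 4 * normc z ^+ 2 * expR (normc z).
Proof.
case: z => a b; apply: le_trans (normc_le_ReIm _) _; rewrite /cexp /=.
set n := Num.sqrt _.
have an : `|a| <= n by exact: (le_Re_normc (a +i* b)).
have bn : `|b| <= n by exact: (le_Im_normc (a +i* b)).
have n0 : 0 <= n by exact: sqrtr_ge0.
have En : expR `|a| <= expR n by rewrite ler_expR.
have e1 := expR_taylor1 a. have e2 := expR_taylor2 a.
have c2 := cos_sub1_le2 b. have s2 := sin_sub_id_le b.
have E0 := expR_gt0 a. have Ea : expR a <= expR n.
  by rewrite ler_expR; apply: le_trans an; exact: ler_norm.
have a2 : a ^+ 2 <= n ^+ 2 by rewrite -(real_normK (num_real a)) ler_sqr ?nnegrE.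
have b2 : b ^+ 2 <= n ^+ 2 by rewrite -(real_normK (num_real b)) ler_sqr ?nnegrE.
have n2 : 0 <= n ^+ 2 by exact: sqr_ge0.
have En0 := expR_gt0 n.
have t1 : `|expR a - 1 - a| <= n ^+ 2 * expR n.
  by apply: le_trans e2 _; apply: ler_pM; rewrite ?sqr_ge0 ?expR_ge0.
have t2 : `|expR a * (cos b - 1)| <= n ^+ 2 * expR n.
  rewrite normrM (ger0_norm (ltW E0)) mulrC; apply: ler_pM; rewrite ?expR_ge0//.
  exact: le_trans c2 b2.
have t3 : `|expR a * (sin b - b)| <= n ^+ 2 * expR n.
  rewrite normrM (ger0_norm (ltW E0)) mulrC; apply: ler_pM; rewrite ?expR_ge0//.
  exact: le_trans s2 b2.
have t4 : `|b * (expR a - 1)| <= n ^+ 2 * expR n.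
  rewrite normrM expr2 -mulrA; apply: ler_pM => //.
  by apply: le_trans e1 _; apply: ler_pM; rewrite ?expR_ge0.
have -> : 4 * n ^+ 2 * expR n = (n ^+ 2 * expR n + n ^+ 2 * expR n)
    + (n ^+ 2 * expR n + n ^+ 2 * expR n) by ring.
apply: lerD.
  rewrite !mul0r !subr0 (_ : _ - 1 - a = (expR a - 1 - a) + expR a * (cos b - 1)); last by ring.
  by apply: le_trans (ler_normD _ _) _; exact: lerD.
rewrite !mul0r !addr0 subr0 (_ : _ - b = expR a * (sin b - b) + b * (expR a - 1)); last by ring.
by apply: le_trans (ler_normD _ _) _; exact: lerD.
Qed.

End ComplexBasics.

(** * Lebesgue integrals of real functions *)

Section RealIntegrals.
Context {R : realType}.
Notation mu := (@lebesgue_measure R).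
Implicit Types (f g F : R -> R) (a b c : R) (D : set R).

Lemma derive_continuous f (x l : R) : is_derive x 1 f l -> {for x, continuous f}.
Proof.
by move=> [fx _]; apply: differentiable_continuous; exact/derivable1_diffP.
Qed.

Lemma integrable_segment a b f : {in `[a, b], continuous f} ->
  mu.-integrable `[a, b] (EFin \o f).
Proof.
move=> cf; apply: continuous_compact_integrable; first exact: segment_compact.
by apply: continuous_in_subspaceT => x /set_mem; exact: cf.
Qed.

Lemma Rintegral_FTC a b (f F : R -> R) : a <= b ->
  (forall x, a <= x <= b -> is_derive x 1 F (f x)) ->
  {in `[a, b], continuous f} ->
  (\int[mu]_(x in `[a, b]) f x) = F b - F a.
Proof.
rewrite le_eqVlt => /predU1P[<- _ _|ab dF cf].
  by rewrite set_itv1 Rintegral_set1 subrr.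
have cF x : a <= x <= b -> {for x, continuous F}.
  by move=> /dF; exact: derive_continuous.
rewrite /Rintegral (@continuous_FTC2 _ f F)//.
- by apply: continuous_in_subspaceT => x /set_mem; exact: cf.
- split.
  + move=> x; rewrite in_itv/= => /andP[/ltW ax /ltW xb].
    by have [] := dF x; rewrite ?ax.
  + by apply: cvg_at_right_filter; apply: cF; rewrite lexx ltW.
  + by apply: cvg_at_left_filter; apply: cF; rewrite lexx ltW.
- move=> x; rewrite in_itv/= => /andP[/ltW ax /ltW xb].
  by rewrite derive1E; apply: derive_val; apply: dF; rewrite ax.
Qed.

Lemma Rintegral_shift a b c f : a <= b -> continuous f ->
  (\int[mu]_(x in `[a, b]) f (x + c)) = \int[mu]_(x in `[a + c, b + c]) f x.
Proof.
move=> ab cf; rewrite /Rintegral.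
have d1 : derive1 (fun x : R => x + c) = cst 1.
  by apply/funext => z; rewrite derive1E derive_val addr0.
rewrite (@integration_by_substitution_increasing _ (fun x => x + c) f a b)//.
- by congr fine; apply: eq_integral => x _; rewrite d1 !fctE mulr1.
- by move=> x y _ _ xy; rewrite ltrD2r.
- by rewrite d1 => ? _; exact: cvg_cst.
- by rewrite d1; exact: is_cvg_cst.
- by rewrite d1; exact: is_cvg_cst.
- have h x : {for x, continuous (fun x : R => x + c)}.
    by apply: (@derive_continuous _ _ 1); apply: is_derive_eq; rewrite addr0.
  split => //.
  + by apply: cvg_at_right_filter; exact: h.
  + by apply: cvg_at_left_filter; exact: h.
- exact: continuous_subspaceT.
Qed.

Lemma Rintegral_oppr a b f : a <= b -> continuous f ->
  (\int[mu]_(x in `[- b, - a]) f x) = \int[mu]_(x in `[a, b]) f (- x).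
Proof.
move=> ab cf; rewrite /Rintegral integration_by_substitution_oppr//.
exact: continuous_subspaceT.
Qed.

Lemma Rintegral_split a b c f : a <= b -> b <= c -> continuous f ->
  (\int[mu]_(x in `[a, c]) f x) =
  \int[mu]_(x in `[a, b]) f x + \int[mu]_(x in `[b, c]) f x.
Proof.
move=> ab bc cf.
have H := @Rintegral_itvB R f (BLeft a) (BRight c) b.
rewrite -(@Rintegral_itv_obnd_cbnd _ b); last first.
  have := @integrable_segment b c f (in1W cf); apply: integrableS => //.
  by apply: subset_itvr; rewrite bnd_simp.
rewrite -H ?bnd_simp//; last exact: integrable_segment.
by rewrite addrC subrK.
Qed.

Lemma Rintegral_dominated D (f_ : (R -> R)^nat) f g : measurable D ->
  (forall n, measurable_fun D (f_ n)) ->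
  (forall x, D x -> f_ n x @[n --> \oo] --> f x) ->
  mu.-integrable D (EFin \o g) ->
  (forall n x, D x -> `|f_ n x| <= g x) ->
  mu.-integrable D (EFin \o f) /\
  (\int[mu]_(x in D) f_ n x) @[n --> \oo] --> \int[mu]_(x in D) f x.
Proof.
move=> mD mf_ f_f ig f_g.
have m1 n := (measurable_EFinP D (f_ n)).2 (mf_ n).
have m2 := (measurable_EFinP D f).2 (@measurable_fun_cvg _ _ _ D f_ f mf_ f_f).
have c1 : {ae mu, forall x, D x -> (EFin \o f_ n) x @[n --> \oo] --> (EFin \o f) x}.
  by apply: aeW => x Dx; apply: cvg_EFin; [exact: nearW|exact: f_f].
have c2 : {ae mu, forall x n, D x -> (`|(EFin \o f_ n) x| <= (EFin \o g) x)%E}.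
  by apply: aeW => x n Dx; rewrite /= lee_fin; exact: f_g.
have [h1 _ h2] := @dominated_convergence _ _ R mu D mD _ _ _ m1 m2 c1 ig c2.
split => //; rewrite /Rintegral; apply: fine_cvg.
by rewrite fineK//; exact: integrable_fin_num.
Qed.

Lemma integrable_le D f g : measurable D -> measurable_fun setT f ->
  (forall x, D x -> `|f x| <= g x) -> mu.-integrable D (EFin \o g) ->
  mu.-integrable D (EFin \o f).
Proof.
move=> mD mf fg; apply: le_integrable => //.
  by apply/measurable_EFinP; exact: measurable_funTS.
by move=> x Dx /=; rewrite lee_fin (le_trans (fg _ Dx))// ler_norm.
Qed.

Lemma integrable_subset (D E : set R) f : measurable D -> measurable E -> D `<=` E ->
  mu.-integrable E (EFin \o f) -> mu.-integrable D (EFin \o f).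
Proof. by move=> mD mE DE; exact: integrableS. Qed.

Lemma integrable_scalel D k f : measurable D -> mu.-integrable D (EFin \o f) ->
  mu.-integrable D (EFin \o (fun x => k * f x)).
Proof. by move=> mD; exact: (@integrableZl _ _ _ mu D mD k). Qed.

Lemma integrable_add D f g : measurable D -> mu.-integrable D (EFin \o f) ->
  mu.-integrable D (EFin \o g) -> mu.-integrable D (EFin \o (fun x => f x + g x)).
Proof. by move=> mD; exact: (@integrableD _ _ _ mu D mD). Qed.

Lemma Rintegral_le_bound D f g : measurable D -> mu.-integrable D (EFin \o f) ->
  mu.-integrable D (EFin \o g) -> (forall x, D x -> `|f x| <= g x) ->
  `|\int[mu]_(x in D) f x| <= \int[mu]_(x in D) g x.
Proof.
move=> mD mf mg fg; apply: le_trans (le_normr_Rintegral _ _) _ => //.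
by apply: le_Rintegral => //; exact: (integrable_norm mf).
Qed.

End RealIntegrals.

Section ExpIntegrals.
Context {R : realType}.
Notation mu := (@lebesgue_measure R).

Lemma continuous_expRM (d : R) : continuous (fun x : R => expR (d * x)).
Proof.
move=> x; apply: (@derive_continuous _ _ _ (d * expR (d * x))).
by apply: is_derive_eq; rewrite /GRing.scale/=; ring.
Qed.

Lemma integrable_ge0 (D : set R) (f : R -> R) : measurable D -> continuous f ->
  (forall x, 0 <= f x) -> (\int[mu]_(x in D) (f x)%:E < +oo)%E ->
  mu.-integrable D (EFin \o f).
Proof.
move=> mD cf f0 h; apply/integrableP; split.
  by apply/measurable_EFinP; apply: measurable_funTS; exact: continuous_measurable_fun.
by under eq_integral do rewrite /= ger0_norm//.
Qed.

Lemma integral_expRN (d : R) : 0 < d ->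
  (\int[mu]_(y in `[0%R, +oo[) (expR (- d * y))%:E = (d^-1)%:E)%E.
Proof.
move=> d0.
have dF (y : R) : is_derive y 1 (fun y => - d^-1 * expR (- d * y)) (expR (- d * y)).
  apply: is_derive_eq; rewrite /GRing.scale/=; field.
  by rewrite gt_eqF.
rewrite (@ge0_continuous_FTC2y _ _ (fun y => - d^-1 * expR (- d * y)) _ 0).
- by rewrite mulr0 expR0 mulr1 -EFinB sub0r opprK.
- by move=> y _; exact: expR_ge0.
- by apply: continuous_subspaceT; exact: continuous_expRM.
- rewrite -[X in _ --> X](mulr0 (- d^-1)); apply: cvgMr.
  under eq_fun do rewrite mulNr.
  apply: (@cvg_comp _ _ _ (fun y => d * y) (fun z => expR (- z)) _ (pinfty_nbhs R)); last exact: cvgr_expR.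
  exact: gt0_cvgMry.
- by move=> y _; have [] := dF y.
- by apply: cvg_at_right_filter; exact: derive_continuous (dF 0).
- by move=> y _; rewrite derive1E; exact: derive_val.
Qed.

Lemma integrable_expRN (d : R) : 0 < d ->
  mu.-integrable `[0, +oo[ (EFin \o (fun y => expR (- d * y))).
Proof.
move=> d0; apply: integrable_ge0 => //.
- exact: continuous_expRM.
- by rewrite (integral_expRN d0) ltry.
Qed.

Lemma Rintegral_expRN (d : R) : 0 < d ->
  \int[mu]_(y in `[0, +oo[) expR (- d * y) = d^-1.
Proof. by move=> d0; rewrite /Rintegral integral_expRN. Qed.

Lemma integrable_expRabs (d : R) : 0 < d ->
  mu.-integrable setT (EFin \o (fun y => expR (- d * `|y|))).
Proof.
move=> d0; have cf : continuous (fun y : R => expR (- d * `|y|)).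
  move=> y; apply: (@continuous_comp _ _ _ (@Num.norm R R) (fun y => expR (- d * y))).
    exact: norm_continuous.
  exact: continuous_expRM.
apply: (@integrable_ge0 _ (fun y => expR (- d * `|y|))) => //.
rewrite ge0_symfun_integralT//; last by move=> y /=; rewrite normrN.
rewrite -set_itvcy.
have -> : (\int[mu]_(y in `[0%R, +oo[) (expR (- d * `|y|))%:E = (d^-1)%:E)%E.
  rewrite -(integral_expRN d0); apply: eq_integral => y /set_mem/=.
  by rewrite in_itv/= andbT => y0; rewrite ger0_norm.
by rewrite -EFinM ltry.
Qed.

Lemma integrable_expR_left (d c : R) : 0 < d ->
  mu.-integrable `]-oo, c] (EFin \o (fun y => expR (d * y))).
Proof.
move=> d0; apply: (@integrable_le _ _ _ (fun y => expR (2 * d * `|c|) * expR (- d * `|y|))) => //.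
- by apply: continuous_measurable_fun; exact: continuous_expRM.
- move=> y /=; rewrite in_itv/= => yc; rewrite ger0_norm ?expR_ge0// -expRD ler_expR.
  have h1 := ler_norm c; have h2 := normr_ge0 c.
  have : d * (y + `|y|) <= d * (2 * `|c|).
    by rewrite (ler_wpM2l (ltW d0))//; have [y0|y0] := leP 0 y; rewrite ?(ger0_norm y0) ?(ltr0_norm y0); lra.
  by lra.
- apply: integrable_scalel => //; apply: (@integrable_subset _ _ setT) => //.
  exact: integrable_expRabs.
Qed.

End ExpIntegrals.

(** * Integrals of complex valued functions of a real variable *)

Section ComplexFunctions.
Context {R : realType}.
Notation mu := (@lebesgue_measure R).
Implicit Types (f g : R -> R[i]) (z c : R[i]) (D : set R).

(** Continuity, measurability, derivatives and integrals of complex valued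
functions are taken componentwise, which makes the theorems on real functions
apply to each component. *)
Definition ccont f :=
  continuous (fun x => complex.Re (f x)) /\ continuous (fun x => complex.Im (f x)).

Definition cmeas f :=
  measurable_fun setT (fun x => complex.Re (f x)) /\
  measurable_fun setT (fun x => complex.Im (f x)).

Definition cder f f' := forall x : R,
  is_derive x 1 (fun x => complex.Re (f x)) (complex.Re (f' x)) /\
  is_derive x 1 (fun x => complex.Im (f x)) (complex.Im (f' x)).

Lemma ReM z c : complex.Re (z * c) =
  complex.Re z * complex.Re c - complex.Im z * complex.Im c.
Proof. by case: z => ? ?; case: c. Qed.

Lemma ImM z c : complex.Im (z * c) =
  complex.Re z * complex.Im c + complex.Im z * complex.Re c.
Proof. by case: z => ? ?; case: c. Qed.

Lemma ReD z c : complex.Re (z + c) = complex.Re z + complex.Re c.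
Proof. by case: z => ? ?; case: c. Qed.

Lemma ImD z c : complex.Im (z + c) = complex.Im z + complex.Im c.
Proof. by case: z => ? ?; case: c. Qed.

Lemma ReN z : complex.Re (- z) = - complex.Re z.
Proof. by case: z. Qed.

Lemma ImN z : complex.Im (- z) = - complex.Im z.
Proof. by case: z. Qed.

Lemma ccont_meas f : ccont f -> cmeas f.
Proof. by case=> ? ?; split; exact: continuous_measurable_fun. Qed.

Lemma ccont_real (k : R -> R) : continuous k -> ccont (fun x => (k x)%:C).
Proof. by move=> ck; split => //= x; exact: cvg_cst. Qed.

Lemma cmeas_real (k : R -> R) : measurable_fun setT k -> cmeas (fun x => (k x)%:C).
Proof. by move=> ck; split => //=; exact: measurable_cst. Qed.

Lemma ccont_cst c : ccont (fun=> c).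
Proof. by split => x; exact: cvg_cst. Qed.

Lemma ccontM f g : ccont f -> ccont g -> ccont (fun x => f x * g x).
Proof.
move=> [fr fi] [gr gi]; split=> x.
  under eq_fun do rewrite ReM.
  by apply: cvgB; apply: cvgM; [exact: fr|exact: gr|exact: fi|exact: gi].
under eq_fun do rewrite ImM.
by apply: cvgD; apply: cvgM; [exact: fr|exact: gi|exact: fi|exact: gr].
Qed.

Lemma ccontD f g : ccont f -> ccont g -> ccont (fun x => f x + g x).
Proof.
move=> [fr fi] [gr gi]; split=> x.
  by under eq_fun do rewrite ReD; apply: cvgD; [exact: fr|exact: gr].
by under eq_fun do rewrite ImD; apply: cvgD; [exact: fi|exact: gi].
Qed.

Lemma cmeasM f g : cmeas f -> cmeas g -> cmeas (fun x => f x * g x).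
Proof.
move=> [fr fi] [gr gi]; split.
  by under eq_fun do rewrite ReM; apply: measurable_funB; exact: measurable_funM.
by under eq_fun do rewrite ImM; apply: measurable_funD; exact: measurable_funM.
Qed.

Lemma cder_cont f f' : cder f f' -> ccont f.
Proof.
move=> h; split=> x; have [h1 h2] := h x.
  exact: derive_continuous h1.
exact: derive_continuous h2.
Qed.

Lemma cder_eq f f' g : cder f f' -> f' =1 g -> cder f g.
Proof. by move=> h e x; rewrite -e; exact: h. Qed.

Lemma cder_real (k k' : R -> R) : (forall x : R, is_derive x 1 k (k' x)) ->
  cder (fun x => (k x)%:C) (fun x => (k' x)%:C).
Proof. by move=> h x; split => //=; exact: is_derive_cst. Qed.

Lemma cder_cst c : cder (fun=> c) (fun=> 0).
Proof. by move=> x; split => /=; exact: is_derive_cst. Qed.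

Lemma cderD f g f' g' : cder f f' -> cder g g' ->
  cder (fun x => f x + g x) (fun x => f' x + g' x).
Proof.
move=> hf hg x; have [fr fi] := hf x; have [gr gi] := hg x; split.
  by under eq_fun do rewrite ReD; rewrite ReD; exact: is_deriveD.
by under eq_fun do rewrite ImD; rewrite ImD; exact: is_deriveD.
Qed.

Lemma cderM f g f' g' : cder f f' -> cder g g' ->
  cder (fun x => f x * g x) (fun x => f' x * g x + f x * g' x).
Proof.
move=> hf hg x; have [fr fi] := hf x; have [gr gi] := hg x; split.
  under eq_fun do rewrite ReM; rewrite ReD !ReM.
  by apply: is_derive_eq; rewrite /GRing.scale/=; ring.
under eq_fun do rewrite ImM; rewrite ImD !ImM.
by apply: is_derive_eq; rewrite /GRing.scale/=; ring.
Qed.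

Lemma cexpMr z (y : R) : cexp (z * y%:C) =
  (expR (complex.Re z * y) * cos (complex.Im z * y)) +i*
  (expR (complex.Re z * y) * sin (complex.Im z * y)).
Proof.
case: z => a b; rewrite /cexp /= !mulr0 subr0 add0r.
by apply/eqP; rewrite eq_complex/= !mul0r subr0 addr0 !eqxx.
Qed.

Lemma normc_cexpMr z (y : R) : normc (cexp (z * y%:C)) = expR (complex.Re z * y).
Proof. by rewrite normc_cexp ReM/= mulr0 subr0. Qed.

Lemma cder_cexp z : cder (fun y => cexp (z * y%:C)) (fun y => z * cexp (z * y%:C)).
Proof.
move=> x; case: z => a b; split.
  under eq_fun do rewrite cexpMr; rewrite ReM cexpMr /=.
  by apply: is_derive_eq; rewrite /GRing.scale/=; ring.
under eq_fun do rewrite cexpMr; rewrite ImM cexpMr /=.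
by apply: is_derive_eq; rewrite /GRing.scale/=; ring.
Qed.

Lemma ccont_cexp z : ccont (fun y => cexp (z * y%:C)).
Proof. exact: cder_cont (cder_cexp z). Qed.

Lemma cmeas_cexp z : cmeas (fun y => cexp (z * y%:C)).
Proof. exact: ccont_meas (ccont_cexp z). Qed.

End ComplexFunctions.

Section ComplexIntegral.
Context {R : realType}.
Notation mu := (@lebesgue_measure R).
Implicit Types (f g : R -> R[i]) (z c : R[i]) (D : set R).

Definition cint D f : R[i] :=
  (\int[mu]_(x in D) complex.Re (f x)) +i* (\int[mu]_(x in D) complex.Im (f x)).

Definition cintegrable D f :=
  mu.-integrable D (EFin \o (fun x => complex.Re (f x))) /\
  mu.-integrable D (EFin \o (fun x => complex.Im (f x))).

Lemma eq_cint D f g : {in D, f =1 g} -> cint D f = cint D g.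
Proof.
by move=> fg; congr (_ +i* _); apply: eq_Rintegral => x /fg ->.
Qed.

Lemma cintegrable_le D f (g : R -> R) : measurable D -> cmeas f ->
  (forall x, D x -> normc (f x) <= g x) -> mu.-integrable D (EFin \o g) ->
  cintegrable D f.
Proof.
move=> mD [mr mi] fg ig; split; apply: (integrable_le _ _ _ ig) => // x Dx.
  exact: le_trans (le_Re_normc _) (fg _ Dx).
exact: le_trans (le_Im_normc _) (fg _ Dx).
Qed.

(** The real and imaginary parts are bounded separately, hence the factor 2. *)
Lemma cint_le D f (g : R -> R) : measurable D -> cintegrable D f ->
  mu.-integrable D (EFin \o g) -> (forall x, D x -> normc (f x) <= g x) ->
  normc (cint D f) <= 2 * \int[mu]_(x in D) g x.
Proof.
move=> mD [ir ii] ig fg; apply: le_trans (normc_le_ReIm _) _.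
rewrite mulr_natl mulr2n; apply: lerD; apply: Rintegral_le_bound => // x Dx.
  exact: le_trans (le_Re_normc _) (fg _ Dx).
exact: le_trans (le_Im_normc _) (fg _ Dx).
Qed.

Lemma cintegrableD D f g : measurable D -> cintegrable D f -> cintegrable D g ->
  cintegrable D (fun x => f x + g x).
Proof.
move=> mD [fr fi] [gr gi]; split.
  by under eq_fun do rewrite ReD; exact: integrable_add.
by under eq_fun do rewrite ImD; exact: integrable_add.
Qed.

Lemma cintD D f g : measurable D -> cintegrable D f -> cintegrable D g ->
  cint D (fun x => f x + g x) = cint D f + cint D g.
Proof.
move=> mD [fr fi] [gr gi]; rewrite /cint.
under eq_Rintegral do rewrite ReD.
under [X in _ +i* X]eq_Rintegral do rewrite ImD.
by rewrite !RintegralD.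
Qed.

Lemma cintegrableZ D c f : measurable D -> cintegrable D f ->
  cintegrable D (fun x => c * f x).
Proof.
move=> mD [fr fi]; split.
  under eq_fun do rewrite ReM -mulNr.
  by apply: integrable_add => //; exact: integrable_scalel.
under eq_fun do rewrite ImM.
by apply: integrable_add => //; exact: integrable_scalel.
Qed.

Lemma cintZ D c f : measurable D -> cintegrable D f ->
  cint D (fun x => c * f x) = c * cint D f.
Proof.
move=> mD [fr fi]; rewrite /cint.
under eq_Rintegral do rewrite ReM -mulNr.
under [X in _ +i* X]eq_Rintegral do rewrite ImM.
rewrite !RintegralD//; try exact: integrable_scalel.
rewrite !RintegralZl//.
by case: c => a b; apply/eqP; rewrite eq_complex/= mulNr !eqxx.
Qed.

Lemma cintegrable_segment (a b : R) f : ccont f -> cintegrable `[a, b] f.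
Proof. by move=> [fr fi]; split; apply: integrable_segment; exact: in1W. Qed.

Lemma cint_FTC (a b : R) f f' : a <= b -> cder f f' -> ccont f' ->
  cint `[a, b] f' = f b - f a.
Proof.
move=> ab df [cr ci].
have -> : f b - f a = (complex.Re (f b) - complex.Re (f a)) +i*
    (complex.Im (f b) - complex.Im (f a)).
  by case: (f a) => ? ?; case: (f b).
congr (_ +i* _).
  exact: (@Rintegral_FTC _ _ _ _ (fun x => complex.Re (f x)) ab
    (fun x _ => (df x).1) (in1W cr)).
exact: (@Rintegral_FTC _ _ _ _ (fun x => complex.Im (f x)) ab
  (fun x _ => (df x).2) (in1W ci)).
Qed.

Lemma cint_shift (a b t : R) f : a <= b -> ccont f ->
  cint `[a, b] (fun x => f (x + t)) = cint `[a + t, b + t] f.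
Proof.
move=> ab [cr ci]; congr (_ +i* _).
  exact: (@Rintegral_shift _ _ _ _ (fun x => complex.Re (f x))).
exact: (@Rintegral_shift _ _ _ _ (fun x => complex.Im (f x))).
Qed.

Lemma cint_oppr (a b : R) f : a <= b -> ccont f ->
  cint `[- b, - a] f = cint `[a, b] (fun x => f (- x)).
Proof.
move=> ab [cr ci]; congr (_ +i* _).
  exact: (@Rintegral_oppr _ _ _ (fun x => complex.Re (f x))).
exact: (@Rintegral_oppr _ _ _ (fun x => complex.Im (f x))).
Qed.

Lemma cint_split (a b c : R) f : a <= b -> b <= c -> ccont f ->
  cint `[a, c] f = cint `[a, b] f + cint `[b, c] f.
Proof.
move=> ab bc [cr ci]; rewrite /cint.
by rewrite (Rintegral_split ab bc cr) (Rintegral_split ab bc ci).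
Qed.

Lemma cint_dominated D (f_ : nat -> R -> R[i]) f (g : R -> R) : measurable D ->
  (forall n, cmeas (f_ n)) ->
  (forall x, D x -> f_ n x @[n --> \oo] --> (f x : R[i]^o)) ->
  mu.-integrable D (EFin \o g) ->
  (forall n x, D x -> normc (f_ n x) <= g x) ->
  cint D (f_ n) @[n --> \oo] --> (cint D f : R[i]^o).
Proof.
move=> mD mf f_f ig f_g; apply/cvgc_ReIm; split => /=.
  apply: (proj2 (Rintegral_dominated mD _ _ ig _)).
  - by move=> n; apply: measurable_funTS; exact: (mf n).1.
  - by move=> x Dx; exact: ((cvgc_ReIm _ _).1 (f_f _ Dx)).1.
  - by move=> n x Dx; exact: le_trans (le_Re_normc _) (f_g _ _ Dx).
apply: (proj2 (Rintegral_dominated mD _ _ ig _)).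
- by move=> n; apply: measurable_funTS; exact: (mf n).2.
- by move=> x Dx; exact: ((cvgc_ReIm _ _).1 (f_f _ Dx)).2.
- by move=> n x Dx; exact: le_trans (le_Im_normc _) (f_g _ _ Dx).
Qed.

End ComplexIntegral.

(** * Oscillatory integrals: the van der Corput bound *)

Section VanDerCorput.
Context {R : realType}.
Notation mu := (@lebesgue_measure R).
Variables s t : R.

Let phi (x : R) := 2 * pi * expR x + s * x + t.
Let dphi (x : R) := 2 * pi * expR x + s.

(** On the critical line the real and imaginary parts of
2 cos (2 pi e^x) e^(z x) are a sum and a difference of two such functions, with
frequencies s = Im z and s = - Im z. *)
Definition chirp (x : R) := expR (x / 2) * cos (2 * pi * expR x + s * x + t).

Let V a b := \int[mu]_(x in `[a, b]) chirp x.

Let is_derive_phi (x : R) : is_derive x 1 phi (dphi x).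
Proof. by apply: is_derive_eq; rewrite /dphi /GRing.scale/=; ring. Qed.

Let is_derive_half (x : R) : is_derive x 1 (fun x => expR (x / 2)) (expR (x / 2) / 2).
Proof. by apply: is_derive_eq; rewrite /GRing.scale/=; ring. Qed.

Lemma chirp_cont : continuous chirp.
Proof.
move=> x; apply: cvgM.
  exact: (derive_continuous (is_derive_half x)).
apply: (@continuous_comp _ _ _ phi cos); last exact: continuous_cos.
exact: (derive_continuous (is_derive_phi x)).
Qed.

Let trivial_bound a b : a <= b -> `|V a b| <= 2 * (expR (b / 2) - expR (a / 2)).
Proof.
move=> ab; rewrite /V.
have -> : 2 * (expR (b / 2) - expR (a / 2)) = \int[mu]_(x in `[a, b]) expR (x / 2).
  rewrite mulrBr; symmetry.
  apply: (@Rintegral_FTC _ a b (fun x => expR (x / 2)) (fun x => 2 * expR (x / 2))) => //.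
    by move=> x _; apply: is_derive_eq; rewrite /GRing.scale/=; field.
  by move=> x _; exact: (derive_continuous (is_derive_half x)).
apply: Rintegral_le_bound => //.
- by apply: integrable_segment => x _; exact: chirp_cont.
- by apply: integrable_segment => x _; exact: (derive_continuous (is_derive_half x)).
- move=> x _; rewrite /chirp normrM (ger0_norm (expR_ge0 _)) ler_piMr ?expR_ge0//.
  exact: cos_max.
Qed.

Let A (x : R) := expR (x / 2) / dphi x.
Let dA (x : R) := expR (x / 2) * (s - 2 * pi * expR x) / (2 * dphi x ^+ 2).

Let is_derive_dphi (x : R) : is_derive x 1 dphi (2 * pi * expR x).
Proof. by apply: is_derive_eq; rewrite /GRing.scale/=; ring. Qed.

Let is_derive_A (x : R) : dphi x != 0 -> is_derive x 1 A (dA x).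
Proof.
move=> p0; have := is_deriveV p0 (is_derive_dphi x) => h.
apply: is_derive_eq; rewrite /GRing.scale/= /dA.
set d := dphi x in p0 *; have -> : s = d - 2 * pi * expR x by rewrite /d/dphi; ring.
by field.
Qed.

Let continuous_dA (x : R) : dphi x != 0 -> {for x, continuous dA}.
Proof.
move=> p0; apply: cvgM.
  apply: cvgM; first exact: (derive_continuous (is_derive_half x)).
  apply: (@derive_continuous _ (fun x => s - 2 * pi * expR x) x (- (2 * pi * expR x))).
  by apply: is_derive_eq; rewrite /GRing.scale/=; ring.
apply: cvgV; first by rewrite mulf_neq0// expf_neq0.
apply: cvgM; first exact: cvg_cst.
apply: (@derive_continuous _ (fun x => dphi x ^+ 2) x (2 * dphi x * (2 * pi * expR x))).
have := is_derive_dphi x => h.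
by apply: is_derive_eq; rewrite /GRing.scale/=; ring.
Qed.

(** First derivative test. With A = e^(x/2) / phi', the chirp is A times the
derivative of sin phi; integrating by parts leaves boundary terms and the total
variation of A, which is at most 2 when A is monotone and bounded by 1 at the
ends. The derivative of A has the sign of s - 2 pi e^x, and e = 1 or -1 records
this sign. *)
Let nonstationary_bound (a b e : R) : a <= b -> `|e| = 1 ->
  (forall x, a <= x <= b -> dphi x != 0 /\ 0 <= e * (s - 2 * pi * expR x)) ->
  `|A a| <= 1 -> `|A b| <= 1 -> `|V a b| <= 4.
Proof.
move=> ab e1 H Aa Ab.
have H1 x : x \in `[a, b] -> dphi x != 0.
  by rewrite in_itv/= => /H[].
have csin x : {for x, continuous (fun x => sin (phi x))}.
  apply: (@continuous_comp _ _ _ phi sin); last exact: continuous_sin.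
  exact: (derive_continuous (is_derive_phi x)).
have i1 : mu.-integrable `[a, b] (EFin \o (fun x => dA x * sin (phi x))).
  by apply: integrable_segment => x /H1 h; apply: cvgM; [exact: continuous_dA|exact: csin].
have i2 : mu.-integrable `[a, b] (EFin \o dA).
  by apply: integrable_segment => x /H1 h; exact: continuous_dA.
have i3 : mu.-integrable `[a, b] (EFin \o chirp).
  by apply: integrable_segment => x _; exact: chirp_cont.
have F1 : \int[mu]_(x in `[a, b]) (dA x * sin (phi x) + chirp x) =
    A b * sin (phi b) - A a * sin (phi a).
  apply: (@Rintegral_FTC _ a b (fun x => dA x * sin (phi x) + chirp x) (fun x => A x * sin (phi x))) => //.
    move=> x /[dup] /H[p0 _] xab.
    have h1 := is_derive_A p0; have h2 := is_derive_phi x.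
    apply: is_derive_eq; rewrite /GRing.scale/= /chirp -/(phi x) /A.
    by field.
  move=> x /H1 h; apply: cvgD; last exact: chirp_cont.
  by apply: cvgM; [exact: continuous_dA|exact: csin].
have F2 : \int[mu]_(x in `[a, b]) (e * dA x) = e * (A b - A a).
  rewrite RintegralZl//; congr (_ * _); apply: (@Rintegral_FTC _ a b dA A) => //.
    by move=> x /H[h _]; exact: is_derive_A.
  by move=> x /H1 h; exact: continuous_dA.
rewrite RintegralD// in F1.
have F3 : `|\int[mu]_(x in `[a, b]) (dA x * sin (phi x))| <= e * (A b - A a).
  rewrite -F2; apply: Rintegral_le_bound => //; first exact: integrable_scalel.
  move=> x /=; rewrite in_itv/= => xab; have [p0 se] := H _ xab.
  have e0 : 0 <= e * dA x.
    rewrite /dA mulrA mulrCA; apply: mulr_ge0; last by rewrite invr_ge0 mulr_ge0// sqr_ge0.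
    by rewrite mulr_ge0// expR_ge0.
  have -> : e * dA x = `|dA x| by rewrite -(ger0_norm e0) (normrM e (dA x)) e1 mul1r.
  by rewrite (normrM (dA x) (sin (phi x))) ler_piMr// sin_max.
have F4 : e * (A b - A a) <= 2.
  apply: le_trans (ler_norm _) _; rewrite normrM e1 mul1r.
  by apply: le_trans (ler_normB _ _) _; lra.
have F5 : `|A b * sin (phi b)| <= 1.
  by rewrite normrM -(mulr1 1); apply: ler_pM => //; exact: sin_max.
have F6 : `|A a * sin (phi a)| <= 1.
  by rewrite normrM -(mulr1 1); apply: ler_pM => //; exact: sin_max.
have -> : V a b = (A b * sin (phi b) - A a * sin (phi a))
  - \int[mu]_(x in `[a, b]) (dA x * sin (phi x)) by rewrite -F1 /V; ring.
apply: le_trans (ler_normB _ _) _.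
have F7 := ler_normB (A b * sin (phi b)) (A a * sin (phi a)).
by lra.
Qed.

Let cut_at (D : R -> Prop) (p c1 c2 : R) : D p ->
  (forall a b, a <= b -> D a -> D b -> b <= p -> `|V a b| <= c1) ->
  (forall a b, a <= b -> D a -> D b -> p <= a -> `|V a b| <= c2) ->
  forall a b, a <= b -> D a -> D b -> `|V a b| <= c1 + c2.
Proof.
move=> Dp h1 h2 a b ab Da Db.
have V0 (x : R) : V x x = 0 by rewrite /V set_itv1 Rintegral_set1.
have c10 : 0 <= c1 by have := h1 p p (lexx _) Dp Dp (lexx _); rewrite V0 normr0.
have c20 : 0 <= c2 by have := h2 p p (lexx _) Dp Dp (lexx _); rewrite V0 normr0.
have [bp|pb] := leP b p; first by have := h1 a b ab Da Db bp; lra.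
have [ap|pa] := leP a p; last by have := h2 a b ab Da Db (ltW pa); lra.
rewrite /V (Rintegral_split ap (ltW pb) chirp_cont).
apply: le_trans (ler_normD _ _) _; apply: lerD.
  exact: h1.
by apply: h2 => //; exact: ltW.
Qed.

Let expR_half_le2 : expR (1 / 2) <= 2 :> R.
Proof.
have := expR_ge1Dx (- (1 / 2) : R); rewrite expRN => h.
have e0 := expR_gt0 (1 / 2 : R).
have : expR (1 / 2) * (1 / 2) <= expR (1 / 2 : R) * (expR (1 / 2))^-1.
  by rewrite ler_pM2l//; lra.
by rewrite divff ?gt_eqF//; lra.
Qed.

Let pi1 : 1 <= pi :> R.
Proof. by have := pi_ge2 R; lra. Qed.

Let expR_half (x : R) : expR x = expR (x / 2) ^+ 2.
Proof. by rewrite -expRM_natl; congr expR; field. Qed.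

Let expR_ge1 (x : R) : 0 <= x -> 1 <= expR x.
Proof. by move=> x0; have := expR_ge1Dx x; lra. Qed.

(** Towards -oo no cancellation is needed: the weight e^(x/2) is integrable. *)
Let left_bound p a b : a <= b -> b <= p -> `|V a b| <= 2 * expR (p / 2).
Proof.
move=> ab bp; apply: le_trans (trivial_bound ab) _.
have : expR (b / 2) <= expR (p / 2) by rewrite ler_expR; lra.
by have := expR_gt0 (a / 2); lra.
Qed.

Let A_le1 x : dphi x != 0 -> expR (x / 2) <= `|dphi x| -> `|A x| <= 1.
Proof.
move=> p0 h; rewrite /A normrM normfV (ger0_norm (expR_ge0 _)).
by rewrite ler_pdivrMr ?normr_gt0// mul1r.
Qed.

(** For s > 0 the phase has no stationary point, and A changes its direction of
variation once, where 2 pi e^x = s. *)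
Let bound_spos : 0 < s -> forall a b, a <= b -> `|V a b| <= 10.
Proof.
move=> s0; have dphi0 x : 0 < dphi x.
  by rewrite /dphi addr_gt0// mulr_gt0 ?expR_gt0// mulr_gt0// pi_gt0.
have A1 x : 0 <= x -> `|A x| <= 1.
  move=> x0; apply: A_le1; first by rewrite gt_eqF.
  rewrite (gtr0_norm (dphi0 x)) /dphi (expR_half x).
  have : 1 <= expR (x / 2) by apply: expR_ge1; lra.
  set q := expR (x / 2) => q1; have q2 : q <= q ^+ 2 by nra.
  have : 1 * q ^+ 2 <= pi * q ^+ 2 by rewrite ler_wpM2r ?sqr_ge0// pi1.
  by lra.
have := @cut_at (fun=> True) 0 2 8 I _ _; rewrite (_ : 2 + 8 = 10); last by ring.
move=> h a b ab; apply: h => // {a b ab} a b ab _ _.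
  by move=> b0; have := left_bound ab b0; rewrite mul0r expR0 mulr1.
have lnE : expR (ln (s / (2 * pi))) = s / (2 * pi).
  by rewrite lnK// posrE divr_gt0// mulr_gt0// pi_gt0.
have pp : 0 < 2 * pi :> R by rewrite mulr_gt0// pi_gt0.
have sE : s = 2 * pi * (s / (2 * pi)) by rewrite mulrC divfK// gt_eqF.
move=> a0; pose y1 := Num.max 0 (ln (s / (2 * pi))).
have := @cut_at (fun x => 0 <= x) y1 4 4 _ _ _; rewrite (_ : 4 + 4 = 8); last by ring.
apply => //.
- by rewrite le_max lexx.
- move=> {ab a0 a b} a b ab a0 b0 by1.
  have [l0|l0] := leP 0 (ln (s / (2 * pi))).
    apply: (@nonstationary_bound a b 1) => //; rewrite ?normr1//; [|exact: A1|exact: A1].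
    move=> x /andP[ax xb]; split; first by rewrite gt_eqF.
    rewrite mul1r subr_ge0 [leRHS]sE ler_pM2l// -lnE ler_expR.
    by apply: le_trans xb _; move: by1; rewrite /y1 max_r.
  have bE : b <= 0 by move: by1; rewrite /y1 (max_l (ltW l0)).
  have -> : b = a by apply: le_anti; rewrite ab (le_trans bE a0).
  by rewrite /V set_itv1 Rintegral_set1 normr0.
- move=> {ab a0 a b} a b ab a0 b0 y1a.
  apply: (@nonstationary_bound a b (-1)) => //; rewrite ?normrN1//; [|exact: A1|exact: A1].
  move=> x /andP[ax xb]; split; first by rewrite gt_eqF.
  rewrite mulN1r opprB subr_ge0 [leLHS]sE ler_pM2l// -lnE ler_expR.
  by apply: le_trans ax; apply: le_trans y1a; rewrite /y1 le_max lexx orbT.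
- exact: le_trans ab.
Qed.

Let neg_sign x : s <= 0 -> 0 <= -1 * (s - 2 * pi * expR x).
Proof.
move=> s0; have : 0 <= 2 * pi * expR x by rewrite !mulr_ge0 ?expR_ge0 ?pi_ge0.
by lra.
Qed.

(** Here the stationary point lies in x <= 0 where the weight is small, and
phi' exceeds e^(x/2) as soon as x >= 2. *)
Let bound_ssmall : - (2 * pi) <= s -> s <= 0 -> forall a b, a <= b -> `|V a b| <= 12.
Proof.
move=> s1 s0.
have := @cut_at (fun=> True) 2 8 4 I _ _; rewrite (_ : 8 + 4 = 12); last by ring.
move=> h a b ab; apply: h => // {a b ab} a b ab _ _.
  move=> b2; apply: le_trans (left_bound ab b2) _; rewrite divff//.
  have := expR_half_le2; have := expR_gt0 (1 / 2 : R).
  by rewrite (expR_half 1); nra.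
move=> a2.
have h x : 2 <= x -> 0 < dphi x /\ expR (x / 2) <= dphi x.
  move=> x2; rewrite /dphi (expR_half x).
  have : 2 <= expR (x / 2) by apply: le_trans (expR_ge1Dx _); lra.
  have p1 := pi1; set q := expR _ => q2.
  have : pi * 2 <= pi * (q ^+ 2 - 1) by rewrite ler_wpM2l ?pi_ge0//; nra.
  have : 1 * (q ^+ 2 - 1) <= pi * (q ^+ 2 - 1) by rewrite ler_wpM2r//; nra.
  by split; [|]; nra.
have A1 x : 2 <= x -> `|A x| <= 1.
  by move=> /h[p0 p1]; apply: A_le1; rewrite ?gt_eqF// gtr0_norm.
apply: (@nonstationary_bound a b (-1)) => //; rewrite ?normrN1//.
- move=> x /andP[ax xb]; split; last exact: neg_sign.
  by have [p0 _] := h _ (le_trans a2 ax); rewrite gt_eqF.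
- exact: A1.
- by apply: A1; exact: le_trans ab.
Qed.

(** The phase is stationary at y0 = ln (- s / (2 pi)) >= 0, with second
derivative 2 pi e^y0. In the window of half-width d = e^(- y0 / 2) around y0 the
integrand is O(e^(y0 / 2)) and the window contributes a bounded amount; outside
it the modulus of phi' is at least e^(x/2), so that the first derivative test
applies on each side. *)
Let bound_sneg : s <= - (2 * pi) -> forall a b, a <= b -> `|V a b| <= 12.
Proof.
move=> s1.
have pp : 0 < 2 * pi :> R by rewrite mulr_gt0// pi_gt0.
have s0 : s < 0 by lra.
pose y0 := ln (- s / (2 * pi)).
have sE : s = - (2 * pi * expR y0).
  rewrite /y0 lnK ?posrE ?divr_gt0 ?oppr_gt0//.
  by rewrite mulrC divfK ?opprK// gt_eqF.
have y00 : 0 <= y0.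
  by rewrite -ler_expR expR0 -(ler_pM2l pp) mulr1; lra.
pose d := expR (- (y0 / 2)).
have d0 : 0 < d by exact: expR_gt0.
have d1 : d <= 1 by rewrite expR_le1; lra.
have dE : d * expR (y0 / 2) = 1 by rewrite /d -expRD addNr expR0.
have dphiE x : dphi x = 2 * pi * (expR x - expR y0) by rewrite /dphi sE; ring.
have hd : d / 2 <= 1 - expR (- d).
  have h1 := expR_ge1Dx d; rewrite expRN.
  have : (expR d)^-1 <= (1 + d)^-1 by rewrite lef_pV2 ?posrE ?expR_gt0//; lra.
  have : (1 + d)^-1 <= 1 - d / 2.
    by rewrite -div1r ler_pdivrMr; [nra|lra].
  by lra.
have p1 := pi1.
(* d >= e^(-x/2) here, so phi' = 2 pi (e^x - e^y0) >= e^x d >= e^(x/2). *)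
have hr x : y0 + d <= x -> 0 < dphi x /\ expR (x / 2) <= dphi x.
  move=> xd.
  have e1 : expR y0 <= expR x * expR (- d) by rewrite -expRD ler_expR; lra.
  have ex := expR_gt0 x.
  have e2 : expR x * (d / 2) <= expR x - expR y0.
    apply: (@le_trans _ _ (expR x * (1 - expR (- d)))); first by rewrite ler_pM2l.
    by lra.
  have e3 : 1 <= d * expR (x / 2).
    by rewrite /d -expRD; apply: expR_ge1; lra.
  have e4 : expR (x / 2) <= 2 * (expR x * (d / 2)).
    rewrite (_ : 2 * _ = expR x * d); last by field.
    by rewrite [in leRHS](expR_half x) expr2 -mulrA ler_peMr ?expR_ge0// mulrC.
  have e5 : 2 * (expR x - expR y0) <= dphi x.
    rewrite dphiE; have : 0 <= expR x - expR y0 by apply: le_trans e2; rewrite mulr_ge0//; lra.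
    by move=> ?; rewrite ler_wpM2r//; lra.
  by have := expR_gt0 (x / 2); split; lra.
(* Here e^(x/2) is below e^(y0/2) = e^y0 d, which bounds - phi' from below. *)
have hl x : x <= y0 - d -> dphi x < 0 /\ expR (x / 2) <= - dphi x.
  move=> xd.
  have e1 : expR x <= expR y0 * expR (- d) by rewrite -expRD ler_expR; lra.
  have ex := expR_gt0 y0.
  have e2 : expR y0 * (d / 2) <= expR y0 - expR x.
    apply: (@le_trans _ _ (expR y0 * (1 - expR (- d)))); first by rewrite ler_pM2l.
    by lra.
  have e4 : expR (y0 / 2) = 2 * (expR y0 * (d / 2)).
    rewrite (_ : 2 * _ = expR y0 * d); last by field.
    by rewrite [in RHS](expR_half y0) expr2 -mulrA [_ * d]mulrC dE mulr1.
  have e5 : 2 * (expR y0 - expR x) <= - dphi x.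
    rewrite dphiE -mulrN opprB; have : 0 <= expR y0 - expR x by apply: le_trans e2; rewrite mulr_ge0//; lra.
    by move=> ?; rewrite ler_wpM2r//; lra.
  have e6 : expR (x / 2) <= expR (y0 / 2) by rewrite ler_expR; lra.
  by have := expR_gt0 (x / 2); split; lra.
have := @cut_at (fun=> True) (y0 - d) 4 8 I _ _; rewrite (_ : 4 + 8 = 12); last by ring.
move=> h a b ab; apply: h => // {a b ab} a b ab _ _.
  move=> bd; have h x : x <= y0 - d -> dphi x != 0 /\ `|A x| <= 1.
    move=> /hl[u v]; have u0 : dphi x != 0 by rewrite lt_eqF.
    by split => //; apply: A_le1 => //; rewrite ltr0_norm.
  apply: (@nonstationary_bound a b (-1)) => //; rewrite ?normrN1//.
  - move=> x /andP[ax xb]; split; last exact/neg_sign/ltW.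
    by have [] := h _ (le_trans xb bd).
  - by have [] := h a (le_trans ab bd).
  - by have [] := h b bd.
move=> ad; have := @cut_at (fun x => y0 - d <= x) (y0 + d) 4 4 _ _ _.
rewrite (_ : 4 + 4 = 8); last by ring.
apply => //.
- lra.
- move=> {ab ad a b} a b ab ad _ bd; apply: (@le_trans _ _ (\int[mu]_(x in `[a, b]) (2 * expR (y0 / 2)))).
    apply: Rintegral_le_bound => //.
    + by apply: integrable_segment => x _; exact: chirp_cont.
    + by apply: integrable_segment => x _; exact: cvg_cst.
    + move=> x /=; rewrite in_itv/= => /andP[ax xb].
      rewrite /chirp normrM (ger0_norm (expR_ge0 _)).
      apply: (@le_trans _ _ (expR (x / 2))); first by rewrite ler_piMr ?expR_ge0// cos_max.
      have : expR (x / 2) <= expR (y0 / 2 + 1 / 2) by rewrite ler_expR; lra.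
      have := expR_half_le2; rewrite expRD; have := expR_gt0 (y0 / 2); nra.
  have -> : \int[mu]_(x in `[a, b]) (2 * expR (y0 / 2)) =
      2 * expR (y0 / 2) * b - 2 * expR (y0 / 2) * a.
    apply: (@Rintegral_FTC _ a b (fun=> 2 * expR (y0 / 2)) (fun x => 2 * expR (y0 / 2) * x)) => //.
      by move=> x _; apply: is_derive_eq; rewrite /GRing.scale/=; ring.
    by move=> x _; exact: cvg_cst.
  rewrite -mulrBr; apply: (@le_trans _ _ (2 * expR (y0 / 2) * (2 * d))).
    by rewrite ler_pM2l; [lra|have := expR_gt0 (y0 / 2); lra].
  by rewrite (_ : _ * _ = 4 * (d * expR (y0 / 2))); [rewrite dE; lra|ring].
- move=> {ab ad a b} a b ab _ _ ad; have h x : y0 + d <= x -> dphi x != 0 /\ `|A x| <= 1.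
    move=> /hr[u v]; have u0 : dphi x != 0 by rewrite gt_eqF.
    by split => //; apply: A_le1 => //; rewrite gtr0_norm.
  apply: (@nonstationary_bound a b (-1)) => //; rewrite ?normrN1//.
  - move=> x /andP[ax xb]; split; last exact/neg_sign/ltW.
    by have [] := h _ (le_trans ad ax).
  - by have [] := h a ad.
  - by have [] := h b (le_trans ad ab).
- exact: le_trans ab.
Qed.

Lemma chirp_integral_bound a b : a <= b ->
  `|\int[mu]_(x in `[a, b]) chirp x| <= 12.
Proof.
move=> ab; have [s0|s0] := ltP 0 s.
  by apply: le_trans (bound_spos s0 ab) _; lra.
have [h|h] := leP s (- (2 * pi)); first exact: bound_sneg.
by apply: bound_ssmall => //; exact: ltW.
Qed.

End VanDerCorput.

Local Arguments normc : simpl never.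

(** * Laplace transforms of bounded functions *)

Section Laplace.
Context {R : realType}.
Notation mu := (@lebesgue_measure R).
Implicit Types (K : R -> R) (w z : R[i]).

Lemma quadratic_derivable (f : R[i] -> R[i]) (w D : R[i]) (C e : R) : 0 < e ->
  (forall h, normc h <= e -> normc (f (h + w) - f w - h * D) <= C * normc h ^+ 2) ->
  derivable (f : R[i]^o -> R[i]^o) w 1.
Proof.
move=> e0 H; apply/cvg_ex; exists D; apply/cvgc_normc.
have idc : normc h @[h --> (0 : R[i]^o)^'] --> (0 : R).
  have /cvgc_normc : (h : R[i]) @[h --> (0 : R[i]^o)^'] --> (0 : R[i]^o).
    exact/cvg_within.
  by under eq_fun do rewrite subr0.
have near_e : \forall h \near (0 : R[i]^o)^', normc h <= e.
  move/cvgrPdist_le : idc => /(_ _ e0); apply: filterS => h.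
  by rewrite sub0r normrN ger0_norm ?normc_ge0.
have near_0 : \forall h \near (0 : R[i]^o)^', h != 0 by exact: nbhs_dnbhs_neq.
apply: (@squeeze_cvgr _ _ _ _ (fun=> 0) (fun h : R[i] => C * normc h)).
- near=> h; rewrite normc_ge0/= /GRing.scale/= mulr1.
  have h0 : h != 0 by near: h.
  have hn : 0 < normc h.
    by rewrite lt_neqAle normc_ge0 andbT eq_sym; apply: contra h0 => /eqP/eq0_normc ->.
  rewrite -(ler_pM2l hn) -normcM mulrBr mulrA divff// mul1r mulrCA -expr2.
  by apply: H; near: h.
- exact: cvg_cst.
- by rewrite -[X in _ --> X](mulr0 C); apply: cvgM => //; exact: cvg_cst.
Unshelve. all: by end_near. Qed.

Definition laplace K w : R[i] :=
  cint `[0, +oo[ (fun y => (K y)%:C * cexp (w * y%:C)).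

Variables (K : R -> R) (B : R).
Hypothesis mK : measurable_fun setT K.
Hypothesis KB : forall y, 0 <= y -> `|K y| <= B.

Let B0 : 0 <= B.
Proof. exact: le_trans (KB (lexx _)). Qed.

Let meas_itg w : cmeas (fun y => (K y)%:C * cexp (w * y%:C)).
Proof. by apply: cmeasM; [exact: cmeas_real|exact: cmeas_cexp]. Qed.

Let itg_le w y : 0 <= y ->
  normc ((K y)%:C * cexp (w * y%:C)) <= B * expR (complex.Re w * y).
Proof.
by move=> y0; rewrite normcM normc_real normc_cexpMr ler_wpM2r ?expR_ge0// KB.
Qed.

Let bound_itg (c d : R) : 0 < d ->
  mu.-integrable `[0, +oo[ (EFin \o (fun y => c * expR (- d * y))).
Proof. by move=> d0; apply: integrable_scalel => //; exact: integrable_expRN. Qed.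

Lemma laplace_integrable w : complex.Re w < 0 ->
  cintegrable `[0, +oo[ (fun y => (K y)%:C * cexp (w * y%:C)).
Proof.
move=> w0; apply: (@cintegrable_le _ _ _ (fun y => B * expR (- - complex.Re w * y))) => //.
  by move=> y /=; rewrite in_itv/= andbT opprK; exact: itg_le.
by apply: bound_itg; rewrite oppr_gt0.
Qed.

Lemma laplace_bound w : complex.Re w < 0 ->
  normc (laplace K w) <= 2 * (B * (- complex.Re w)^-1).
Proof.
move=> w0; have w1 : 0 < - complex.Re w by rewrite oppr_gt0.
rewrite -(Rintegral_expRN w1) -RintegralZl//; last exact: integrable_expRN.
apply: cint_le => //; [exact: laplace_integrable|exact: bound_itg|].
by move=> y /=; rewrite in_itv/= andbT opprK; exact: itg_le.
Qed.

Lemma laplace_cvg w (b : nat -> R) : complex.Re w < 0 -> b n @[n --> \oo] --> +oo ->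
  cint `[0, b n] (fun y => (K y)%:C * cexp (w * y%:C)) @[n --> \oo] -->
  (laplace K w : R[i]^o).
Proof.
move=> w0 binf.
pose f_ n (y : R) : R[i] := (if y <= b n then 1 else 0) * ((K y)%:C * cexp (w * y%:C)).
have E n : cint `[0, b n] (fun y => (K y)%:C * cexp (w * y%:C)) = cint `[0, +oo[ (f_ n).
  have I : `[0, b n]%classic = `[0, +oo[%classic `&` [set y | y <= b n].
    by apply/seteqP; split => y /=; rewrite !in_itv/= andbT => /andP.
  rewrite /cint I !Rintegral_mkcondr; congr (_ +i* _).
    apply: eq_Rintegral => y _; rewrite patchE /f_.
    case: ifPn => [/set_mem/= ->|/negP h]; first by rewrite mul1r.
    case: ifPn => [yb|]; last by rewrite mul0r.
    by exfalso; apply: h; apply/mem_set.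
  apply: eq_Rintegral => y _; rewrite patchE /f_.
  case: ifPn => [/set_mem/= ->|/negP h]; first by rewrite mul1r.
  case: ifPn => [yb|]; last by rewrite mul0r.
  by exfalso; apply: h; apply/mem_set.
under eq_fun do rewrite E.
apply: (@cint_dominated _ _ _ _ (fun y => B * expR (- - complex.Re w * y))) => //.
- move=> n; apply: cmeasM; last exact: meas_itg.
  have h : measurable_fun setT (fun y : R => if y <= b n then 1 : R else 0).
    apply: measurable_fun_ifT => //.
    by apply: measurable_fun_ler => //; exact: measurable_cst.
  have -> : (fun y : R => if y <= b n then 1 else 0 : R[i]) =
      (fun y => (if y <= b n then 1 else 0 : R)%:C).
    by apply/funext => y; case: ifP.
  exact: cmeas_real.
- move=> y /=; rewrite in_itv/= andbT => y0; apply: (@cvg_near_cst _ R[i]^o).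
  have /cvgryPge/(_ y) := binf; apply: filterS => n yb.
  by rewrite /f_ yb mul1r.
- by apply: bound_itg; rewrite oppr_gt0.
- move=> n y /=; rewrite in_itv/= andbT => y0; rewrite opprK /f_.
  case: ifP => _; first by rewrite mul1r itg_le.
  by rewrite mul0r normc0 mulr_ge0// expR_ge0.
Qed.

(** The derivative is the Laplace transform of y K(y). By cexp_taylor2 the
difference quotient is off by O(|h|) times the integral of
y^2 e^(|h| y) e^(Re w y); with e = - Re w / 4 and |h| <= e, both y^2 and e^(|h| y) are
absorbed by e^(e y) and the integrand still decays like e^(- 2 e y). *)
Lemma laplace_derivable w : complex.Re w < 0 ->
  derivable (laplace K : R[i]^o -> R[i]^o) w 1.
Proof.
move=> w0; pose e := - complex.Re w / 4.
have e0 : 0 < e by rewrite divr_gt0// oppr_gt0.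
have wE : complex.Re w = - (4 * e) by rewrite /e; field.
have ye (y : R) : 0 <= y -> y <= e^-1 * expR (e * y).
  move=> y0; rewrite -(ler_pM2l e0) mulrA divff ?gt_eqF// mul1r.
  by have := expR_ge1Dx (e * y); lra.
have y2e (y : R) : 0 <= y -> y ^+ 2 <= 2 * e^-1 ^+ 2 * expR (e * y).
  move=> y0; have ey0 : 0 <= e * y by rewrite mulr_ge0// ltW.
  have := expR_ge1Dxn 1 ey0; rewrite (_ : 2`!%:R = 2)// => h.
  have -> : y ^+ 2 = 2 * e^-1 ^+ 2 * ((e * y) ^+ 2 / 2) by field; rewrite gt_eqF.
  by rewrite ler_pM2l; [lra|rewrite mulr_gt0// exprn_gt0// invr_gt0].
pose K1 (y : R) := K y * y.
have mK1 : cmeas (fun y => (K1 y)%:C * cexp (w * y%:C)).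
  apply: cmeasM; last exact: cmeas_cexp.
  by apply: cmeas_real; exact: measurable_funM.
have I1 : cintegrable `[0, +oo[ (fun y => (K1 y)%:C * cexp (w * y%:C)).
  apply: (@cintegrable_le _ _ _ (fun y => B * e^-1 * expR (- (3 * e) * y))) => //.
    move=> y /=; rewrite in_itv/= andbT => y0.
    rewrite normcM normc_real normc_cexpMr /K1 normrM (ger0_norm y0) wE.
    have -> : expR (- (3 * e) * y) = expR (e * y) * expR (- (4 * e) * y).
      by rewrite -expRD; congr expR; ring.
    rewrite [leRHS](_ : _ = B * (e^-1 * expR (e * y)) * expR (- (4 * e) * y)); last by ring.
    by rewrite ler_wpM2r ?expR_ge0//; apply: ler_pM; rewrite ?KB ?ye ?normr_ge0.
  by apply: bound_itg; rewrite mulr_gt0.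
pose D := cint `[0, +oo[ (fun y => (K1 y)%:C * cexp (w * y%:C)).
apply: (@quadratic_derivable _ _ D (2 * (8 * B * e^-1 ^+ 2 * (2 * e)^-1)) e e0) => h he.
have hw0 : complex.Re (h + w) < 0.
  by rewrite ReD; have := le_trans (Re_le_normc h) he; lra.
have -> : laplace K (h + w) - laplace K w - h * D =
    cint `[0, +oo[ (fun y => (K y)%:C * cexp ((h + w) * y%:C) +
      (-1 * ((K y)%:C * cexp (w * y%:C)) + (- h) * ((K1 y)%:C * cexp (w * y%:C)))).
  rewrite cintD//; last 2 first.
  - exact: laplace_integrable.
  - apply: cintegrableD => //; apply: cintegrableZ => //; exact: laplace_integrable.
  rewrite cintD//; try (apply: cintegrableZ => //; exact: laplace_integrable).
  rewrite !cintZ//; last exact: laplace_integrable.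
  by rewrite /laplace -/D; ring.
have G0 : 0 < 2 * e by rewrite mulr_gt0.
apply: (@le_trans _ _ (2 * \int[mu]_(y in `[0, +oo[)
   (8 * B * e^-1 ^+ 2 * normc h ^+ 2 * expR (- (2 * e) * y)))).
  apply: cint_le => //.
  - apply: cintegrableD => //; first exact: laplace_integrable.
    apply: cintegrableD => //; apply: cintegrableZ => //; exact: laplace_integrable.
  - exact: bound_itg.
  move=> y /=; rewrite in_itv/= andbT => y0.
  have -> : (K y)%:C * cexp ((h + w) * y%:C) + (-1 * ((K y)%:C * cexp (w * y%:C))
      + (- h) * ((K1 y)%:C * cexp (w * y%:C))) =
      (K y)%:C * cexp (w * y%:C) * (cexp (h * y%:C) - 1 - h * y%:C).
    by rewrite mulrDl cexpD /K1 rmorphM/=; ring.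
  rewrite normcM; have t := cexp_taylor2 (h * y%:C).
  rewrite normcM normc_real (ger0_norm y0) in t.
  have a1 := itg_le w y0; rewrite wE in a1.
  apply: le_trans (ler_pM (normc_ge0 _) (normc_ge0 _) a1 t) _.
  have E1 : expR (normc h * y) <= expR (e * y) by rewrite ler_expR ler_wpM2r.
  have n2 : 0 <= normc h ^+ 2 by exact: sqr_ge0.
  have E2 : 4 * (normc h * y) ^+ 2 * expR (normc h * y) <=
     4 * normc h ^+ 2 * (2 * e^-1 ^+ 2 * expR (e * y)) * expR (e * y).
    have E3 : (normc h * y) ^+ 2 <= normc h ^+ 2 * (2 * e^-1 ^+ 2 * expR (e * y)).
      by rewrite exprMn ler_wpM2l// y2e.
    apply: ler_pM; [by rewrite mulr_ge0// sqr_ge0|exact: expR_ge0| |exact: E1].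
    by rewrite -[leRHS]mulrA ler_pM2l.
  apply: le_trans (ler_wpM2l _ E2) _; first by rewrite mulr_ge0// expR_ge0.
  have -> : expR (- (2 * e) * y) = expR (- (4 * e) * y) * expR (e * y) * expR (e * y).
    by rewrite -!expRD; congr expR; ring.
  by rewrite le_eqVlt; apply/orP; left; apply/eqP; ring.
rewrite RintegralZl//; last exact: integrable_expRN.
rewrite Rintegral_expRN//.
by rewrite le_eqVlt; apply/orP; left; apply/eqP; ring.
Qed.

End Laplace.

(** * The kernel 2 cos (2 pi x) in the logarithmic variable *)

Section Primitive.
Context {R : realType}.
Notation mu := (@lebesgue_measure R).

Lemma continuous_primitive (f : R -> R) : continuous f ->
  exists F : R -> R, forall x : R, is_derive x 1 F (f x).
Proof.
move=> cf.
pose F (x : R) := if 0 <= x then \int[mu]_(y in `[0, x]) f y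
                  else - \int[mu]_(y in `[x, 0]) f y.
exists F => x.
(* A base point to the left of both x and 0 turns F into one integral near x. *)
pose m := Num.min x 0 - 1.
have mx : m < x by rewrite /m ltrBlDr gt_min ltrDl ltr01.
have m0 : m <= 0 by rewrite /m lerBlDr ge_min lerDl ler01 orbT.
have FE y : m <= y -> F y = \int[mu]_(u in `[m, y]) f u - \int[mu]_(u in `[m, 0]) f u.
  move=> my; rewrite /F; case: ifPn => [y0|]; last rewrite -ltNge => /ltW y0.
    by rewrite (Rintegral_split m0 y0 cf) addrC addKr.
  by rewrite (Rintegral_split my y0 cf) opprD addNKr.
have x1 : x < x + 1 by rewrite ltrDl.
have [d1 d2] := @continuous_FTC1_closed R f m x (x + 1) x1
  (integrable_segment (in1W cf)) mx (cf x).
apply: (@near_eq_is_derive _ _ _ (fun y => \int[mu]_(u in `[m, y]) f u -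
  \int[mu]_(u in `[m, 0]) f u)).
  have := lt_nbhsr mx; apply: filterS => y my.
  by rewrite FE// ltW.
have h : is_derive x 1 (fun y => \int[mu]_(u in `[m, y]) f u) (f x).
  by apply: DeriveDef; [exact: d1|rewrite -derive1E; exact: d2].
by apply: is_derive_eq; rewrite subr0.
Qed.

Lemma ccont_primitive (f : R -> R[i]) : ccont f -> exists F, cder F f.
Proof.
move=> [cr ci]; have [Fr hr] := continuous_primitive cr.
have [Fi hi] := continuous_primitive ci.
by exists (fun x => Fr x +i* Fi x) => x; exact: (conj (hr x) (hi x)).
Qed.

Lemma limit_normc_le (u : nat -> R[i]) (l : R[i]) (b : R) :
  u n @[n --> \oo] --> (l : R[i]^o) -> (\forall n \near \oo, normc (u n) <= b) -> normc l <= b.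
Proof.
move=> ul ub; rewrite leNgt; apply/negP => bl.
move/cvgc_normc : ul => /cvgrPdist_lt/(_ (normc l - b)).
rewrite subr_gt0 => /(_ bl) h.
have [n [h1 h2]] : exists n, normc (u n) <= b /\ `|0 - normc (u n - l)| < normc l - b.
  by apply: (@filter_ex _ \oo); near=> n; split; near: n.
move: h2; rewrite sub0r normrN ger0_norm ?normc_ge0// normcB.
have := le_normcD (l - u n) (u n); rewrite subrK; lra.
Unshelve. all: by end_near. Qed.

End Primitive.

Section CosineKernel.
Context {R : realType}.
Notation mu := (@lebesgue_measure R).
Implicit Types (a y : R) (z : R[i]).

Definition coskernel y : R := 2 * cos (2 * pi * expR y).

(** The primitive of 2 cos (2 pi x) in the variable x = e^y. *)
Definition sinkernel y : R := sin (2 * pi * expR y) / pi.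

Definition cos_integrand z y : R[i] := (coskernel y)%:C * cexp (z * y%:C).

Lemma coskernel_cont : continuous coskernel.
Proof.
move=> y; apply: (@derive_continuous _ _ _ (- 2 * sin (2 * pi * expR y) * (2 * pi * expR y))).
by apply: is_derive_eq; rewrite /GRing.scale/=; ring.
Qed.

Lemma sinkernel_derive y : is_derive y 1 sinkernel (coskernel y * expR y).
Proof.
apply: is_derive_eq; rewrite /GRing.scale/= /coskernel.
have p0 : pi != 0 :> R by rewrite gt_eqF// pi_gt0.
by move: p0; move: (pi : R) => p p0; field.
Qed.

Lemma sinkernel_cont : continuous sinkernel.
Proof. by move=> y; exact: derive_continuous (sinkernel_derive y). Qed.

Lemma coskernel_le y : `|coskernel y| <= 2.
Proof.
rewrite /coskernel normrM ger0_norm// -[leRHS]mulr1 ler_pM2l//; exact: cos_max.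
Qed.

Lemma sinkernel_le y : `|sinkernel y| <= 1.
Proof.
rewrite /sinkernel normrM normfV (gtr0_norm (pi_gt0 R)) ler_pdivrMr ?pi_gt0// mul1r.
by apply: le_trans (sin_max _) _; have := pi_ge2 R; lra.
Qed.

Lemma cos_integrand_cont z : ccont (cos_integrand z).
Proof. by apply: ccontM; [exact/ccont_real/coskernel_cont|exact: ccont_cexp]. Qed.

(** The real part is a sum of two chirps with t = 0, the imaginary part a
difference of two chirps with t = pi / 2; hence 48 = 4 * 12. *)
Lemma cos_integrand_bound (a b : R) z : a <= b -> complex.Re z = 1 / 2 ->
  normc (cint `[a, b] (cos_integrand z)) <= 48.
Proof.
move=> ab zh; apply: le_trans (normc_le_ReIm _) _ => /=.
have it s t : mu.-integrable `[a, b] (EFin \o chirp s t).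
  by apply: integrable_segment => x _; exact: chirp_cont.
have [t tE] : exists t, complex.Im z = t by exists (complex.Im z).
have -> : \int[mu]_(x in `[a, b]) complex.Re (cos_integrand z x) =
    \int[mu]_(x in `[a, b]) (chirp t 0 x + chirp (- t) 0 x).
  apply: eq_Rintegral => x _; rewrite /cos_integrand cexpMr ReM/= mul0r subr0 zh tE.
  rewrite /chirp !addr0 /coskernel mulNr cosD cosB (_ : 1 / 2 * x = x / 2); last by field.
  by ring.
have -> : \int[mu]_(x in `[a, b]) complex.Im (cos_integrand z x) =
    \int[mu]_(x in `[a, b]) (chirp (- t) (pi / 2) x - chirp t (pi / 2) x).
  apply: eq_Rintegral => x _; rewrite /cos_integrand cexpMr ImM/= mul0r addr0 zh tE.
  rewrite /chirp !cosDpihalf /coskernel mulNr sinB sinD (_ : 1 / 2 * x = x / 2); last by field.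
  by ring.
rewrite RintegralD// RintegralB//.
have h s u := @chirp_integral_bound R s u a b ab.
have n1 := ler_normD (\int[mu]_(x in `[a, b]) chirp t 0 x) (\int[mu]_(x in `[a, b]) chirp (- t) 0 x).
have n2 := ler_normB (\int[mu]_(x in `[a, b]) chirp (- t) (pi / 2) x) (\int[mu]_(x in `[a, b]) chirp t (pi / 2) x).
have h1 := h t 0; have h2 := h (- t) 0; have h3 := h t (pi / 2); have h4 := h (- t) (pi / 2).
apply: le_trans (lerD n1 n2) _; apply: le_trans (lerD (lerD h1 h2) (lerD h4 h3)) _.
by rewrite -!natrD ler_nat.
Qed.

Lemma cos_integrand_shift a z y :
  (coskernel (y + a))%:C * cexp (z * y%:C) = cexp (- (z * a%:C)) * cos_integrand z (y + a).
Proof.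
rewrite /cos_integrand [RHS]mulrCA -cexpD; congr (_ * cexp _).
by rewrite rmorphD/=; ring.
Qed.

Lemma cos_integrand_shift_int a b c z : b <= c ->
  cint `[b, c] (fun y => (coskernel (y + a))%:C * cexp (z * y%:C)) =
  cexp (- (z * a%:C)) * cint `[b + a, c + a] (cos_integrand z).
Proof.
move=> bc; rewrite -(cint_shift a bc (cos_integrand_cont z)).
rewrite -cintZ//; first by apply: eq_cint => y _; exact: cos_integrand_shift.
apply: cintegrable_segment; have [h1 h2] := cos_integrand_cont z.
have sc : continuous (fun y : R => y + a).
  by move=> y; apply: cvgD; [exact: cvg_id|exact: cvg_cst].
split=> y.
  exact: (@continuous_comp _ _ _ (fun y => y + a) (fun y => complex.Re (cos_integrand z y)) _ (sc y) (h1 _)).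
exact: (@continuous_comp _ _ _ (fun y => y + a) (fun y => complex.Im (cos_integrand z y)) _ (sc y) (h2 _)).
Qed.

End CosineKernel.

(** * The two halves of the Mellin transform of the cosine *)

Section HalfMellin.
Context {R : realType}.
Notation mu := (@lebesgue_measure R).
Implicit Types (a y : R) (z : R[i]).

(** The integral of shifted a z over y > 0 converges only conditionally. One
integration by parts, with sinkernel as the primitive, gives this absolutely
convergent form, which makes sense for all Re z < 1. *)
Definition right_mell a z : R[i] := (expR (- a))%:C *
  ((1 - z) * laplace (fun y => sinkernel (y + a)) (z - 1) - (sinkernel a)%:C).

(** The integral of shifted a z over y < 0, reflected to y > 0. *)
Definition left_mell a z : R[i] := laplace (fun y => coskernel (a - y)) (- z).

Definition shifted a z y : R[i] := (coskernel (y + a))%:C * cexp (z * y%:C).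

Lemma ccvg_unique (u : nat -> R[i]) (k l : R[i]) :
  u n @[n --> \oo] --> (k : R[i]^o) -> u n @[n --> \oo] --> (l : R[i]^o) -> k = l.
Proof.
move=> /cvgc_ReIm[r1 i1] /cvgc_ReIm[r2 i2].
have := cvg_unique (@Rhausdorff R) r1 r2; have := cvg_unique (@Rhausdorff R) i1 i2.
by case: k {r1 i1} => ? ?; case: l {r2 i2} => ? ? /= -> ->.
Qed.

Let is_derive_shift a y (f : R -> R) l : is_derive (y + a) 1 f l ->
  is_derive y 1 (fun y => f (y + a)) l.
Proof.
move=> h; have h2 : is_derive y 1 (fun y : R => y + a) 1.
  by apply: is_derive_eq; rewrite addr0.
by have := @is_derive1_comp _ f (fun y => y + a) y l 1 h h2; rewrite mulr1.
Qed.

Lemma cont_shift a (f : R -> R) : continuous f -> continuous (fun y => f (y + a)).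
Proof.
move=> cf y; apply: (@continuous_comp _ _ _ (fun y => y + a) f); last exact: cf.
by apply: cvgD; [exact: cvg_id|exact: cvg_cst].
Qed.

Lemma shifted_cont a z : ccont (shifted a z).
Proof.
apply: ccontM; last exact: ccont_cexp.
by apply: ccont_real; apply: cont_shift; exact: coskernel_cont.
Qed.

Let sshift_cont a z : ccont (fun y => (sinkernel (y + a))%:C * cexp ((z - 1) * y%:C)).
Proof.
apply: ccontM; last exact: ccont_cexp.
by apply: ccont_real; apply: cont_shift; exact: sinkernel_cont.
Qed.

Lemma shifted_partial a z b : 0 <= b -> cint `[0, b] (shifted a z) =
  (expR (- a))%:C * ((1 - z) *
     cint `[0, b] (fun y => (sinkernel (y + a))%:C * cexp ((z - 1) * y%:C))
   - (sinkernel a)%:C + (sinkernel (b + a))%:C * cexp ((z - 1) * b%:C)).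
Proof.
move=> b0.
pose f (y : R) : R[i] := (sinkernel (y + a))%:C * cexp ((z - 1) * y%:C).
have df : cder f (fun y => (expR a)%:C * shifted a z y + (z - 1) * f y).
  have hs (y : R) : is_derive y 1 (fun y => sinkernel (y + a)) (coskernel (y + a) * expR (y + a)).
    exact: is_derive_shift (sinkernel_derive (y + a)).
  apply: cder_eq (cderM (cder_real hs) (cder_cexp (z - 1))) _.
  move=> y; rewrite /f /shifted /=.
  have e1 : (expR (y + a))%:C = (expR a)%:C * cexp y%:C :> R[i].
    by rewrite cexp_real -rmorphM/= -expRD addrC.
  have e2 : cexp (z * y%:C) = cexp y%:C * cexp ((z - 1) * y%:C).
    by rewrite -cexpD; congr cexp; ring.
  by rewrite e2 rmorphM/= e1; ring.
have is1 : cintegrable `[0, b] (shifted a z).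
  by apply: cintegrable_segment; exact: shifted_cont.
have is2 : cintegrable `[0, b] f.
  by apply: cintegrable_segment; exact: sshift_cont.
have cf' : ccont (fun y => (expR a)%:C * shifted a z y + (z - 1) * f y).
  apply: ccontD; apply: ccontM; try exact: ccont_cst; [exact: shifted_cont|exact: sshift_cont].
have := cint_FTC b0 df cf'.
rewrite cintD//; try exact: cintegrableZ.
rewrite !cintZ//.
have -> : f 0 = (sinkernel a)%:C by rewrite /f add0r mulr0 cexp0 mulr1.
rewrite -/(f b) => h.
have ea : (expR (- a))%:C * (expR a)%:C = 1 :> R[i].
  by rewrite -rmorphM/= -expRD addNr expR0.
have -> : cint `[0, b] (shifted a z) = (expR (- a))%:C * ((expR a)%:C * cint `[0, b] (shifted a z)).
  by rewrite mulrA ea mul1r.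
congr (_ * _).
have -> : (expR a)%:C * cint `[0, b] (shifted a z) =
  f b - (sinkernel a)%:C - (z - 1) * cint `[0, b] f by rewrite -h addrK.
by rewrite -/f -/(f b); ring.
Qed.

Let sB a y : 0 <= y -> `|sinkernel (y + a)| <= 1.
Proof. by move=> _; exact: sinkernel_le. Qed.

Let smeas a : measurable_fun setT (fun y => sinkernel (y + a)).
Proof. by apply: continuous_measurable_fun; apply: cont_shift; exact: sinkernel_cont. Qed.

Lemma cexp_cvg0 z (b : nat -> R) : complex.Re z < 0 -> b n @[n --> \oo] --> +oo ->
  normc (cexp (z * (b n)%:C)) @[n --> \oo] --> (0 : R).
Proof.
move=> z0 binf; under eq_fun do rewrite normc_cexpMr.
have -> : (fun n => expR (complex.Re z * b n)) = (fun n => expR (- (- complex.Re z * b n))).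
  by apply/funext => n; rewrite mulNr opprK.
apply: (@cvg_comp _ _ _ (fun n => - complex.Re z * b n) (fun x : R => expR (- x)) _ (pinfty_nbhs R)).
  have z1 : 0 < - complex.Re z by rewrite oppr_gt0.
  apply/cvgryPge => A; move/cvgryPge/(_ (A / - complex.Re z)) : binf.
  by apply: filterS => n; rewrite ler_pdivrMr// mulrC.
exact: cvgr_expR.
Qed.

Lemma right_mell_cvg a z (b : nat -> R) : complex.Re z < 1 -> b n @[n --> \oo] --> +oo ->
  cint `[0, b n] (shifted a z) @[n --> \oo] --> (right_mell a z : R[i]^o).
Proof.
move=> z1 binf; have zm : complex.Re (z - 1) < 0 by rewrite ReD/=; lra.
apply: (@cvg_near_eq _ _ _ _ _ (fun n => (expR (- a))%:C * ((1 - z) *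
     cint `[0, b n] (fun y => (sinkernel (y + a))%:C * cexp ((z - 1) * y%:C))
   - (sinkernel a)%:C + (sinkernel (b n + a))%:C * cexp ((z - 1) * (b n)%:C)))).
  have /cvgryPge/(_ 0) := binf; apply: filterS => n; exact: shifted_partial.
rewrite /right_mell -[X in (_ * X : R[i])]addr0.
apply: ccvgM; first exact: ccvg_cst.
apply: ccvgD.
  apply: ccvgB; last exact: ccvg_cst.
  apply: ccvgM; first exact: ccvg_cst.
  exact: (@laplace_cvg _ (fun y => sinkernel (y + a)) 1 (smeas a) (@sB a) (z - 1) b zm binf).
apply/cvgc_normc; apply: (@squeeze_cvgr _ _ _ _ (fun=> 0)
   (fun n => normc (cexp ((z - 1) * (b n)%:C)))).
- apply: nearW => n; rewrite normc_ge0/= subr0 normcM normc_real.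
  by rewrite ler_piMl ?normc_ge0// sinkernel_le.
- exact: cvg_cst.
- exact: cexp_cvg0.
Qed.

Lemma left_mell_cvg a z (b : nat -> R) : 0 < complex.Re z -> b n @[n --> \oo] --> +oo ->
  cint `[- b n, 0] (shifted a z) @[n --> \oo] --> (left_mell a z : R[i]^o).
Proof.
move=> z0 binf; have zm : complex.Re (- z) < 0 by rewrite ReN oppr_lt0.
apply: (@cvg_near_eq _ _ _ _ _ (fun n => cint `[0, b n]
    (fun y => (coskernel (a - y))%:C * cexp (- z * y%:C)))).
  have /cvgryPge/(_ 0) := binf; apply: filterS => n bn.
  rewrite -[X in `[_, X]]oppr0 (cint_oppr bn (shifted_cont a z)).
  by apply: eq_cint => y _; rewrite /shifted addrC rmorphN mulrN mulNr.
apply: (@laplace_cvg _ (fun y => coskernel (a - y)) 2) => //.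
  apply: continuous_measurable_fun => y.
  apply: (@continuous_comp _ _ _ (fun y => a - y) coskernel); last exact: coskernel_cont.
  by apply: cvgB; [exact: cvg_cst|exact: cvg_id].
by move=> y _; exact: coskernel_le.
Qed.

(** The Mellin transform of 2 cos (2 pi x), the sum of its two halves cut at
x = 1; cos_mellin_cvg identifies it with the improper integral. *)
Definition cos_mellin z := right_mell 0 z + left_mell 0 z.

Lemma cos_mellin_cvg z (u v : nat -> R) : 0 < complex.Re z < 1 ->
  u n @[n --> \oo] --> -oo -> v n @[n --> \oo] --> +oo ->
  cint `[u n, v n] (cos_integrand z) @[n --> \oo] --> (cos_mellin z : R[i]^o).
Proof.
move=> /andP[z0 z1] uinf vinf.
have uinf' : - u n @[n --> \oo] --> +oo by exact/cvgNry.
have e0 : shifted 0 z = cos_integrand z by apply/funext => y; rewrite /shifted addr0.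
have := @right_mell_cvg 0 z v z1 vinf; have := @left_mell_cvg 0 z (fun n => - u n) z0 uinf'.
rewrite e0 => h1 h2; apply: cvg_near_eq (ccvgD h2 h1).
have /cvgryPge/(_ 0) := vinf; have /cvgrNyPle/(_ 0) := uinf.
apply: filterS2 => n un vn /=.
by rewrite opprK addrC; apply: cint_split => //; exact: cos_integrand_cont.
Qed.

(** Translating the variable by a multiplies the full integral by e^(- z a); the
two halves on the left are those of the translated kernel, cut again at 0. *)
Lemma split_mell a z : 0 < complex.Re z < 1 ->
  right_mell a z + left_mell a z = cexp (- (z * a%:C)) * cos_mellin z.
Proof.
move=> /[dup] z01 /andP[z0 z1].
pose n_ n : R := n%:R.
have ninf : n_ n @[n --> \oo] --> +oo by exact: cvgr_idn.
have ninf' : - n_ n @[n --> \oo] --> -oo by apply/cvgNrNy.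
have h1 := @right_mell_cvg a z n_ z1 ninf; have h2 := @left_mell_cvg a z n_ z0 ninf.
apply: (@ccvg_unique (fun n => cint `[0, n_ n] (shifted a z) + cint `[- n_ n, 0] (shifted a z))).
  exact: ccvgD.
apply: (@cvg_near_eq _ _ _ _ _ (fun n => cexp (- (z * a%:C)) * cint `[- n_ n + a, n_ n + a] (cos_integrand z))).
  apply: nearW => n /=; rewrite addrC.
  have n0 : 0 <= n_ n by [].
  have nn : - n_ n <= n_ n by lra.
  rewrite -cos_integrand_shift_int//; symmetry; apply: cint_split => //; last exact: shifted_cont.
  by rewrite oppr_le0.
apply: ccvgM; first exact: ccvg_cst.
apply: cos_mellin_cvg => //.
  apply/cvgrNyPle => A; move/cvgrNyPle/(_ (A - a)) : ninf'.
  by apply: filterS => n; rewrite lerBrDr.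
apply/cvgryPge => A; move/cvgryPge/(_ (A - a)) : ninf.
by apply: filterS => n; rewrite lerBlDr.
Qed.

Lemma left_mell_bound a z : complex.Re z = 1 / 2 ->
  normc (left_mell a z) <= 48 * expR (- a / 2).
Proof.
move=> zh; have z0 : 0 < complex.Re z by rewrite zh; lra.
have h := @left_mell_cvg a z (fun n => n%:R) z0 (@cvgr_idn R).
apply: (@limit_normc_le _ _ _ _ h).
apply: nearW => n.
have nn : - (n%:R : R) <= 0 by rewrite oppr_le0.
rewrite (cos_integrand_shift_int a z nn) add0r normcM normc_cexp ReN ReM/= mulr0 subr0 zh.
rewrite mulrC (_ : - (1 / 2 * a) = - a / 2); last by field.
by apply: ler_pM; rewrite ?normc_ge0 ?expR_ge0//; apply: cos_integrand_bound => //; lra.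
Qed.

(** On the critical line this is cos_integrand_bound. To its left the integrand
is the one on the line times the decreasing function e^(- c y), with
c = 1/2 - Re z, and Abel summation keeps the bound up to the factor
3 = 144 / 48. *)
Lemma right_mell_bound a z : complex.Re z <= 1 / 2 ->
  normc (right_mell a z) <= 144 * expR (- a / 2).
Proof.
move=> zh; have z1 : complex.Re z < 1 by lra.
have h := @right_mell_cvg a z (fun n => n%:R) z1 (@cvgr_idn R).
apply: (@limit_normc_le _ _ _ _ h).
apply: nearW => n; have : 0 <= (n%:R : R) by [].
move: (n%:R : R) => b b0 {n h}.
pose w : R[i] := (1 / 2) +i* complex.Im z.
pose c := 1 / 2 - complex.Re z.
have c0 : 0 <= c by rewrite /c; lra.
have zw : z = w + (- c)%:C.
  by apply/eqP; rewrite eq_complex/= /c; apply/andP; split; apply/eqP; ring.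
have [P dP] := ccont_primitive (shifted_cont a w).
pose m := 48 * expR (- a / 2).
have m0 : 0 <= m by rewrite mulr_ge0// expR_ge0.
have Pm y : 0 <= y -> normc (P y - P 0) <= m.
  move=> y0; rewrite -(cint_FTC y0 dP (shifted_cont a w)).
  rewrite (cos_integrand_shift_int a w y0) add0r normcM normc_cexp ReN ReM/= mulr0 subr0.
  rewrite mulrC (_ : - (1 / 2 * a) = - a / 2); last by field.
  apply: ler_pM; rewrite ?normc_ge0 ?expR_ge0//.
  by apply: cos_integrand_bound => //; lra.
pose Q y : R[i] := (P y - P 0) * cexp ((- c)%:C * y%:C).
pose Q' y : R[i] := shifted a z y + (- c)%:C * Q y.
have cP : ccont P := cder_cont dP.
have cQ : ccont Q.
  by apply: ccontM; [apply: ccontD => //; exact: ccont_cst|exact: ccont_cexp].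
have dQ : cder Q Q'.
  apply: cder_eq (cderM (cderD dP (cder_cst (- P 0))) (cder_cexp (- c)%:C)) _.
  move=> y; rewrite /Q' /Q /shifted /=.
  have -> : cexp (z * y%:C) = cexp (w * y%:C) * cexp ((- c)%:C * y%:C).
    by rewrite -cexpD -mulrDl -zw.
  by ring.
have cQ' : ccont Q'.
  by apply: ccontD; [exact: shifted_cont|apply: ccontM => //; exact: ccont_cst].
have iS : cintegrable `[0, b] (shifted a z).
  by apply: cintegrable_segment; exact: shifted_cont.
have iQ : cintegrable `[0, b] Q by exact: cintegrable_segment.
have := cint_FTC b0 dQ cQ'.
rewrite cintD//; last exact: cintegrableZ.
have Q0 : Q 0 = 0 by rewrite /Q subrr mul0r.
rewrite cintZ// Q0 subr0 => h.
have -> : cint `[0, b] (shifted a z) = Q b + c%:C * cint `[0, b] Q.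
  by rewrite -h rmorphN/=; ring.
have nQ y : 0 <= y -> normc (Q y) <= m * expR (- c * y).
  move=> y0; rewrite /Q normcM normc_cexpMr /=.
  by rewrite ler_wpM2r ?expR_ge0// Pm.
have I : normc (cint `[0, b] Q) <= 2 * \int[mu]_(y in `[0, b]) (m * expR (- c * y)).
  apply: cint_le => //.
    apply: integrable_scalel => //; apply: integrable_segment => x _; exact: continuous_expRM.
  by move=> y /=; rewrite in_itv/= => /andP[y0 _]; exact: nQ.
have cI : c * \int[mu]_(y in `[0, b]) (m * expR (- c * y)) = m * (1 - expR (- c * b)).
  have ie : mu.-integrable `[0, b] (EFin \o (fun y : R => m * expR (- c * y))).
    by apply: integrable_scalel => //; apply: integrable_segment => x _; exact: continuous_expRM.
  rewrite -RintegralZl//.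
  rewrite (_ : m * (1 - _) = (fun y => - m * expR (- c * y)) b - (fun y => - m * expR (- c * y)) 0); last first.
    by rewrite mulr0 expR0; ring.
  apply: (@Rintegral_FTC _ 0 b (fun y => c * (m * expR (- c * y))) (fun y => - m * expR (- c * y))) => //.
    by move=> y _; apply: is_derive_eq; rewrite /GRing.scale/=; ring.
  by move=> y _; apply: cvgM; [exact: cvg_cst|apply: cvgM; [exact: cvg_cst|exact: continuous_expRM]].
apply: le_trans (le_normcD _ _) _.
rewrite (normcM c%:C (cint `[0, b] Q)) normc_real (ger0_norm c0).
have e1 : expR (- c * b) <= 1 by rewrite expR_le1; nra.
have e0 := expR_ge0 (- c * b).
have t1 : normc (Q b) <= m.
  by apply: le_trans (nQ _ b0) _; rewrite ler_piMr.
have t2 : c * normc (cint `[0, b] Q) <= 2 * m.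
  apply: le_trans (ler_wpM2l c0 I) _.
  rewrite mulrCA cI ler_pM2l// ler_piMr//; lra.
have -> : 144 * expR (- a / 2) = m + 2 * m by rewrite /m; ring.
exact: lerD.
Qed.

End HalfMellin.

Section LeftDecay.
Context {R : realType}.
Notation mu := (@lebesgue_measure R).

(** One integration by parts against e^(- z y): the boundary term at 0 and the
Laplace transform of the derivative q of the kernel are both bounded. This decay
is what makes the left half continuous at v = 1, that is, at z = oo. *)
Lemma left_mell_decay (a : R) (z : R[i]) : complex.Re z = 1 / 2 ->
  normc z * normc (left_mell a z) <= 2 + 16 * pi * expR a.
Proof.
move=> zh; have z0 : complex.Re (- z) < 0 by rewrite ReN zh; lra.
pose k (y : R) := coskernel (a - y).
pose q (y : R) := 4 * pi * expR (a - y) * sin (2 * pi * expR (a - y)).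
have dk (y : R) : is_derive y 1 k (q y).
  by rewrite /k /q /coskernel; apply: is_derive_eq; rewrite /GRing.scale/=; ring.
have ck : continuous k by move=> y; exact: derive_continuous (dk y).
have cq : continuous q.
  move=> y; pose q' := - (4 * pi * expR (a - y)) * sin (2 * pi * expR (a - y))
    - 4 * pi * expR (a - y) * (cos (2 * pi * expR (a - y)) * (2 * pi * expR (a - y))).
  apply: (@derive_continuous _ q y q'); rewrite /q /q'.
  by apply: is_derive_eq; rewrite /GRing.scale/=; ring.
pose B := 4 * pi * expR a.
have qB y : 0 <= y -> `|q y| <= B.
  move=> y0; have p0 : 0 <= 4 * pi * expR (a - y) by rewrite !mulr_ge0 ?expR_ge0 ?pi_ge0.
  rewrite /q normrM (ger0_norm p0) -[leRHS]mulr1; apply: ler_pM => //; last exact: sin_max.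
  by rewrite /B ler_wpM2l ?mulr_ge0 ?pi_ge0// ler_expR; lra.
have mq : measurable_fun setT q by exact: continuous_measurable_fun.
have mk : measurable_fun setT k by exact: continuous_measurable_fun.
have kB y : 0 <= y -> `|k y| <= 2 by move=> _; exact: coskernel_le.
pose f (y : R) : R[i] := (k y)%:C * cexp (- z * y%:C).
have cf : ccont f by apply: ccontM; [exact: ccont_real|exact: ccont_cexp].
pose g (y : R) : R[i] := (q y)%:C * cexp (- z * y%:C).
have cg : ccont g by apply: ccontM; [exact: ccont_real|exact: ccont_cexp].
have df : cder f (fun y => g y + (- z) * f y).
  apply: cder_eq (cderM (cder_real dk) (cder_cexp (- z))) _.
  by move=> y; rewrite /f /g; ring.
have cf' : ccont (fun y => g y + (- z) * f y).
  by apply: ccontD => //; apply: ccontM => //; exact: ccont_cst.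
have l1 := @laplace_cvg _ q B mq qB (- z) (fun n => n%:R) z0 (@cvgr_idn R).
have l2 := @laplace_cvg _ k 2 mk kB (- z) (fun n => n%:R) z0 (@cvgr_idn R).
have l3 : f n%:R @[n --> \oo] --> ((0 : R[i]) : R[i]^o).
  apply/cvgc_normc; apply: (@squeeze_cvgr _ _ _ _ (fun=> 0)
     (fun n => 2 * normc (cexp (- z * (n%:R)%:C)))).
  - apply: nearW => n; rewrite normc_ge0/= subr0 normcM normc_real.
    by rewrite ler_wpM2r ?normc_ge0// coskernel_le.
  - exact: cvg_cst.
  - rewrite -[X in _ --> X](mulr0 2); apply: cvgM; first exact: cvg_cst.
    exact: (@cexp_cvg0 _ (- z) (fun n => n%:R) z0 (@cvgr_idn R)).
have E : laplace q (- z) + (- z) * left_mell a z = 0 - f 0.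
  have l4 := @ccvgB R nat \oo _ (fun n => f n%:R) (fun=> f 0) 0 (f 0) l3 (@ccvg_cst R _ _ _ (f 0)).
  refine (@ccvg_unique _ (fun n => f n%:R - f 0) _ _ _ (l4 _ _)).
  refine (cvg_near_eq _ (ccvgD l1 (ccvgM (@ccvg_cst R _ _ _ (- z)) l2))).
  apply: nearW => n; have n0 : 0 <= (n%:R : R) by [].
  rewrite -(cint_FTC n0 df cf') cintD//; last 2 first.
  - exact: cintegrable_segment.
  - by apply: cintegrableZ => //; exact: cintegrable_segment.
  by rewrite cintZ//; exact: cintegrable_segment.
have f0 : f 0 = (coskernel a)%:C by rewrite /f /k subr0 mulr0 cexp0 mulr1.
have -> : normc z * normc (left_mell a z) = normc (laplace q (- z) + f 0).
  rewrite -normcM; congr normc.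
  have -> : z * left_mell a z = laplace q (- z) - (laplace q (- z) + (- z) * left_mell a z) by ring.
  by rewrite E; ring.
apply: le_trans (le_normcD _ _) _; rewrite addrC; apply: lerD.
  by rewrite f0 normc_real coskernel_le.
apply: le_trans (laplace_bound mq qB z0) _.
rewrite ReN opprK zh /B le_eqVlt; apply/orP; left; apply/eqP.
by move: (pi : R) (expR a) => p e; field.
Qed.

End LeftDecay.

Section Exhaustion.
Context {R : realType}.
Notation mu := (@lebesgue_measure R).

Lemma Rintegral_exhaustion (D : set R) (f : R -> R) : measurable D ->
  mu.-integrable D (EFin \o f) ->
  (\int[mu]_(x in D `&` `[- n%:R, n%:R]) f x) @[n --> \oo] --> \int[mu]_(x in D) f x.
Proof.
move=> mD fi; have mf := (measurable_EFinP _ _).1 (measurable_int mu fi).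
under eq_fun do rewrite Rintegral_mkcondr.
apply: (proj2 (@Rintegral_dominated _ D (fun n => f \_ `[- n%:R, n%:R]) f
  (fun x => `|f x|) mD _ _ (integrable_norm fi) _)).
- move=> n; apply/(measurable_restrict _ _ _) => //.
  by apply: measurable_funS mf.
- move=> x _; apply: (@cvg_near_cst _ R).
  have := @cvgr_idn R; move/cvgryPge/(_ `|x|); apply: filterS => n.
  by rewrite ler_norml => xn; rewrite patchE mem_set//= in_itv.
- by move=> n x _; rewrite patchE; case: ifP => // _; rewrite normr0.
Qed.

Lemma cint_exhaustion (D : set R) (f : R -> R[i]) : measurable D -> cintegrable D f ->
  cint (D `&` `[- n%:R, n%:R]) f @[n --> \oo] --> (cint D f : R[i]^o).
Proof.
by move=> mD [fr fi]; apply/cvgc_ReIm; split; exact: Rintegral_exhaustion.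
Qed.

End Exhaustion.

(** * The Gaussian is its own cosine transform *)

Section Gaussian.
Context {R : realType}.
Notation mu := (@lebesgue_measure R).

(** e^(- pi x^2) at x = e^y. *)
Definition gauss (y : R) := expR (- (pi * expR (2 * y))).

Lemma gauss_derive (y : R) : is_derive y 1 gauss (- (2 * pi * expR (2 * y) * gauss y)).
Proof. by rewrite /gauss; apply: is_derive_eq; rewrite /GRing.scale/=; ring. Qed.

Lemma gauss_cont : continuous gauss.
Proof. by move=> y; exact: derive_continuous (gauss_derive y). Qed.

Lemma gauss_gt0 y : 0 < gauss y.
Proof. exact: expR_gt0. Qed.

Lemma gauss_exp_le (s y : R) : 0 < s <= 2 -> gauss y * expR (s * y) <= expR (- s * `|y|).
Proof.
move=> /andP[s0 s2]; rewrite /gauss -expRD ler_expR.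
have p2 := pi_ge2 R; have e0 := expR_gt0 (2 * y).
have [y0|y0] := leP 0 y.
  rewrite (ger0_norm y0); have e1 := expR_ge1Dx (2 * y).
  have : 2 * expR (2 * y) <= pi * expR (2 * y) by rewrite ler_wpM2r// ltW.
  have : s * y <= 2 * y by rewrite ler_wpM2r.
  by lra.
rewrite (ltr0_norm y0); have : 0 <= pi * expR (2 * y) by rewrite mulr_ge0 ?pi_ge0 ?expR_ge0.
by lra.
Qed.

Lemma gauss_exp_cont (s : R) : continuous (fun y => gauss y * expR (s * y)).
Proof. by move=> y; apply: cvgM; [exact: gauss_cont|exact: continuous_expRM]. Qed.

Lemma gauss_exp_integrable (s : R) : 0 < s <= 2 ->
  mu.-integrable setT (EFin \o (fun y => gauss y * expR (s * y))).
Proof.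
move=> s02; have /andP[s0 _] := s02.
apply: (@integrable_le _ _ _ (fun y => expR (- s * `|y|))) => //.
- by apply: continuous_measurable_fun; exact: gauss_exp_cont.
- by move=> y _; rewrite ger0_norm ?mulr_ge0 ?expR_ge0// gauss_exp_le.
- exact: integrable_expRabs.
Qed.

Let theta (X y : R) := 2 * cos (2 * pi * X * expR y) * (gauss y * expR (1 * y)).
Let dtheta (X y : R) := - (4 * pi) * sin (2 * pi * X * expR y) * (gauss y * expR (2 * y)).

Let expR2 (y : R) : expR (2 * y) = expR y * expR y.
Proof. by rewrite -expRD; congr expR; ring. Qed.

Let gauss_int1 : mu.-integrable setT (EFin \o (fun y => gauss y * expR (1 * y))).
Proof. by apply: gauss_exp_integrable; lra. Qed.

Let gauss_int2 : mu.-integrable setT (EFin \o (fun y => gauss y * expR (2 * y))).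
Proof. by apply: gauss_exp_integrable; lra. Qed.

Let theta_derive (X y : R) : is_derive X 1 (theta ^~ y) (dtheta X y).
Proof.
rewrite /theta /dtheta expR2 mul1r.
by apply: is_derive_eq; rewrite /GRing.scale/=; ring.
Qed.

Let cont_arg (X : R) : continuous (fun y => 2 * pi * X * expR y).
Proof. by move=> y; apply: cvgM; [exact: cvg_cst|exact: continuous_expR]. Qed.

Let theta_cont (X : R) : continuous (theta X).
Proof.
move=> y; apply: cvgM; last exact: gauss_exp_cont.
apply: cvgM; first exact: cvg_cst.
apply: (@continuous_comp _ _ _ (fun y => 2 * pi * X * expR y) cos).
  exact: cont_arg.
exact: continuous_cos.
Qed.

Let dtheta_cont (X : R) : continuous (dtheta X).
Proof.
move=> y; apply: cvgM; last exact: gauss_exp_cont.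
apply: cvgM; first exact: cvg_cst.
apply: (@continuous_comp _ _ _ (fun y => 2 * pi * X * expR y) sin).
  exact: cont_arg.
exact: continuous_sin.
Qed.

Let theta_le (X y : R) : `|theta X y| <= 2 * (gauss y * expR (1 * y)).
Proof.
have g0 : 0 <= gauss y * expR (1 * y) by rewrite mulr_ge0 ?expR_ge0.
rewrite /theta normrM (ger0_norm g0) ler_wpM2r// normrM ger0_norm//.
by rewrite -[leRHS]mulr1 ler_pM2l// cos_max.
Qed.

Let dtheta_le (X y : R) : `|dtheta X y| <= 4 * pi * (gauss y * expR (2 * y)).
Proof.
have g0 : 0 <= gauss y * expR (2 * y) by rewrite mulr_ge0 ?expR_ge0.
have p0 : 0 <= 4 * pi :> R by rewrite mulr_ge0// pi_ge0.
rewrite /dtheta normrM (ger0_norm g0) ler_wpM2r// normrM normrN (ger0_norm p0).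
rewrite -[leRHS]mulr1 ler_wpM2l ?mulr_ge0 ?pi_ge0//; exact: sin_max.
Qed.

Let theta_int (X : R) : mu.-integrable setT (EFin \o theta X).
Proof.
apply: (@integrable_le _ _ _ (fun y => 2 * (gauss y * expR (1 * y)))) => //.
- by apply: continuous_measurable_fun; exact: theta_cont.
- exact: integrable_scalel.
Qed.

Let dtheta_int (X : R) : mu.-integrable setT (EFin \o dtheta X).
Proof.
apply: (@integrable_le _ _ _ (fun y => 4 * pi * (gauss y * expR (2 * y)))) => //.
- by apply: continuous_measurable_fun; exact: dtheta_cont.
- exact: integrable_scalel.
Qed.

(** The cosine transform of the Gaussian, in the variable y = ln x. It solves the
differential equation Theta' = - 2 pi X Theta of the Gaussian itself. *)
Let Theta (X : R) := \int[mu]_y theta X y.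

Let Theta_derive (X : R) : is_derive X 1 Theta (\int[mu]_y dtheta X y).
Proof.
have XI : `]X - 1, X + 1[%classic X by rewrite /= in_itv/=; lra.
have h1 x : `]X - 1, X + 1[%classic x -> mu.-integrable setT (EFin \o theta x).
  by move=> _; exact: theta_int.
have h2 x y : `]X - 1, X + 1[%classic x -> setT y -> derivable (theta ^~ y) x 1.
  by move=> _ _; have [] := theta_derive x y.
pose G y := 4 * pi * (gauss y * expR (2 * y)).
have h3 y : 0 <= G y by rewrite /G !mulr_ge0 ?expR_ge0 ?pi_ge0.
have h4 : mu.-integrable setT (EFin \o G) by exact: integrable_scalel.
have dE x y : partial1of2 theta x y = dtheta x y.
  by rewrite partial1of2E; have h := theta_derive x y; exact: derive_val.
have h5 x y : `]X - 1, X + 1[%classic x -> setT y -> `|partial1of2 theta x y| <= G y.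
  by move=> _ _; rewrite dE; exact: dtheta_le.
apply: DeriveDef.
  exact: (@derivable_under_integral _ _ _ mu theta setT measurableT X _ _ XI h1 h2 G h3 h4 h5).
rewrite -derive1E.
rewrite (@differentiation_under_integral _ _ _ mu theta setT measurableT X _ _ XI h1 h2 G h3 h4 h5).
by apply: eq_Rintegral => y _; rewrite -dE.
Qed.

(** The integrand of the derivative and that of Theta combine into the derivative
of sin (2 pi X x) e^(- pi x^2), whose integral vanishes. *)
Let dTheta (X : R) : \int[mu]_y dtheta X y = - (2 * pi * X) * Theta X.
Proof.
pose f (y : R) := sin (2 * pi * X * expR y) * gauss y.
pose f' (y : R) := 2^-1 * dtheta X y + pi * X * theta X y.
have df (y : R) : is_derive y 1 f (f' y).
  have := gauss_derive y => h; apply: is_derive_eq; rewrite /GRing.scale/=.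
  rewrite /f' /dtheta /theta expR2 mul1r.
  by move: (pi : R) => p; field.
have cf' : continuous f'.
  move=> y; apply: cvgD; (apply: cvgM; first exact: cvg_cst).
    exact: dtheta_cont.
  exact: theta_cont.
have if' : mu.-integrable setT (EFin \o f').
  by apply: integrable_add => //; exact: integrable_scalel.
have h1 := Rintegral_exhaustion measurableT if'.
have h2 : f n%:R - f (- n%:R) @[n --> \oo] --> (0 : R).
  apply: (@cvg_trans _ ((fun n : nat => f n%:R - f (- n%:R)) @ \oo)) => //.
  apply/norm_cvg0P; apply: (@squeeze_cvgr _ _ _ _ (fun=> 0)
    (fun n => expR (- n%:R) + `|2 * pi * X| * expR (- n%:R))).
  - apply: nearW => n; rewrite normr_ge0/=; apply: le_trans (ler_normB _ _) _.
    apply: lerD; rewrite /f normrM (gtr0_norm (gauss_gt0 _)).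
      apply: (@le_trans _ _ (gauss n%:R)).
        by rewrite (ler_piMl (ltW (gauss_gt0 _)))//; exact: sin_max.
      rewrite /gauss ler_expR lerN2.
      have p2 := pi_ge2 R; have e1 := expR_ge1Dx (2 * n%:R : R).
      have n0 : 0 <= (n%:R : R) by [].
      have : 1 * expR (2 * n%:R) <= pi * expR (2 * n%:R : R).
        by rewrite ler_wpM2r ?expR_ge0//; lra.
      by lra.
    apply: (@le_trans _ _ `|sin (2 * pi * X * expR (- n%:R))|).
      by rewrite ler_piMr// /gauss expR_le1 oppr_le0 mulr_ge0 ?pi_ge0 ?expR_ge0.
    apply: le_trans (sin_le_id _) _.
    by rewrite (normrM (2 * pi * X)) (ger0_norm (expR_ge0 _)).
  - exact: cvg_cst.
  - rewrite -[X in _ --> X](addr0 0); apply: cvgD; first exact: cvgn_expR.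
    rewrite -[X in _ --> X](mulr0 `|2 * pi * X|); apply: cvgM; first exact: cvg_cst.
    exact: cvgn_expR.
have h3 : \int[mu]_y f' y = 0.
  apply: (cvg_unique (@Rhausdorff R) h1).
  apply: cvg_trans h2; apply: near_eq_cvg; apply: nearW => n.
  rewrite setTI; symmetry; apply: (@Rintegral_FTC _ (- n%:R) n%:R f' f).
  - by have n0 : 0 <= (n%:R : R) by []; lra.
  - by move=> y _; exact: cf'.
move: h3; rewrite RintegralD//; try exact: integrable_scalel.
rewrite !RintegralZl// -/(Theta X).
have := pi_gt0 R; move: (pi : R) => p p0.
by lra.
Qed.

Let ThetaE (X : R) : Theta X = Theta 0 * expR (- (pi * X ^+ 2)).
Proof.
pose H (X : R) := Theta X * expR (pi * X ^+ 2).
have dH (Y : R) : is_derive Y 1 H 0.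
  have h := Theta_derive Y; rewrite dTheta in h.
  by apply: is_derive_eq; rewrite /GRing.scale/=; ring.
have := @is_derive_0_is_cst R H X 0 dH.
rewrite /H expr0n mulr0 expR0 mulr1 => <-.
by rewrite -mulrA -expRD subrr expR0 mulr1.
Qed.

(** The value of the cosine transform at 0. It is kept as a positive constant
instead of being evaluated to 1. *)
Definition gauss_mass := \int[mu]_y (2 * (gauss y * expR (1 * y))).

Lemma gauss_exp_pos (s : R) : 0 < s <= 2 -> 0 < \int[mu]_y (gauss y * expR (s * y)).
Proof.
move=> s02; pose f (y : R) := gauss y * expR (s * y).
have f0 y : 0 <= f y by rewrite /f mulr_ge0 ?expR_ge0.
have fi : mu.-integrable setT (EFin \o f) by exact: gauss_exp_integrable.
pose d := expR (- pi) * expR (- s) : R.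
have d0 : 0 < d by rewrite /d mulr_gt0 ?expR_gt0.
apply: (lt_le_trans d0).
apply: (@le_trans _ _ (\int[mu]_(y in `[-1, 0]) f y)).
  rewrite (_ : d = \int[mu]_(y in `[-1, 0]) d).
    apply: le_Rintegral => //.
    - by apply: integrable_segment => x _; exact: cvg_cst.
    - by apply: integrable_subset fi.
    - move=> y /=; rewrite in_itv/= => /andP[y1 y0].
      rewrite /d /f; apply: ler_pM; rewrite ?expR_ge0//.
        rewrite /gauss ler_expR lerN2 ler_piMr ?pi_ge0// expR_le1; lra.
      by rewrite ler_expR; have /andP[s0 _] := s02; nra.
  rewrite [LHS](_ : d = (fun y => d * y) 0 - (fun y => d * y) (-1)); last by ring.
  symmetry; apply: (@Rintegral_FTC _ (-1) 0 (fun=> d) (fun y => d * y)).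
  - by lra.
  - by move=> y _; apply: is_derive_eq; rewrite /GRing.scale/=; ring.
  - by move=> y _; exact: cvg_cst.
rewrite Rintegral_mkcond; apply: le_Rintegral => //.
- apply: (@integrable_le _ _ _ f) => //.
    have mf := (measurable_EFinP _ _).1 (measurable_int mu fi).
    by apply/(measurable_restrict _ _ _) => //; apply: measurable_funS mf.
  by move=> y _; rewrite patchE; case: ifP => _; rewrite ?normr0// ger0_norm.
- by move=> y _; rewrite patchE; case: ifP => _; [exact: lexx|exact: f0].
Qed.

Lemma gauss_mass_gt0 : 0 < gauss_mass.
Proof. by rewrite /gauss_mass RintegralZl// mulr_gt0// gauss_exp_pos//; lra. Qed.

Lemma gauss_cosine (x : R) :
  \int[mu]_y (coskernel (x + y) * (gauss y * expR (1 * y))) = gauss_mass * gauss x.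
Proof.
have T0 : Theta 0 = gauss_mass.
  by apply: eq_Rintegral => y _; rewrite /theta mulr0 mul0r cos0 mulr1.
rewrite /gauss expR2 -T0 (_ : pi * _ = pi * expR x ^+ 2) ?expr2// -expr2 -ThetaE.
by apply: eq_Rintegral => y _; rewrite /coskernel /theta expRD !mulrA.
Qed.

End Gaussian.

(** * The local functional equation *)

Section FubiniConvolution.
Context {R : realType}.
Notation mu := (@lebesgue_measure R).

Lemma EFin_Rintegral (D : set R) (f : R -> R) : measurable D ->
  mu.-integrable D (EFin \o f) ->
  (\int[mu]_(x in D) f x)%:E = (\int[mu]_(x in D) (f x)%:E)%E.
Proof. by move=> mD fi; rewrite /Rintegral fineK//; exact: integrable_fin_num. Qed.

Lemma integrable_patch (D : set R) (f : R -> R) : measurable D ->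
  mu.-integrable D (EFin \o f) -> mu.-integrable setT (EFin \o (f \_ D)).
Proof.
move=> mD fi; rewrite -restrict_EFin.
exact: ((@integrable_mkcond _ _ _ mu D _ mD).1 fi).
Qed.

Lemma fubini_convolution (G v k : R -> R) (B : R) :
  mu.-integrable setT (EFin \o G) -> mu.-integrable setT (EFin \o v) ->
  continuous k -> (forall x, `|k x| <= B) ->
  \int[mu]_x (G x * \int[mu]_y (k (x + y) * v y)) =
  \int[mu]_y (\int[mu]_x (G x * k (x + y)) * v y).
Proof.
move=> iG iv ck kB.
have mG := (measurable_EFinP _ _).1 (measurable_int mu iG).
have mv := (measurable_EFinP _ _).1 (measurable_int mu iv).
have mk : measurable_fun setT k by exact: continuous_measurable_fun.
have B0 : 0 <= B by exact: le_trans (normr_ge0 (k 0)) (kB 0).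
pose f (p : R * R) := G p.1 * (k (p.1 + p.2) * v p.2).
have mf : measurable_fun setT (f : measurableTypeR R * measurableTypeR R -> measurableTypeR R).
  apply: measurable_funM; first exact: measurableT_comp mG measurable_fst.
  apply: measurable_funM; last exact: measurableT_comp mv measurable_snd.
  apply: (measurableT_comp mk).
  by apply: measurable_funD; [exact: measurable_fst|exact: measurable_snd].
have mfE := (measurable_EFinP _ _).2 mf.
have mkx (x : R) : measurable_fun setT (fun y : R => k (x + y)).
  apply: continuous_measurable_fun => y.
  apply: (@continuous_comp _ _ _ (fun y : R => x + y) k); last exact: ck.
  by apply: cvgD; [exact: cvg_cst|exact: cvg_id].
have mky (y : R) : measurable_fun setT (fun x : R => k (x + y)).
  by apply: continuous_measurable_fun; exact: cont_shift.
have ikv (x : R) : mu.-integrable setT (EFin \o (fun y => k (x + y) * v y)).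
  apply: (@integrable_le _ _ _ (fun y => B * `|v y|)) => //.
  - exact: measurable_funM.
  - by move=> y _; rewrite normrM ler_wpM2r.
  - by apply: integrable_scalel => //; exact: (integrable_norm iv).
have iGk (y : R) : mu.-integrable setT (EFin \o (fun x => G x * k (x + y))).
  apply: (@integrable_le _ _ _ (fun x => B * `|G x|)) => //.
  - exact: measurable_funM.
  - by move=> x _; rewrite normrM mulrC ler_wpM2r.
  - by apply: integrable_scalel => //; exact: (integrable_norm iG).
have fin : (mu \x mu)%E.-integrable setT (EFin \o f).
  apply: (proj2 (@integrable12ltyP _ _ _ _ R mu mu _ mfE)).
  pose V := \int[mu]_y `|v y|.
  have iH : mu.-integrable setT (EFin \o (fun x => B * V * `|G x|)).
    by apply: integrable_scalel => //; exact: (integrable_norm iG).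
  apply: (@le_lt_trans _ _ (\int[mu]_x (B * V * `|G x|)%:E)%E); last first.
    by apply: (@integrable_lty _ _ _ mu setT measurableT _ iH).
  apply: ge0_le_integral => //.
  - by move=> x _; exact: integral_ge0.
  - apply: (@measurable_fun_fubini_tonelli_F _ _ _ _ _ mu (abse \o (EFin \o f))).
      exact: measurableT_comp.
    by move=> x; exact: abse_ge0.
  - by apply: (measurable_int mu iH).
  - move=> x _.
    have iW : mu.-integrable setT (EFin \o (fun y => `|G x| * B * `|v y|)).
      by apply: integrable_scalel => //; exact: (integrable_norm iv).
    rewrite (_ : B * V * `|G x| = \int[mu]_y (`|G x| * B * `|v y|)); last first.
      rewrite RintegralZl//; last exact: (integrable_norm iv).
      by rewrite -/V; ring.
    rewrite (EFin_Rintegral measurableT iW).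
    apply: ge0_le_integral => //.
    + have h := integrable_scalel (G x) measurableT (ikv x).
      by apply: measurableT_comp => //; exact: measurable_int h.
    + exact: measurable_int iW.
    + move=> y _ /=; rewrite lee_fin /f/= !normrM -mulrA ler_wpM2l//.
      by rewrite ler_wpM2r.
have := @Fubini _ _ _ _ R mu mu (EFin \o f) fin => h.
rewrite /Rintegral; congr fine.
rewrite [LHS](_ : _ = \int[mu]_x \int[mu]_y (f (x, y))%:E)%E; last first.
  apply: eq_integral => x _; rewrite EFinM (EFin_Rintegral measurableT (ikv x)).
  by rewrite -(integralZl measurableT (ikv x)).
rewrite h; apply: eq_integral => y _.
rewrite EFinM (EFin_Rintegral measurableT (iGk y)).
rewrite -(integralZr measurableT (iGk y)).
by apply: eq_integral => x _; rewrite -EFinM /f/= mulrA.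
Qed.

End FubiniConvolution.

Section GaussMellin.
Context {R : realType}.
Notation mu := (@lebesgue_measure R).
Implicit Types z : R[i].

Lemma ReMr (x : R) z : complex.Re (x%:C * z) = x * complex.Re z.
Proof. by case: z => a b /=; rewrite mul0r subr0. Qed.

Lemma ImMr (x : R) z : complex.Im (x%:C * z) = x * complex.Im z.
Proof. by case: z => a b /=; rewrite mul0r addr0. Qed.

Definition gauss_mellin z : R[i] := cint setT (fun y => (gauss y)%:C * cexp (z * y%:C)).

Lemma gauss_mellin_le z y : normc ((gauss y)%:C * cexp (z * y%:C)) =
  gauss y * expR (complex.Re z * y).
Proof. by rewrite normcM normc_real normc_cexpMr gtr0_norm// gauss_gt0. Qed.

Lemma gauss_mellin_cont z : ccont (fun y => (gauss y)%:C * cexp (z * y%:C)).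
Proof. by apply: ccontM; [exact/ccont_real/gauss_cont|exact: ccont_cexp]. Qed.

Lemma gauss_mellin_integrable z : 0 < complex.Re z <= 2 ->
  cintegrable setT (fun y => (gauss y)%:C * cexp (z * y%:C)).
Proof.
move=> z02; apply: (cintegrable_le _ _ _ (gauss_exp_integrable z02)) => //.
  exact/ccont_meas/gauss_mellin_cont.
by move=> y _; rewrite gauss_mellin_le.
Qed.

(** Replace the Gaussian by its cosine transform in its Mellin integral at z and
exchange the integrals: the inner one becomes the cosine integral with the
variable translated by y, that is cos_mellin z e^(- z y), and the outer one the
Mellin integral of the Gaussian at 1 - z. The cosine integral converges only
conditionally, so Fubini is used on [-n, n] and n then tends to infinity; the
truncated integrals are dominated thanks to cos_integrand_bound. *)
Lemma cos_mellin_gauss z : complex.Re z = 1 / 2 ->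
  (@gauss_mass R)%:C * gauss_mellin z = cos_mellin z * gauss_mellin (1 - z).
Proof.
move=> zh.
have z02 : 0 < complex.Re z <= 2 by rewrite zh; lra.
have z01 : 0 < complex.Re z < 1 by rewrite zh; lra.
have zh' : complex.Re (1 - z) = 1 / 2 by rewrite ReD ReN zh/=; lra.
have z02' : 0 < complex.Re (1 - z) <= 2 by rewrite zh'; lra.
pose v (y : R) := gauss y * expR (1 * y).
have iv : mu.-integrable setT (EFin \o v) by apply: gauss_exp_integrable; lra.
pose J (n : nat) (y : R) : R[i] := cint `[- n%:R, n%:R] (shifted y z).
have nn n : - (n%:R : R) <= n%:R by have : 0 <= (n%:R : R) by []; lra.
have real_fubini (n : nat) (g : R -> R) : continuous g ->
    \int[mu]_(x in `[- n%:R, n%:R]) (gauss_mass * gauss x * g x) =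
    \int[mu]_y (\int[mu]_(x in `[- n%:R, n%:R]) (coskernel (x + y) * g x) * v y).
  move=> cg; pose G := g \_ `[- n%:R, n%:R].
  have iG : mu.-integrable setT (EFin \o G).
    have ig : mu.-integrable `[- n%:R, n%:R] (EFin \o g).
      by apply: integrable_segment => x _; exact: cg.
    exact: integrable_patch.
  have := @fubini_convolution _ G v coskernel 2 iG iv (@coskernel_cont R) (@coskernel_le R).
  under eq_Rintegral => x _ do rewrite gauss_cosine.
  move=> h; rewrite [LHS]Rintegral_mkcond.
  transitivity (\int[mu]_x (G x * (gauss_mass * gauss x))).
    apply: eq_Rintegral => x _; rewrite /G !patchE; case: ifP => _; last by rewrite mul0r.
    by rewrite mulrC.
  rewrite h; apply: eq_Rintegral => y _; congr (_ * _).
  rewrite [RHS]Rintegral_mkcond; apply: eq_Rintegral => x _; rewrite /G !patchE.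
  by case: ifP => _; [rewrite mulrC|rewrite mul0r].
have [zr zi] := ccont_cexp z.
have E n : cint `[- n%:R, n%:R] (fun x => gauss_mass%:C * ((gauss x)%:C * cexp (z * x%:C))) =
    cint setT (fun y => (v y)%:C * J n y).
  rewrite /cint; congr (_ +i* _).
    transitivity (\int[mu]_(x in `[- n%:R, n%:R]) (gauss_mass * gauss x * complex.Re (cexp (z * x%:C)))).
      by apply: eq_Rintegral => x _; rewrite !ReMr mulrA.
    rewrite real_fubini//; apply: eq_Rintegral => y _.
    rewrite ReMr mulrC; congr (_ * _).
    by apply: eq_Rintegral => x _; rewrite /shifted [RHS]ReMr.
  transitivity (\int[mu]_(x in `[- n%:R, n%:R]) (gauss_mass * gauss x * complex.Im (cexp (z * x%:C)))).
    by apply: eq_Rintegral => x _; rewrite !ImMr mulrA.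
  rewrite real_fubini//; apply: eq_Rintegral => y _.
  rewrite ImMr mulrC; congr (_ * _).
  by apply: eq_Rintegral => x _; rewrite /shifted [RHS]ImMr.
have L : cint `[- n%:R, n%:R] (fun x => gauss_mass%:C * ((gauss x)%:C * cexp (z * x%:C)))
    @[n --> \oo] --> (gauss_mass%:C * gauss_mellin z : R[i]^o).
  rewrite /gauss_mellin -cintZ//; last exact: gauss_mellin_integrable.
  have h := cint_exhaustion measurableT (cintegrableZ gauss_mass%:C measurableT
    (gauss_mellin_integrable z02)).
  by apply: cvg_near_eq h; apply: nearW => m; rewrite setTI.
have JE n y : J n y = cexp (- (z * y%:C)) * cint `[- n%:R + y, n%:R + y] (cos_integrand z).
  exact: cos_integrand_shift_int.
have [P dP] := ccont_primitive (cos_integrand_cont z).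
have mJ n : cmeas (fun y => (v y)%:C * J n y).
  have mv := (measurable_EFinP _ _).1 (measurable_int mu iv).
  apply: cmeasM; first exact: cmeas_real.
  have -> : J n = (fun y => cexp (- z * y%:C) * (P (n%:R + y) + (-1) * P (- n%:R + y))).
    apply/funext => y; rewrite mulN1r JE -(cint_FTC _ dP (cos_integrand_cont z)) ?mulNr//.
    by rewrite lerD2r.
  apply: cmeasM; first exact: cmeas_cexp.
  have [pr pi'] := cder_cont dP.
  have csh (c : R) (f : R -> R) : continuous f -> continuous (fun y => f (c + y)).
    move=> cf; have -> : (fun y => f (c + y)) = (fun y => f (y + c)).
      by apply/funext => y; rewrite addrC.
    exact: cont_shift.
  have cP c : ccont (fun y => P (c + y)).
    by split; [exact: (csh c _ pr)|exact: (csh c _ pi')].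
  apply: ccont_meas; apply: ccontD; first exact: cP.
  by apply: ccontM; [exact: ccont_cst|exact: cP].
have Rl : cint setT (fun y => (v y)%:C * J n y) @[n --> \oo] -->
    (cint setT (fun y => cos_mellin z * ((gauss y)%:C * cexp ((1 - z) * y%:C))) : R[i]^o).
  refine (@cint_dominated R setT (fun n y => (v y)%:C * J n y)
    (fun y => cos_mellin z * ((gauss y)%:C * cexp ((1 - z) * y%:C)))
    (fun y => 48 * (gauss y * expR (1 / 2 * y))) measurableT mJ _ _ _).
  - move=> y _.
    have -> : cos_mellin z * ((gauss y)%:C * cexp ((1 - z) * y%:C)) =
        (v y)%:C * (cexp (- (z * y%:C)) * cos_mellin z).
      have ey : (expR (1 * y))%:C = cexp y%:C :> R[i] by rewrite mul1r cexp_real.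
      rewrite /v rmorphM/= ey mulrBl mul1r cexpD.
      by ring.
    apply: ccvgM; first exact: ccvg_cst.
    apply: cvg_near_eq; first by apply: nearW => n; exact: JE.
    apply: ccvgM; first exact: ccvg_cst.
    apply: cos_mellin_cvg => //.
      apply/cvgrNyPle => A; have /cvgryPge/(_ (y - A)) := @cvgr_idn R.
      by apply: filterS => n; lra.
    apply/cvgryPge => A; have /cvgryPge/(_ (A - y)) := @cvgr_idn R.
    by apply: filterS => n; lra.
  - apply: integrable_scalel => //; apply: gauss_exp_integrable; lra.
  - move=> n y _; rewrite JE (normcM (v y)%:C) (normcM (cexp _)) normc_real normc_cexp ReN ReM/= mulr0 subr0 zh.
    have v0 : 0 <= v y by rewrite /v mulr_ge0 ?expR_ge0.
    rewrite (ger0_norm v0).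
    have c48 := @cos_integrand_bound R (- n%:R + y) (n%:R + y) z _ zh.
    rewrite mulrA [leRHS]mulrC; apply: ler_pM; rewrite ?normc_ge0 ?mulr_ge0 ?expR_ge0//; last first.
      by apply: c48; rewrite lerD2r.
    have e : expR (1 * y) * expR (- (1 / 2 * y)) = expR (1 / 2 * y).
      by rewrite -expRD; congr expR; field.
    by rewrite /v -[leLHS]mulrA e.
have := ccvg_unique L (cvg_near_eq _ Rl) => ->.
  by rewrite cintZ//; exact: gauss_mellin_integrable.
by apply: nearW => n; exact: E.
Qed.

End GaussMellin.

(** * Euler's limit for Gamma as a Mellin transform of the Gaussian *)

Section EulerLimit.
Context {R : realType}.
Notation mu := (@lebesgue_measure R).
Implicit Types w z : R[i].

Lemma bernoulli_inequality (u : R) n : 0 <= u <= 1 -> 1 - u *+ n <= (1 - u) ^+ n.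
Proof.
move=> /andP[u0 u1]; elim: n => [|n IH]; first by rewrite mulr0n expr0 subr0.
rewrite exprSr mulrSr; have [h|h] := leP (1 - u *+ n) 0.
  have : 0 <= (1 - u) ^+ n * (1 - u) by rewrite mulr_ge0 ?exprn_ge0//; lra.
  by lra.
have : (1 - u *+ n) * (1 - u) <= (1 - u) ^+ n * (1 - u) by rewrite ler_wpM2r//; lra.
have : 0 <= u * (u *+ n) by rewrite mulr_ge0// mulrn_wge0.
by lra.
Qed.

Lemma expR_limit_le (t : R) n : 0 <= t -> t <= n%:R -> (0 < n)%N ->
  0 <= (1 - t / n%:R) ^+ n <= expR (- t).
Proof.
move=> t0 tn n0; have nR : 0 < n%:R :> R by rewrite ltr0n.
have u1 : t / n%:R <= 1 by rewrite ler_pdivrMr// mul1r.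
have h : 0 <= 1 - t / n%:R by lra.
rewrite exprn_ge0//=.
have -> : - t = n%:R * (- (t / n%:R)) by field; rewrite gt_eqF.
rewrite expRM_natl lerXn2r ?nnegrE ?expR_ge0//.
exact: expR_ge1Dx.
Qed.

(** The lower bound comes from (1 - u^2)^n <= ((1 - u) e^u)^n with u = t / n, the
left-hand side tending to 1 by Bernoulli's inequality. *)
Lemma cvg_expR_limit (t : R) : 0 <= t ->
  (1 - t / n%:R) ^+ n @[n --> \oo] --> expR (- t).
Proof.
move=> t0.
apply: (@squeeze_cvgr _ _ _ _ (fun n => expR (- t) * (1 - t ^+ 2 * n%:R^-1)) (fun=> expR (- t))).
- have := @cvgr_idn R; move/cvgryPge/(_ (t + 1)); apply: filterS => n tn.
  have n0 : (0 < n)%N by rewrite -(ltr0n R); lra.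
  have nR : 0 < n%:R :> R by rewrite ltr0n.
  have tn' : t <= n%:R by lra.
  have /andP[h1 h2] := expR_limit_le t0 tn' n0; rewrite h2 andbT.
  pose u := t / n%:R.
  have u01 : 0 <= u <= 1.
    by rewrite /u divr_ge0//= ler_pdivrMr ?mul1r.
  have u2 : 0 <= u ^+ 2 <= 1.
    by rewrite sqr_ge0/= expr_le1//; case/andP: u01.
  have e1 : expR (- t) * (1 - u ^+ 2) ^+ n <= (1 - u) ^+ n.
    have -> : - t = n%:R * (- u) by rewrite /u; field; rewrite gt_eqF.
    rewrite expRM_natl -exprMn lerXn2r ?nnegrE//.
    + by rewrite mulr_ge0 ?expR_ge0//; lra.
    + by have /andP[_ ?] := u01; lra.
    + have : expR (- u) * (1 + u) <= 1.
        rewrite -[leRHS](_ : expR (- u) * expR u = 1); last by rewrite -expRD addNr expR0.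
        by rewrite ler_pM2l ?expR_gt0//; exact: expR_ge1Dx.
      move=> e; have /andP[u0 u1] := u01.
      have -> : expR (- u) * (1 - u ^+ 2) = expR (- u) * (1 + u) * (1 - u) by ring.
      by rewrite -[leRHS]mul1r ler_wpM2r//; lra.
  apply: le_trans e1; rewrite ler_pM2l ?expR_gt0//.
  have e2 := bernoulli_inequality n u2.
  apply: le_trans e2; rewrite lerD2l lerN2 /u expr_div_n -[X in X <= _]mulr_natr.
  rewrite le_eqVlt; apply/orP; left; apply/eqP.
  by move: nR; move: (n%:R : R) => m m0; field; rewrite gt_eqF.
- rewrite -[X in _ --> X]mulr1; apply: cvgM; first exact: cvg_cst.
  rewrite -[X in _ --> X](subr0 1); apply: cvgB; first exact: cvg_cst.
  rewrite -[X in _ --> X](mulr0 (t ^+ 2)); apply: cvgM; first exact: cvg_cst.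
  apply: (proj2 (@gtr0_cvgV0 _ _ _ _ (fun n : nat => n%:R) _)); last exact: cvgr_idn.
  by exists 1 => // n /= n1; rewrite ltr0n.
- exact: cvg_cst.
Qed.

(** For l = pi / n this tends to the integrand e^(- pi t^2) t^(2 w), with t = e^x, of
the Gaussian Mellin transform; the integral over the range l t^2 <= 1 is Euler's
approximant of Gamma w, up to the factor 2 pi^w. *)
Definition beta_itg (l : R) n w (x : R) : R[i] :=
  ((1 - l * expR (2 * x)) ^+ n)%:C * cexp (2 * w * x%:C).

Lemma Re2 w : complex.Re (2 * w) = 2 * complex.Re w.
Proof. by rewrite (_ : 2 * w = w + w) ?ReD; ring. Qed.

Lemma beta_itg_cont l n w : ccont (beta_itg l n w).
Proof.
apply: ccontM; last exact: ccont_cexp.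
apply: ccont_real => x.
apply: (@continuous_comp _ _ _ (fun x : R => 1 - l * expR (2 * x)) (fun y : R => y ^+ n)).
  by apply: cvgB; [exact: cvg_cst|apply: cvgM; [exact: cvg_cst|exact: continuous_expRM]].
exact: exprn_continuous.
Qed.

Lemma beta_itg_le (l c : R) n w x : 0 < l -> l * expR (2 * c) = 1 -> x <= c ->
  normc (beta_itg l n w x) <= expR (2 * complex.Re w * x).
Proof.
move=> l0 lc xc; rewrite /beta_itg normcM normc_real normc_cexpMr Re2.
rewrite ler_piMl ?expR_ge0// normrX exprn_ile1// ger0_norm.
  by have := expR_gt0 (2 * x); nra.
have : l * expR (2 * x) <= l * expR (2 * c) by rewrite ler_pM2l// ler_expR; lra.
by lra.
Qed.

Let beta_integrable (l c : R) n w : 0 < l -> l * expR (2 * c) = 1 -> 0 < complex.Re w ->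
  cintegrable `]-oo, c] (beta_itg l n w).
Proof.
move=> l0 lc w0; apply: (@cintegrable_le _ _ _ (fun x => expR (2 * complex.Re w * x))) => //.
- exact/ccont_meas/beta_itg_cont.
- by move=> x /=; rewrite in_itv/=; exact: beta_itg_le.
- by apply: integrable_expR_left; lra.
Qed.

Lemma Re_gt0_neq0 w : 0 < complex.Re w -> w != 0.
Proof. by apply: contraTneq => ->; rewrite ltxx. Qed.

Lemma Re_natr n : complex.Re (n%:R : R[i]) = n%:R.
Proof. by rewrite -(rmorph_nat (real_complex R)). Qed.

Lemma prod_shift_neq0 w n : 0 < complex.Re w -> \prod_(0 <= k < n) (w + k%:R) != 0.
Proof.
move=> w0; rewrite prodf_seq_neq0; apply/allP => k _ /=.
by rewrite Re_gt0_neq0// ReD Re_natr; apply: ltr_wpDr.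
Qed.

Let beta0 (c : R) w : 0 < complex.Re w ->
  cint `]-oo, c] (fun x => cexp (2 * w * x%:C)) = cexp (2 * w * c%:C) / (2 * w).
Proof.
move=> w0; have w20 : 2 * w != 0 by rewrite mulf_neq0 ?pnatr_eq0// Re_gt0_neq0.
have w2 : 0 < complex.Re (2 * w) by rewrite Re2; lra.
have ci : cintegrable `]-oo, c] (fun x => cexp (2 * w * x%:C)).
  apply: (@cintegrable_le _ _ _ (fun x => expR (complex.Re (2 * w) * x))) => //.
  - exact: cmeas_cexp.
  - by move=> x _; rewrite normc_cexpMr.
  - exact: integrable_expR_left.
have h := cint_exhaustion (measurable_itv _) ci.
pose F (x : R) := (2 * w)^-1 * cexp (2 * w * x%:C).
have dF : cder F (fun x => cexp (2 * w * x%:C)).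
  apply: cder_eq (cderM (cder_cst (2 * w)^-1) (cder_cexp (2 * w))) _.
  by move=> x; rewrite mul0r add0r mulrA mulVf// mul1r.
have l1 : cexp (- (2 * w) * n%:R%:C) @[n --> \oo] --> ((0 : R[i]) : R[i]^o).
  apply/cvgc_normc; under eq_fun do rewrite subr0.
  apply: (@cexp_cvg0 _ (- (2 * w)) (fun n => n%:R)) => //; last exact: cvgr_idn.
  by rewrite ReN oppr_lt0.
have l2 := ccvgM (@ccvg_cst R _ _ _ (2 * w)^-1) l1.
have l3 := ccvgB (@ccvg_cst R _ _ _ (F c)) (l2 _ _).
have -> : cexp (2 * w * c%:C) / (2 * w) = F c - (2 * w)^-1 * 0.
  by rewrite mulr0 subr0 mulrC.
refine (ccvg_unique h _); refine (cvg_near_eq _ (l3 _ _ _ _)).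
have := @cvgr_idn R; move/cvgryPge/(_ `|c|); apply: filterS => n nc.
have -> : `]-oo, c] `&` `[- n%:R, n%:R] = `[- n%:R, c]%classic.
  apply/seteqP; split=> x /=; rewrite !in_itv/=.
    by move=> [xc /andP[-> _]]; rewrite xc.
  move=> /andP[nx xc]; split => //; rewrite nx/=.
  by apply: le_trans xc _; apply: le_trans nc; exact: ler_norm.
rewrite (cint_FTC _ dF (ccont_cexp _)); last first.
  by have := ler_norm (- c); rewrite normrN; lra.
by rewrite {2}/F rmorphN mulrN mulNr.
Qed.

(** By induction: splitting one factor 1 - l e^(2 x) off the power expresses the
integral for (n + 1, w) by those for (n, w) and (n, w + 1). *)
Lemma beta_integral (l c : R) n w : 0 < l -> l * expR (2 * c) = 1 -> 0 < complex.Re w ->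
  cint `]-oo, c] (beta_itg l n w) =
  cpow l (- w) * ((n`!)%:R / 2 / \prod_(0 <= k < n.+1) (w + k%:R)).
Proof.
move=> l0 lc; elim: n w => [|n IH] w w0.
  rewrite [LHS](_ : _ = cint `]-oo, c] (fun x => cexp (2 * w * x%:C))); last first.
    by apply: eq_cint => x _; rewrite /beta_itg expr0 mul1r.
  rewrite beta0// big_nat1 addr0 /cpow.
  have -> : cexp (2 * w * c%:C) = cexp (- w * (ln l)%:C).
    congr cexp; have -> : ln l = - (2 * c).
      apply: expR_inj; rewrite lnK ?posrE// expRN.
      by apply: (mulIf (lt0r_neq0 (expR_gt0 (2 * c)))); rewrite lc mulVf// lt0r_neq0// expR_gt0.
    by rewrite rmorphN rmorphM/= rmorph_nat; ring.
  rewrite fact0; move: (cexp _) => E; have w_neq0 := Re_gt0_neq0 w0.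
  by field.
have w1 : 0 < complex.Re (w + 1) by rewrite ReD/=; lra.
rewrite [LHS](_ : _ = cint `]-oo, c] (fun x => beta_itg l n w x + (- l%:C) * beta_itg l n (w + 1) x)); last first.
  apply: eq_cint => x _; rewrite /beta_itg exprSr rmorphM/= rmorphB/= rmorph1 rmorphM/=.
  have -> : cexp (2 * (w + 1) * x%:C) = (expR (2 * x))%:C * cexp (2 * w * x%:C).
    by rewrite -cexp_real -cexpD rmorphM/= rmorph_nat; congr cexp; ring.
  by ring.
rewrite cintD//; [|exact: beta_integrable|apply: cintegrableZ => //; exact: beta_integrable].
rewrite cintZ//; last exact: beta_integrable.
rewrite !IH//.
have lE : l%:C * cpow l (- (w + 1)) = cpow l (- w).
  rewrite /cpow -[X in X%:C * _](lnK (x := l)) ?posrE// -cexp_real -cexpD.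
  by congr cexp; ring.
have factor A B : cpow l (- w) * A + - l%:C * (cpow l (- (w + 1)) * B) =
    cpow l (- w) * (A - B) by rewrite -lE; ring.
rewrite factor; congr (_ * _).
set P := \prod_(0 <= k < n) (w + 1 + k%:R).
have P0 : P != 0 by exact: prod_shift_neq0.
have wS m : \prod_(0 <= k < m.+1) (w + k%:R) = w * \prod_(0 <= k < m) (w + 1 + k%:R).
  rewrite big_nat_recl// addr0; congr (_ * _); apply: eq_bigr => k _.
  by rewrite -addrA -natr1 [1 + _]addrC.
have wR : \prod_(0 <= k < n.+1) (w + 1 + k%:R) = P * (w + n.+1%:R).
  by rewrite big_nat_recr//= -addrA -natr1 [1 + _]addrC.
rewrite (wS n.+1) wR (wS n) -/P factS natrM.
have w_neq0 := Re_gt0_neq0 w0.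
have wn_neq0 : w + n.+1%:R != 0.
  by rewrite Re_gt0_neq0// ReD Re_natr; apply: ltr_wpDr.
move: P0 wn_neq0 {wS wR}; move: P (n`!%:R : R[i]) => P a P0.
move: w_neq0; rewrite -natr1; move: (n%:R : R[i]) => m w_neq0 wm.
by field; rewrite P0 w_neq0 wm.
Qed.

End EulerLimit.

Section GammaFunction.
Context {R : realType}.
Notation mu := (@lebesgue_measure R).
Implicit Types w z : R[i].

Definition euler_gamma n w : R[i] :=
  (n`!)%:R * cpow n%:R w / \prod_(0 <= k < n.+1) (w + k%:R).

Lemma cpowM (a b : R) w : 0 < a -> 0 < b -> cpow (a * b) w = cpow a w * cpow b w.
Proof. by move=> a0 b0; rewrite /cpow -cexpD lnM ?posrE// rmorphD/= mulrDr. Qed.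

Lemma cpowN (a : R) w : cpow a (- w) = (cpow a w)^-1.
Proof. by rewrite /cpow mulNr cexpN. Qed.

Lemma cpowD (a : R) w z : cpow a (w + z) = cpow a w * cpow a z.
Proof. by rewrite /cpow mulrDl cexpD. Qed.

Lemma cpow_neq0 (a : R) w : cpow a w != 0.
Proof. exact: cexp_neq0. Qed.

Lemma normc_cpow (a : R) w : normc (cpow a w) = expR (complex.Re w * ln a).
Proof. by rewrite /cpow normc_cexpMr. Qed.

Lemma ccvg_shiftS (u : nat -> R[i]) (l : R[i]) :
  u n.+1 @[n --> \oo] --> (l : R[i]^o) -> u n @[n --> \oo] --> (l : R[i]^o).
Proof.
move=> /cvgc_ReIm[hr hi]; apply/cvgc_ReIm; split.
  by rewrite -cvg_shiftS.
by rewrite -cvg_shiftS.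
Qed.

(** Euler's approximant is 2 pi^w times the integral of beta_itg for l = pi / n, and
(1 - t / n)^n <= e^(-t) makes the Gaussian integrand a dominating function. *)
Lemma euler_gamma_cvg w : 0 < complex.Re w <= 1 ->
  euler_gamma n w @[n --> \oo] --> (2 * cpow pi w * gauss_mellin (2 * w) : R[i]^o).
Proof.
move=> /andP[w0 w1].
have p0 : 0 < pi :> R by exact: pi_gt0.
pose c (n : nat) : R := ln (n.+1%:R / pi) / 2.
pose l (n : nat) : R := pi / n.+1%:R.
pose f_ n (x : R) : R[i] := (if x <= c n then 1 else 0) * beta_itg (l n) n.+1 w x.
have nR n : 0 < n.+1%:R :> R by rewrite ltr0n.
have l0 n : 0 < l n by rewrite /l divr_gt0.
have lc n : l n * expR (2 * c n) = 1.
  rewrite /c (_ : 2 * (ln (n.+1%:R / pi) / 2) = ln (n.+1%:R / pi)); last by field.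
  rewrite lnK ?posrE ?divr_gt0// /l.
  have := nR n; move: p0; move: (pi : R) (n.+1%:R : R) => p m p0' m0; field.
  by rewrite !gt_eqF.
have E n : euler_gamma n.+1 w = 2 * cpow pi w * cint setT (f_ n).
  have -> : cint setT (f_ n) = cint `]-oo, c n] (beta_itg (l n) n.+1 w).
    rewrite /cint [in RHS]Rintegral_mkcond [in X in _ = _ +i* X]Rintegral_mkcond.
    have e (x : R) : (x \in `]-oo, c n]%classic) = (x <= c n).
      by apply/idP/idP => [/set_mem/=|h]; [|apply/mem_set => /=]; rewrite in_itv.
    congr (_ +i* _); apply: eq_Rintegral => x _; rewrite patchE e /f_; case: ifP => _;
      by rewrite ?mul1r// mul0r.
  rewrite (beta_integral n.+1 (l0 n) (lc n) w0) /euler_gamma.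
  have -> : cpow (l n) (- w) = cpow n.+1%:R w / cpow pi w.
    have lE : pi = l n * n.+1%:R by rewrite /l divfK// gt_eqF.
    rewrite lE cpowM// cpowN.
    have := cpow_neq0 (l n) w; have := cpow_neq0 n.+1%:R w.
    move: (cpow _ w) (cpow _ w) => a b b0 a0.
    by field; rewrite a0 b0.
  have q0 := cpow_neq0 pi w; have P0 := prod_shift_neq0 n.+2 w0.
  move: q0 P0; move: (cpow pi w) (cpow _ w) (\prod_(0 <= k < n.+2) _) (n.+1`!%:R : R[i]).
  by move=> p q P F p_neq0 P_neq0; field; rewrite p_neq0 P_neq0.
apply: ccvg_shiftS; under eq_fun do rewrite E.
apply: ccvgM; first exact: ccvg_cst.
have Rw2 : 0 < complex.Re (2 * w) <= 2 by rewrite Re2; lra.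
have inside n x : x <= c n -> pi * expR (2 * x) <= n.+1%:R.
  move=> xc; have : l n * expR (2 * x) <= l n * expR (2 * c n).
    by rewrite ler_pM2l// ler_expR; lra.
  by rewrite lc /l mulrAC ler_pdivrMr// mul1r.
have pe0 x : 0 <= pi * expR (2 * x) :> R by rewrite mulr_ge0 ?expR_ge0// ltW.
have lnE n x : l n * expR (2 * x) = pi * expR (2 * x) / n.+1%:R by rewrite /l mulrAC.
refine (@cint_dominated R setT f_ (fun y => (gauss y)%:C * cexp (2 * w * y%:C))
  (fun y => gauss y * expR (complex.Re (2 * w) * y)) measurableT _ _ _ _).
- move=> n; apply: cmeasM; last exact/ccont_meas/beta_itg_cont.
  have h : measurable_fun setT (fun y : R => if y <= c n then 1 : R else 0).
    apply: measurable_fun_ifT => //.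
    by apply: measurable_fun_ler => //; exact: measurable_cst.
  have -> : (fun y : R => if y <= c n then 1 else 0 : R[i]) =
      (fun y => (if y <= c n then 1 else 0 : R)%:C).
    by apply/funext => y; case: ifP.
  exact: cmeas_real.
- move=> x _.
  apply: (@cvg_near_eq _ _ _ _ _ (fun n => ((1 - l n * expR (2 * x)) ^+ n.+1)%:C * cexp (2 * w * x%:C))).
    have := @cvgr_idn R; move/cvgryPge/(_ (pi * expR (2 * x))); apply: filterS => n xn.
    rewrite /f_ /beta_itg ifT ?mul1r// leNgt; apply/negP => cx.
    have : l n * expR (2 * c n) < l n * expR (2 * x) by rewrite ltr_pM2l// ltr_expR; lra.
    rewrite lc lnE ltr_pdivlMr// mul1r => h; have : n%:R <= n.+1%:R :> R by rewrite ler_nat.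
    by lra.
  apply: ccvgM; last exact: ccvg_cst.
  apply/cvgc_ReIm; split => /=; last exact: cvg_cst.
  have := cvg_expR_limit (pe0 x); rewrite -cvg_shiftS.
  by under eq_fun do rewrite -lnE.
- exact: gauss_exp_integrable.
- move=> n x _; rewrite /f_; case: ifPn => [xc|_]; last first.
    by rewrite mul0r normc0 mulr_ge0 ?expR_ge0.
  rewrite mul1r /beta_itg (normcM (_)%:C) normc_real normc_cexpMr ler_wpM2r ?expR_ge0//.
  have /andP[h1 h2] := expR_limit_le (pe0 x) (inside _ _ xc) (ltn0Sn n).
  by rewrite lnE ger0_norm.
Qed.

Lemma GammaE w : 0 < complex.Re w <= 1 ->
  Gamma w = 2 * cpow pi w * gauss_mellin (2 * w).
Proof.
move=> w01; have h := euler_gamma_cvg w01.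
exact: (@cvg_lim R[i]^o (@norm_hausdorff _ R[i]^o) _ _ _ (fun n => euler_gamma n w) _ h).
Qed.

Lemma gauss_mellin_real_neq0 (s : R) : 0 < s <= 2 -> gauss_mellin s%:C != 0.
Proof.
move=> s02; apply/eqP => /(congr1 (@complex.Re R)) h.
have e : complex.Re (gauss_mellin s%:C) = \int[mu]_x (gauss x * expR (s * x)).
  apply: eq_Rintegral => x _.
  have -> : cexp (s%:C * x%:C) = (expR (s * x))%:C by rewrite -cexp_real rmorphM.
  by rewrite ReMr.
by have := gauss_exp_pos s02; rewrite -e h ltxx.
Qed.

Lemma normc_shift_le (x y : R) k : 0 < x ->
  normc ((x +i* y) + k%:R) <= (x + k%:R) * expR (y ^+ 2 / (x + k%:R) ^+ 2).
Proof.
move=> x0; have a0 : 0 < x + k%:R by apply: ltr_wpDr.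
have -> : (x +i* y) + k%:R = (x + k%:R) +i* y.
  by apply/eqP; rewrite eq_complex ReD ImD Re_natr/= -(rmorph_nat (real_complex R))/= addr0 !eqxx.
move: (x + k%:R) a0 => a a0.
have u0 : 0 <= y ^+ 2 / a ^+ 2 by rewrite divr_ge0 ?sqr_ge0.
apply: (@le_trans _ _ (a * (1 + y ^+ 2 / a ^+ 2))); last first.
  by rewrite ler_pM2l//; exact: expR_ge1Dx.
rewrite /normc -[leRHS]ger0_norm; last by rewrite mulr_ge0 ?ltW//; lra.
rewrite -sqrtr_sqr ler_wsqrtr// exprMn.
have yE : y ^+ 2 = a ^+ 2 * (y ^+ 2 / a ^+ 2) by field; rewrite gt_eqF.
rewrite {1}yE; move: (y ^+ 2 / a ^+ 2) u0 => u u0.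
have : 0 <= a ^+ 2 * (u + u ^+ 2) by rewrite mulr_ge0 ?sqr_ge0// addr_ge0// sqr_ge0.
by rewrite -subr_ge0 => h; rewrite -subr_ge0; lra.
Qed.

(** The sum of 1 / (x + k)^2 for 1 <= k <= n is at most that of 2 / (k (k + 1)),
which telescopes to 2 (1 - 1 / (n + 1)). *)
Lemma prod_shift_le (x y : R) n : 0 < x ->
  normc (\prod_(0 <= k < n.+1) ((x +i* y) + k%:R)) <=
  normc (\prod_(0 <= k < n.+1) (x%:C + k%:R)) *
    expR (y ^+ 2 * (x ^- 2 + 2 * (1 - n.+1%:R^-1))).
Proof.
move=> x0; elim: n => [|n IH].
  rewrite !big_nat1 !addr0 normc_real gtr0_norm//.
  have := normc_shift_le y 0 x0; rewrite !addr0 => h; apply: le_trans h _.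
  by rewrite invr1 subrr mulr0 addr0.
rewrite big_nat_recr//= [in leRHS]big_nat_recr//= !normcM.
have xn0 : 0 < x + n.+1%:R by apply: ltr_wpDr.
have -> : normc (x%:C + n.+1%:R) = x + n.+1%:R.
  by rewrite -(rmorph_nat (real_complex R)) -rmorphD/= normc_real gtr0_norm.
apply: le_trans (ler_pM (normc_ge0 _) (normc_ge0 _) IH (normc_shift_le y n.+1 x0)) _.
set A := normc _; set E1 := expR _; set E2 := expR _; set E3 := expR _.
rewrite mulrACA ler_wpM2l ?mulr_ge0 ?normc_ge0 ?(ltW xn0)//.
rewrite /E1 /E2 /E3 -expRD ler_expR -mulrDr ler_wpM2l ?sqr_ge0//.
rewrite -addrA lerD2l.
have m0 : 0 < n.+1%:R :> R by rewrite ltr0n.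
have -> : n.+2%:R = n.+1%:R + 1 :> R by rewrite natr1.
have m1 : 1 <= n.+1%:R :> R by rewrite ler1n.
move: (n.+1%:R : R) m0 m1 xn0 => m m0 m1 xm0.
apply: (@le_trans _ _ (2 * (1 - m^-1) + m ^- 2)).
  by rewrite lerD2l lef_pV2 ?posrE ?exprn_gt0// lerXn2r ?nnegrE; lra.
have m10 : 0 < m + 1 by lra.
have -> : 2 * (1 - (m + 1)^-1) = 2 * (1 - m^-1) + 2 / (m * (m + 1)).
  by field; rewrite !gt_eqF.
rewrite lerD2l -div1r ler_pdivrMr ?exprn_gt0// mulrAC ler_pdivlMr ?mulr_gt0//.
by nra.
Qed.

(** This is the absence of zeros of Gamma, from Euler's limit: by prod_shift_le
the moduli of the approximants at x + i y are at least a fixed positive multiple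
of those at the real point x, whose limit is a positive integral. *)
Lemma gauss_mellin_neq0 z : 0 < complex.Re z <= 2 -> gauss_mellin z != 0.
Proof.
move=> z02; pose x := complex.Re z / 2; pose y := complex.Im z / 2.
pose w := x +i* y.
have zE : z = 2 * w.
  rewrite /w /x /y (_ : 2 * _ = w + w); last by rewrite /w/x/y; ring.
  by apply/eqP; rewrite eq_complex ReD ImD /w /x /y/=; apply/andP; split; apply/eqP; field.
have x0 : 0 < x by rewrite /x; lra.
have x1 : x <= 1 by rewrite /x; lra.
have w01 : 0 < complex.Re w <= 1 by rewrite /w/= x0.
have xc01 : 0 < complex.Re x%:C <= 1 by rewrite /= x0.
have cw := euler_gamma_cvg w01; have cx := euler_gamma_cvg xc01.
pose e := expR (- (y ^+ 2 * (x ^- 2 + 2))).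
have H n : e * normc (euler_gamma n x%:C) <= normc (euler_gamma n w).
  have nE v : normc (euler_gamma n v) = normc (n`!%:R : R[i]) *
      expR (complex.Re v * ln n%:R) / normc (\prod_(0 <= k < n.+1) (v + k%:R)).
    by rewrite /euler_gamma normcM normcV (normcM (_%:R)) normc_cpow.
  rewrite !nE [complex.Re w]/= [complex.Re x%:C]/=.
  set a := normc _ * expR _.
  have a0 : 0 <= a by rewrite mulr_ge0 ?normc_ge0 ?expR_ge0.
  rewrite mulrCA ler_wpM2l//.
  have q0 : 0 < normc (\prod_(0 <= k < n.+1) (x%:C + k%:R)).
    rewrite lt_neqAle normc_ge0 andbT eq_sym; apply/eqP => /eq0_normc h.
    by have := @prod_shift_neq0 R x%:C n.+1 x0; rewrite h eqxx.
  have Q0 : 0 < normc (\prod_(0 <= k < n.+1) (w + k%:R)).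
    rewrite lt_neqAle normc_ge0 andbT eq_sym; apply/eqP => /eq0_normc h.
    by have := @prod_shift_neq0 R w n.+1 x0; rewrite h eqxx.
  rewrite -[leRHS]div1r ler_pdivlMr// mulrAC ler_pdivrMr// mul1r.
  apply: le_trans (ler_wpM2l (expR_ge0 _) (prod_shift_le y n x0)) _.
  rewrite mulrCA ler_piMr ?normc_ge0// /e -expRD expR_le1.
  have : 0 <= y ^+ 2 * (n.+1%:R)^-1 by rewrite mulr_ge0 ?sqr_ge0// invr_ge0.
  by move: (y ^+ 2) (x ^- 2) (n.+1%:R^-1 : R) => u1 u2 u3 h; lra.
have := gauss_mellin_real_neq0 (s := 2 * x).
rewrite (_ : (2 * x)%:C = 2 * x%:C); last by rewrite rmorphM/= rmorph_nat.
move=> /(_ _)/wrap[|g0]; first by rewrite mulr_gt0//=; lra.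
rewrite zE; apply/eqP => gw0; rewrite gw0 mulr0 in cw.
have /eqP[] := g0.
suff : 2 * cpow pi x%:C * gauss_mellin (2 * x%:C) = 0.
  have c0 : 2 * cpow pi x%:C != 0.
    by apply: mulf_neq0; [rewrite pnatr_eq0|exact: cpow_neq0].
  by move/eqP; rewrite mulf_eq0 (negbTE c0) => /eqP.
apply: (ccvg_unique cx); apply/cvgc_normc; under eq_fun do rewrite subr0.
move/cvgc_normc : cw; under eq_fun do rewrite subr0; move=> cw.
have e0 : 0 < e by exact: expR_gt0.
apply: (@squeeze_cvgr _ _ _ _ (fun=> 0) (fun n => e^-1 * normc (euler_gamma n w))).
- apply: nearW => n; rewrite normc_ge0/= -(ler_pM2l e0) mulrA divff ?mul1r//.
  by rewrite gt_eqF.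
- exact: cvg_cst.
- by rewrite -[X in _ --> X](mulr0 e^-1); apply: cvgM; [exact: cvg_cst|].
Qed.

(** The powers of pi in rho_infty cancel those relating Gamma to gauss_mellin,
and what remains is the quotient in cos_mellin_gauss. *)
Lemma rho_inftyE z : complex.Re z = 1 / 2 ->
  rho_infty z = cos_mellin z / (@gauss_mass R)%:C.
Proof.
move=> zh.
have z02 : 0 < complex.Re z <= 2 by rewrite zh; lra.
have zh' : complex.Re (1 - z) = 1 / 2 by rewrite ReD ReN zh/=; lra.
have z02' : 0 < complex.Re (1 - z) <= 2 by rewrite zh'; lra.
have half z' : 2 * (z' / 2) = z' by field.
have Rhalf z' : complex.Re z' = 1 / 2 -> 0 < complex.Re (z' / 2) <= 1.
  by move=> h; have := Re2 (z' / 2); rewrite half h; lra.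
rewrite /rho_infty (GammaE (Rhalf _ zh)) (GammaE (Rhalf _ zh')) !half.
have gE := cos_mellin_gauss zh.
have g0 : gauss_mellin (1 - z) != 0 by exact: gauss_mellin_neq0.
have m0 : (@gauss_mass R)%:C != 0 by rewrite (inj_eq (@complexI R)) gt_eqF// gauss_mass_gt0.
have n1 (u : R[i]) : cpow pi (- u / 2) * (2 * cpow pi (u / 2) * gauss_mellin u) = 2 * gauss_mellin u.
  by rewrite mulNr cpowN; have := cpow_neq0 pi (u / 2) => q0; field.
rewrite !n1; have -> : cos_mellin z = gauss_mass%:C * gauss_mellin z / gauss_mellin (1 - z).
  by rewrite gE mulfK.
by field; rewrite g0 m0.
Qed.

End GammaFunction.

(** * The Euler factor and the sum of the right halves *)

Section GeometricTail.
Context {R : realType}.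

Lemma geometric_tail (f : nat -> R[i]) (C q : R) M N : 0 <= q -> q < 1 ->
  (forall m, normc (f m) <= C * q ^+ m) -> (M <= N)%N ->
  normc (\sum_(M <= m < N) f m) <= C / (1 - q) * (q ^+ M - q ^+ N).
Proof.
move=> q0 q1 fC; have q1' : 1 - q != 0 by rewrite gt_eqF// subr_gt0.
elim: N => [|N IH].
  by rewrite leqn0 => /eqP ->; rewrite big_geq// normc0 subrr mulr0.
rewrite leq_eqVlt => /predU1P[->|]; first by rewrite big_geq// normc0 subrr mulr0.
rewrite ltnS => MN; rewrite big_nat_recr//=.
apply: le_trans (le_normcD _ _) _; apply: le_trans (lerD (IH MN) (fC N)) _.
rewrite le_eqVlt; apply/orP; left; apply/eqP; rewrite exprS.
by field.
Qed.

Lemma geometric_sum_le (f : nat -> R[i]) (C q : R) M N : 0 <= C -> 0 <= q -> q < 1 ->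
  (forall m, normc (f m) <= C * q ^+ m) -> (M <= N)%N ->
  normc (\sum_(M <= m < N) f m) <= C / (1 - q) * q ^+ M.
Proof.
move=> C0 q0 q1 fC MN; apply: le_trans (geometric_tail q0 q1 fC MN) _.
rewrite ler_wpM2l ?divr_ge0 ?subr_ge0 ?(ltW q1)//.
by rewrite lerBlDr lerDl exprn_ge0.
Qed.

Lemma real_geometric_sum_le (u : nat -> R) (C q : R) M N : 0 <= C -> 0 <= q -> q < 1 ->
  (forall m, `|u m| <= C * q ^+ m) -> (M <= N)%N ->
  `|\sum_(M <= m < N) u m| <= C / (1 - q) * q ^+ M.
Proof.
move=> C0 q0 q1 uC MN; rewrite -normc_real rmorph_sum/=.
by apply: geometric_sum_le => // m; rewrite normc_real.
Qed.

Lemma geometric_series_limit (u : nat -> R) (C q : R) : 0 <= C -> 0 <= q -> q < 1 ->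
  (forall m, `|u m| <= C * q ^+ m) ->
  series u n @[n --> \oo] --> limn (series u) /\
  forall M, `|limn (series u) - series u M| <= C / (1 - q) * q ^+ M.
Proof.
move=> C0 q0 q1 uC.
have cu : cvgn (series u).
  apply: normed_cvg; apply: (@series_le_cvg _ _ (geometric C q)).
  - by move=> n; rewrite normr_ge0.
  - by move=> n; rewrite /geometric/= mulr_ge0// exprn_ge0.
  - by move=> n; exact: uC.
  - by apply: is_cvg_geometric_series; rewrite ger0_norm.
split=> // M.
have h : `|series u n - series u M| @[n --> \oo] --> `|limn (series u) - series u M|.
  by apply: cvg_norm; apply: cvgB => //; exact: cvg_cst.
apply: (cvgr_to_le h); exists M => // n /= Mn.
rewrite /series/= (@big_cat_nat _ _ _ M 0 n)//= addrAC subrr add0r.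
exact: real_geometric_sum_le.
Qed.

End GeometricTail.

Section LaplaceLinear.
Context {R : realType}.

Lemma laplace_linear (K H : R -> R) (B B' c : R) (w : R[i]) :
  measurable_fun setT K -> (forall y, 0 <= y -> `|K y| <= B) ->
  measurable_fun setT H -> (forall y, 0 <= y -> `|H y| <= B') -> complex.Re w < 0 ->
  laplace (fun y => K y + c * H y) w = laplace K w + c%:C * laplace H w.
Proof.
move=> mK KB mH HB w0.
have iK := laplace_integrable mK KB w0; have iH := laplace_integrable mH HB w0.
rewrite /laplace -(cintZ c%:C (measurable_itv _) iH).
rewrite -(cintD (measurable_itv _) iK (cintegrableZ c%:C (measurable_itv _) iH)).
by apply: eq_cint => y _; rewrite rmorphD/= rmorphM/=; ring.
Qed.

End LaplaceLinear.

Section EulerFactor.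
Context {R : realType}.
Variable p : nat.
Hypothesis p_gt1 : (1 < p)%N.
Implicit Types z : R[i].

Let P : R := p%:R.
Let L : R := ln P.

(** Powers and coefficients of the expansion, for Re z > 0, of
rho_p z = (1 - p^(-1) p^z) / (1 - p^(-z)) in powers of p^(-z), starting with
p^z: the term of index m is the coefficient times e^(- z euler_shift m). *)
Definition euler_shift m : R := (m%:R - 1) * ln (p%:R : R).
Definition euler_coef m : R := if m is 0%N then - P^-1 else 1 - P^-1.

Let P1 : 1 < P. Proof. by rewrite /P ltr1n. Qed.
Let P0 : 0 < P. Proof. by have := P1; lra. Qed.
Let L0 : 0 < L. Proof. exact: ln_gt0. Qed.
Let Pinv : 0 < P^-1 < 1. Proof. by rewrite invr_gt0 P0/= invf_lt1. Qed.

Lemma coef_le m : `|euler_coef m| <= 1.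
Proof.
have /andP[h0 h1] := Pinv; case: m => [|m] /=; first by rewrite normrN ger0_norm; lra.
by rewrite ger0_norm; lra.
Qed.

(** The modulus of p^(-z) on the critical line. *)
Definition sqrt_ratio : R := expR (- L / 2).

Let q := sqrt_ratio.

Lemma sqrt_ratio_itv : 0 < q < 1.
Proof. by rewrite /q /sqrt_ratio expR_gt0 expR_lt1/=; have := L0; lra. Qed.

Lemma sqrt_ratio_sqr : q ^+ 2 = P^-1.
Proof.
by rewrite /q /sqrt_ratio -expRM_natl mulrC divfK// expRN lnK// posrE.
Qed.

Lemma expR_shift_half m : expR (- euler_shift m / 2) = q^-1 * q ^+ m.
Proof.
rewrite /q /sqrt_ratio -expRN -expRM_natl -expRD; congr expR.
by rewrite /euler_shift -/P -/L; field.
Qed.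

Lemma expR_shift m : expR (- euler_shift m) = P * (P^-1) ^+ m.
Proof.
have -> : - euler_shift m = (- euler_shift m / 2) + (- euler_shift m / 2) by field.
rewrite expRD expR_shift_half mulrACA -invfM -expr2 sqrt_ratio_sqr invrK.
by rewrite -exprMn -expr2 sqrt_ratio_sqr.
Qed.

Let kterm m y := euler_coef m * (expR (- euler_shift m) * sinkernel (y + euler_shift m)).

Let kterm_le m y : `|kterm m y| <= P * P^-1 ^+ m.
Proof.
rewrite /kterm normrM (normrM (expR _)) (ger0_norm (expR_ge0 _)) -expR_shift.
rewrite -[leRHS]mul1r; apply: ler_pM => //; rewrite ?mulr_ge0 ?expR_ge0//.
  exact: coef_le.
apply: ler_piMr; first exact: expR_ge0.
exact: sinkernel_le.
Qed.

Let Kpart M y := series (kterm ^~ y) M.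
Let K y := limn (series (kterm ^~ y)).
Let C := P / (1 - P^-1).

Let Pi1 : 0 <= P^-1 < 1. Proof. by have /andP[h ->] := Pinv; rewrite ltW. Qed.

Let C0 : 0 <= C.
Proof. by have /andP[h1 h2] := Pi1; rewrite /C divr_ge0 ?ltW ?subr_gt0. Qed.

Let K_lim y : Kpart n y @[n --> \oo] --> K y.
Proof.
have /andP[h1 h2] := Pi1.
exact: (geometric_series_limit (ltW P0) h1 h2 (kterm_le ^~ y)).1.
Qed.

Let K_tail y M : `|K y - Kpart M y| <= C * P^-1 ^+ M.
Proof.
have /andP[h1 h2] := Pi1.
exact: (geometric_series_limit (ltW P0) h1 h2 (kterm_le ^~ y)).2.
Qed.

Let kterm_meas m : measurable_fun setT (kterm m).
Proof.
apply: continuous_measurable_fun => y; apply: cvgM; first exact: cvg_cst.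
by apply: cvgM; [exact: cvg_cst|exact: (@cont_shift R (euler_shift m) _ (@sinkernel_cont R) y)].
Qed.

Let Kpart_meas M : measurable_fun setT (Kpart M).
Proof.
elim: M => [|M IH].
  by rewrite /Kpart /series/=; under eq_fun do rewrite big_geq//; exact: measurable_cst.
rewrite /Kpart /series/=; under eq_fun do rewrite big_nat_recr//=.
by apply: measurable_funD => //; exact: IH.
Qed.

Let K_meas : measurable_fun setT K.
Proof.
apply: (@measurable_fun_cvg _ _ _ setT Kpart K); first exact: Kpart_meas.
by move=> y _; exact: K_lim.
Qed.

Let K_bound y : 0 <= y -> `|K y| <= C.
Proof. by move=> _; have := K_tail y 0; rewrite /Kpart /series/= big_geq// subr0 expr0 mulr1. Qed.

Let Kpart_bound M y : 0 <= y -> `|Kpart M y| <= C.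
Proof.
move=> _; have /andP[h1 h2] := Pi1.
have := real_geometric_sum_le (ltW P0) h1 h2 (kterm_le ^~ y) (leq0n M).
by rewrite expr0 mulr1.
Qed.

Definition right_part M z := \sum_(0 <= m < M) (euler_coef m)%:C * right_mell (euler_shift m) z.
Definition left_part M z := \sum_(0 <= m < M) (euler_coef m)%:C * left_mell (euler_shift m) z.
(** All the right halves have the form of a Laplace transform of a translate of
sinkernel at the same point z - 1. The series therefore sums to the transform of
the summed kernel K, whose terms decay like p^(-m), and holomorphy of the sum is
that of a single Laplace transform. *)
Definition right_total z : R[i] := (1 - z) * laplace K (z - 1) - (K 0)%:C.

Let right_partE M z : complex.Re z < 1 ->
  right_part M z = (1 - z) * laplace (Kpart M) (z - 1) - (Kpart M 0)%:C.
Proof.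
move=> z1; have zm : complex.Re (z - 1) < 0 by rewrite ReD/=; lra.
elim: M => [|M IH].
  have K0 y : Kpart 0 y = 0 by rewrite /Kpart /series/= big_geq.
  have b0 y : 0 <= y -> `|Kpart 0 y| <= 0 by rewrite K0 normr0.
  have l0 : laplace (Kpart 0) (z - 1) = 0.
    apply: eq0_normc; apply: le_anti; rewrite normc_ge0 andbT.
    by have := laplace_bound (Kpart_meas 0) b0 zm; rewrite mul0r mulr0.
  by rewrite /right_part big_geq// K0 l0 mulr0 subr0.
rewrite /right_part big_nat_recr//= -/(right_part M z) IH.
have -> : Kpart M.+1 = (fun y => Kpart M y + (euler_coef M * expR (- euler_shift M)) * sinkernel (y + euler_shift M)).
  by apply/funext => y; rewrite /Kpart /series/= big_nat_recr//= /kterm mulrA.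
rewrite (laplace_linear _ (Kpart_meas M) (@Kpart_bound M) (B' := 1))//; last 2 first.
- by apply: continuous_measurable_fun; apply: cont_shift; exact: sinkernel_cont.
- by move=> y _; exact: sinkernel_le.
rewrite add0r /right_mell rmorphD/= !rmorphM/=; ring.
Qed.

(** Convergence for each fixed z; it identifies right_total as the sum of the
right halves. *)
Lemma right_total_approx M z : complex.Re z < 1 ->
  normc (right_total z - right_part M z) <=
  (normc (1 - z) * (2 * (1 - complex.Re z)^-1) + 1) * (C * P^-1 ^+ M).
Proof.
move=> z1; have zm : complex.Re (z - 1) < 0 by rewrite ReD/=; lra.
rewrite right_partE// /right_total.
pose D y := K y - Kpart M y.
have DE : laplace K (z - 1) = laplace (Kpart M) (z - 1) + 1%:C * laplace D (z - 1).
  rewrite -(laplace_linear 1 (Kpart_meas M) (@Kpart_bound M) (B' := C * P^-1 ^+ M))//.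
  - by congr laplace; apply/funext => y; rewrite /D mul1r addrC subrK.
  - exact: measurable_funB.
  - by move=> y _; exact: K_tail.
have Db : normc (laplace D (z - 1)) <= 2 * (C * P^-1 ^+ M * (1 - complex.Re z)^-1).
  have := @laplace_bound _ D (C * P^-1 ^+ M) _ _ _ zm.
  rewrite (_ : - complex.Re (z - 1) = 1 - complex.Re z); last by rewrite ReD/=; ring.
  by apply; [exact: measurable_funB|move=> y _; exact: K_tail].
have -> : (1 - z) * laplace K (z - 1) - (K 0)%:C -
    ((1 - z) * laplace (Kpart M) (z - 1) - (Kpart M 0)%:C) =
    (1 - z) * laplace D (z - 1) - (D 0)%:C.
  by rewrite DE /D rmorphB/=; ring.
apply: le_trans (le_normcD _ _) _; rewrite normcN normcM normc_real mulrDl mul1r.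
apply: lerD; last exact: K_tail.
rewrite -mulrA ler_wpM2l ?normc_ge0//; apply: le_trans Db _.
by rewrite le_eqVlt; apply/orP; left; apply/eqP; ring.
Qed.

Definition right_const := 144 * q^-1 / (1 - q).

Let right_mell_term z : complex.Re z <= 1 / 2 ->
  forall m, normc ((euler_coef m)%:C * right_mell (euler_shift m) z) <= 144 * q^-1 * q ^+ m.
Proof.
move=> zh m; rewrite normcM normc_real -mulrA -expR_shift_half -[leRHS]mul1r.
by apply: ler_pM; rewrite ?normc_ge0// ?coef_le// right_mell_bound.
Qed.

Lemma right_total_cvg z : complex.Re z < 1 ->
  right_part n z @[n --> \oo] --> (right_total z : R[i]^o).
Proof.
move=> z1; apply/cvgc_normc.
pose B := (normc (1 - z) * (2 * (1 - complex.Re z)^-1) + 1) * C.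
apply: (@squeeze_cvgr _ _ _ _ (fun=> 0) (fun n => B * P^-1 ^+ n)).
- apply: nearW => n; rewrite normc_ge0/= normcB /B -[leRHS]mulrA.
  exact: right_total_approx.
- exact: cvg_cst.
- rewrite -[X in _ --> X](mulr0 B); apply: cvgM; first exact: cvg_cst.
  by have /andP[h1 h2] := Pi1; apply: cvg_expr; rewrite ger0_norm.
Qed.

(** Uniform in z, in contrast to right_total_approx whose constant grows with |z|:
here the bound on each right half by e^(- a / 2), with a = euler_shift m, is summed. *)
Lemma right_total_tail M z : complex.Re z <= 1 / 2 ->
  normc (right_total z - right_part M z) <= right_const * q ^+ M.
Proof.
move=> zh; have z1 : complex.Re z < 1 by lra.
have /andP[q0 q1] := sqrt_ratio_itv.
have h := ccvgB (right_total_cvg z1) (@ccvg_cst R _ _ _ (right_part M z)).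
apply: (@limit_normc_le _ _ _ _ (h _ _)); exists M => // n /= Mn.
rewrite /right_part (@big_cat_nat _ _ _ M 0 n)//= addrAC subrr add0r /right_const.
apply: geometric_sum_le => //; rewrite ?ltW//; last exact: right_mell_term.
by rewrite mulr_gt0 ?invr_gt0.
Qed.

Lemma right_total_bound z : complex.Re z <= 1 / 2 -> normc (right_total z) <= right_const.
Proof.
by move=> zh; have := right_total_tail 0 zh; rewrite /right_part big_geq// subr0 expr0 mulr1.
Qed.

Lemma right_total_differentiable (z : R[i]^o) : complex.Re z < 1 ->
  differentiable (right_total : R[i]^o -> R[i]^o) z.
Proof.
move=> z1; have zm : complex.Re ((z : R[i]) - 1) < 0 by rewrite ReD/=; lra.
have /derivable1_diffP h := laplace_derivable K_meas K_bound zm.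
have s1 : differentiable ((fun z => z - (1 : R[i])) : R[i]^o -> R[i]^o) z.
  by apply: differentiableB; [exact: ex_diff|exact: differentiable_cst].
apply: (@differentiableB R[i] R[i]^o R[i]^o
  (fun z => (1 - (z : R[i])) * laplace K ((z : R[i]) - 1) : R[i]^o)); last exact: differentiable_cst.
apply: (@differentiableM R[i] R[i]^o (fun z => (1 : R[i]) - (z : R[i]) : R[i]^o)
  (fun z => laplace K ((z : R[i]) - 1) : R[i]^o)).
  by apply: differentiableB; [exact: differentiable_cst|exact: ex_diff].
exact: (differentiable_comp s1 h).
Qed.

(** With Q = p^(-z), |Q| = q, the sum falls short of rho_p z by exactly
(1 - 1 / p) Q^M / (1 - Q). *)
Lemma sum_coef_shift M z : complex.Re z = 1 / 2 ->
  normc (rho_p p z - \sum_(0 <= m < M.+1) (euler_coef m)%:C * cexp (- (z * (euler_shift m)%:C)))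
  <= q ^+ M / (1 - q).
Proof.
move=> zh; have /andP[q0 q1] := sqrt_ratio_itv; have /andP[h1 h2] := Pi1.
pose Q := cpow P (- z).
have nQ : normc Q = q.
  by rewrite /Q normc_cpow ReN zh /sqrt_ratio; congr expR; rewrite -/L; ring.
have Q0 : Q != 0 by exact: cpow_neq0.
have Q1 : 1 - Q != 0.
  apply: contraTneq q1 => /eqP; rewrite subr_eq0 => /eqP E.
  by rewrite -nQ -E (_ : 1 = 1%:C)// normc_real normr1 ltxx.
have term m : cexp (- (z * (euler_shift m)%:C)) = Q ^+ m / Q.
  elim: m => [|m IH].
    rewrite expr0 div1r /Q -cpowN opprK /euler_shift /cpow; congr cexp.
    by rewrite sub0r mulN1r rmorphN/= mulrN opprK.
  rewrite exprS -mulrA -IH /Q /cpow -cexpD; congr cexp.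
  by rewrite /euler_shift !rmorphM !rmorphB/= -natr1 rmorphD/=; ring.
have P0' : P%:C != 0 :> R[i] by rewrite fmorph_eq0 gt_eqF.
have cP : cpow P 1 = P%:C by rewrite /cpow mul1r cexp_real lnK// posrE.
have cz : cpow P (z - 1) = (P%:C)^-1 / Q by rewrite cpowD /Q !cpowN cP invrK mulrC.
have rE : rho_p p z = (1 - (P%:C)^-1 / Q) / (1 - Q) by rewrite -cz.
have S : \sum_(0 <= m < M.+1) (euler_coef m)%:C * cexp (- (z * (euler_shift m)%:C)) =
   rho_p p z - (1 - P^-1)%:C * Q ^+ M / (1 - Q).
  rewrite rE; elim: M => [|M IH].
    by rewrite big_nat1 term /= expr0 rmorphN rmorphB/= fmorphV/=;
    move: (P%:C) (Q) P0' Q0 Q1 => U V U0 V0 V1; field; rewrite U0 V0 V1.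
  by rewrite big_nat_recr//= IH term /= rmorphB/= fmorphV/= !exprS;
    move: (P%:C) (Q) P0' Q0 Q1 => U V U0 V0 V1; field; rewrite U0 V0 V1.
rewrite S opprB addrCA subrr addr0.
have d0 : 1 - q <= normc (1 - Q).
  have := le_normcD (1 - Q) Q; rewrite subrK nQ (_ : normc 1 = 1); first by lra.
  by rewrite (_ : 1 = 1%:C)// normc_real normr1.
rewrite -mulrA normcM normc_real -[leRHS]mul1r; apply: ler_pM; rewrite ?normc_ge0//.
  by rewrite ger0_norm; lra.
have nQX : normc (Q ^+ M) = q ^+ M.
  elim: M {S} => [|M IH]; first by rewrite !expr0 (_ : 1 = 1%:C)// normc_real normr1.
  by rewrite !exprS normcM IH nQ.
rewrite normcM nQX normcV ler_wpM2l ?exprn_ge0 ?(ltW q0)//.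
by rewrite lef_pV2 ?posrE//; lra.
Qed.

End EulerFactor.

(** * Functions on the unit circle *)

Section CircleFunctions.
Context {R : realType}.
Implicit Types (v x : R[i]) (f g : R[i] -> R[i]).

Lemma unit_circleP v : unit_circle v <-> normc v = 1.
Proof.
rewrite /unit_circle/= normcP; split; first by move/complexI.
by move=> ->.
Qed.

Lemma normc_sqr v : normc v ^+ 2 = complex.Re v ^+ 2 + complex.Im v ^+ 2.
Proof. by case: v => a b; rewrite /normc sqr_sqrtr// addr_ge0// sqr_ge0. Qed.

Lemma cis_unit (t : R) : unit_circle (cis t).
Proof. by apply/unit_circleP; rewrite /cis /normc cos2Dsin2 sqrtr1. Qed.

Lemma cis_neq1 (t : R) : 0 < t < 2 * pi -> cis t != 1.
Proof.
move=> /andP[t0 t2]; apply/eqP => /(congr1 (@complex.Re R))/= c1.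
have s0 : 0 < sin (t / 2) by apply: sin_gt0_pi; rewrite divr_gt0// ltr_pdivrMr// mulrC.
have := cos2Dsin2 (t / 2).
have : cos t = cos (t / 2) ^+ 2 - sin (t / 2) ^+ 2.
  have -> : cos t = cos (t / 2 + t / 2) by congr cos; field.
  by rewrite cosD -!expr2.
have := exprn_gt0 2 s0; lra.
Qed.

Lemma cis_cvg (t : R) : cis s @[s --> t] --> (cis t : R[i]^o).
Proof.
by apply/cvgc_ReIm; split => /=; [exact: continuous_cos|exact: continuous_sin].
Qed.

Lemma continuous_circleP f :
  continuous_circle f <-> forall v, unit_circle v ->
    normc (f x - f v) @[x --> within unit_circle (nbhs (v : R[i]^o))] --> (0 : R).
Proof.
split=> [/subspace_continuousP h v cv|h].
  by apply/cvgc_normc; exact: h.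
by apply/subspace_continuousP => v cv; apply/cvgc_normc; exact: h.
Qed.

Lemma continuous_circle_cis f : continuous_circle f ->
  forall t : R, f (cis s) @[s --> t] --> (f (cis t) : R[i]^o).
Proof.
move=> /subspace_continuousP h t; apply: cvg_comp; last exact: (h _ (cis_unit t)).
move=> A; rewrite /within/= => nA.
have h1 : nbhs t (cis @^-1` (fun x => unit_circle x -> A x)) := @cis_cvg t _ nA.
by apply: filterS h1 => s /=; apply; exact: cis_unit.
Qed.

Lemma measurable_angles (k : R -> R) :
  measurable_fun `]0, 2 * pi[ k -> measurable_fun angles k.
Proof.
move=> mk.
have -> : (angles : set R) = ([set 0] `|` `]0, 2 * pi[) `|` [set 2 * pi].
  rewrite /angles; have p0 : 0 < 2 * pi :> R by rewrite mulr_gt0// pi_gt0.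
  apply/seteqP; split => t /=; rewrite !in_itv/=.
    rewrite !le_eqVlt => /andP[/orP[/eqP ->|h0] /orP[/eqP ->|h1]].
    + by right. + by left; left. + by right. + by left; right; rewrite h0 h1.
  by move=> [[->|/andP[h0 h1]]|->]; rewrite ?lexx ?(ltW p0) ?(ltW h0) ?(ltW h1).
apply/measurable_funU => //; first exact: measurableU.
split; last exact: measurable_fun_set1.
apply/measurable_funU => //; split=> //; exact: measurable_fun_set1.
Qed.

(** Only the two angles 0 and 2 pi give the point 1. *)
Lemma ae_circle_neq1 (P : R[i] -> Prop) :
  (forall v, unit_circle v -> v != 1 -> P v) -> ae_circle P.
Proof.
move=> h.
have n0 : (@lebesgue_measure R).-negligible [set 0; 2 * pi].
  exists [set 0; 2 * pi]; split => //; first exact: measurableU.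
  by apply: countable_lebesgue_measure0; exact: finite_set_countable.
apply: negligibleS n0 => t /=; apply: contra_notP => /not_orP[t0 t1].
rewrite /angles/= in_itv/= => /andP[h0 h1]; apply: h; first exact: cis_unit.
by apply: cis_neq1; rewrite !lt_neqAle h0 h1 !andbT; apply/andP; split; apply/eqP; [exact/nesym|].
Qed.

Lemma Linfty_circle_neq1 f (B : R) :
  (forall t : R, 0 < t < 2 * pi -> f (cis s) @[s --> t] --> (f (cis t) : R[i]^o)) ->
  (forall v, unit_circle v -> v != 1 -> normc (f v) <= B) ->
  Linfty_circle f.
Proof.
move=> cf fB.
have op : open (`]0, 2 * pi[%classic : set R) by exact: interval_open.
split.
- apply: measurable_angles; apply: open_continuous_measurable_fun => // t.
  by rewrite inE/= in_itv/= => /cf/cvgc_ReIm[].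
- apply: measurable_angles; apply: open_continuous_measurable_fun => // t.
  by rewrite inE/= in_itv/= => /cf/cvgc_ReIm[].
exists B; apply: ae_circle_neq1 => v cv v1.
by rewrite normcP lecR; exact: fB.
Qed.

Lemma continuous_circle_uniform g :
  (forall e : R, 0 < e -> exists f, continuous_circle f /\
     forall v, unit_circle v -> normc (g v - f v) <= e) ->
  continuous_circle g.
Proof.
move=> H; apply/continuous_circleP => v cv; apply/cvgrPdist_le => e e0.
have e3 : 0 < e / 3 by rewrite divr_gt0.
have [f [/continuous_circleP cf fg]] := H _ e3.
have /cvgrPdist_le/(_ _ e3) := cf v cv.
have : \forall x \near within unit_circle (nbhs (v : R[i]^o)), unit_circle x.
  by apply: withinT.
apply: filterS2 => x cx; rewrite !sub0r !normrN !ger0_norm ?normc_ge0// => fx.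
have -> : g x - g v = (g x - f x) + ((f x - f v) + (f v - g v)) by ring.
have := le_normcD (g x - f x) ((f x - f v) + (f v - g v)).
have := le_normcD (f x - f v) (f v - g v).
have := fg x cx; have := fg v cv; rewrite (normcB (f v)); lra.
Qed.

End CircleFunctions.

(** * The change of variable from the disk to the half-plane *)

Section Mobius.
Context {R : realType}.
Implicit Types (v x : R[i]).

Definition mobius v : R[i] := 1 / 2 + (v + 1) / (v - 1).

Lemma Re_mobius v : v != 1 ->
  complex.Re (mobius v) = 1 / 2 + (normc v ^+ 2 - 1) / normc (v - 1) ^+ 2.
Proof.
move=> v1.
have n0 : 0 < normc (v - 1) ^+ 2.
  rewrite exprn_gt0// lt_neqAle normc_ge0 andbT eq_sym.
  by apply: contra v1 => /eqP/eq0_normc/eqP; rewrite subr_eq0.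
rewrite /mobius ReD; congr (_ + _); first by rewrite /=; field.
move: n0; rewrite !normc_sqr ReD ImD ReN ImN.
case: v v1 => a b _ /=; rewrite oppr0 !addr0 => n0.
by field; rewrite gt_eqF.
Qed.

Lemma Re_mobius_disk v : normc v < 1 -> complex.Re (mobius v) < 1 / 2.
Proof.
move=> v1; have v1' : v != 1.
  by apply: contraTneq v1 => ->; rewrite (_ : 1 = 1%:C)// normc_real normr1 ltxx.
have n0 : 0 < normc (v - 1) ^+ 2.
  rewrite exprn_gt0// lt_neqAle normc_ge0 andbT eq_sym.
  by apply: contra v1' => /eqP/eq0_normc/eqP; rewrite subr_eq0.
rewrite Re_mobius// -[ltRHS]addr0 ltrD2l pmulr_llt0 ?invr_gt0// subr_lt0.
by rewrite expr_lt1// normc_ge0.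
Qed.

Lemma Re_mobius_circle v : unit_circle v -> complex.Re (mobius v) = 1 / 2.
Proof.
move=> /unit_circleP v1; have [->|v1'] := eqVneq v 1.
  by rewrite /mobius subrr invr0 mulr0 addr0/=; field.
by rewrite Re_mobius// v1 expr1n subrr mul0r addr0.
Qed.

(** On the circle the modulus of (v - 1) mobius v = (3 v + 1) / 2 is at
least 1. *)
Lemma mobius_large v : unit_circle v -> v != 1 ->
  (normc (mobius v))^-1 <= normc (v - 1).
Proof.
move=> /unit_circleP cv v1.
have E : mobius v * (v - 1) = (3 * v + 1) / 2.
  by rewrite /mobius; field; rewrite subr_eq0.
have real_norm (x : R) : 0 <= x -> normc x%:C = x by move=> x0; rewrite normc_real ger0_norm.
have n3 : normc (3 * v) = 3 by rewrite normcM cv mulr1 -[RHS]real_norm// rmorph_nat.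
have n1 : normc (- 1 : R[i]) = 1 by rewrite normcN (_ : 1 = 1%:C)// normc_real normr1.
have n2 : normc (2^-1 : R[i]) = 2^-1.
  by rewrite -[RHS]real_norm ?invr_ge0// fmorphV rmorph_nat.
have h : 1 <= normc (mobius v) * normc (v - 1).
  rewrite -(normcM (mobius v)) E normcM n2.
  have := le_normcD (3 * v + 1) (- 1); rewrite addrK n3 n1; lra.
have m0 : 0 < normc (mobius v).
  rewrite lt_neqAle normc_ge0 andbT eq_sym; apply: contraTneq h => ->.
  by rewrite mul0r ler10.
by rewrite -(ler_pM2l m0) divff ?gt_eqF.
Qed.

Lemma mobius_differentiable (v : R[i]^o) : (v : R[i]) != 1 ->
  differentiable (mobius : R[i]^o -> R[i]^o) v.
Proof.
move=> v1.
apply: (@differentiableD R[i] R[i]^o R[i]^o (cst (1 / 2 : R[i]))); first exact: differentiable_cst.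
apply: (@differentiableM R[i] R[i]^o (fun z => (z : R[i]) + (1 : R[i]) : R[i]^o)
  (fun z => ((z : R[i]) - (1 : R[i]))^-1 : R[i]^o)).
  by apply: differentiableD; [exact: ex_diff|exact: differentiable_cst].
have s1 : differentiable ((fun z => z - (1 : R[i])) : R[i]^o -> R[i]^o) v.
  by apply: differentiableB; [exact: ex_diff|exact: differentiable_cst].
apply: (differentiable_comp s1); apply: differentiable_Rinv.
by rewrite subr_eq0.
Qed.

Lemma near_neq1 v : v != 1 -> \forall x \near (v : R[i]^o), (x : R[i]) != 1.
Proof.
move=> v1; have n0 : 0 < normc (1 - v).
  rewrite lt_neqAle normc_ge0 andbT eq_sym.
  by apply: contra v1 => /eqP/eq0_normc/eqP; rewrite subr_eq0 eq_sym.
have /cvgc_normc h : (x : R[i]) @[x --> (v : R[i]^o)] --> (v : R[i]^o) by exact: cvg_id.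
have /cvgrPdist_lt/(_ _ n0) := h; apply: filterS => x.
rewrite sub0r normrN ger0_norm ?normc_ge0// => xv.
by apply: contraTneq xv => ->; rewrite ltxx.
Qed.

End Mobius.

(** * The decomposition *)

Section Assembly.
Context {R : realType}.
Variable p : nat.
Hypothesis p_gt1 : (1 < p)%N.
Implicit Types (v z : R[i]).

Let q := @sqrt_ratio R p.
Let c0 := @gauss_mass R.
Let c0_gt0 : 0 < c0. Proof. exact: gauss_mass_gt0. Qed.
Let A := 192 / (1 - q) + @right_const R p.

Lemma cos_mellin_bound z : complex.Re z = 1 / 2 -> normc (cos_mellin z) <= 192.
Proof.
move=> zh; apply: le_trans (le_normcD _ _) _.
have := left_mell_bound 0 zh; have := @right_mell_bound R 0 z.
rewrite zh lexx oppr0 mul0r expR0 !mulr1 => /(_ isT); lra.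
Qed.

(** The product and the two partial sums are compared term by term with
split_mell; the error is made of the tail of the Euler factor, times the bound
192 = 144 + 48 on cos_mellin, and of the tail of right_total. *)
Lemma left_part_approx M z : complex.Re z = 1 / 2 ->
  normc (cos_mellin z * rho_p p z - right_total p z - left_part p M.+1 z) <= A * q ^+ M.
Proof.
move=> zh; have /andP[q0 q1] := @sqrt_ratio_itv R p p_gt1.
have z01 : 0 < complex.Re z < 1 by rewrite zh; lra.
pose S := \sum_(0 <= m < M.+1) (euler_coef p m)%:C * cexp (- (z * (euler_shift p m)%:C)).
have E : right_part p M.+1 z + left_part p M.+1 z = cos_mellin z * S.
  rewrite /right_part /left_part -big_split/= /S mulr_sumr; apply: eq_bigr => m _.
  by rewrite -mulrDr split_mell//; ring.
have -> : cos_mellin z * rho_p p z - right_total p z - left_part p M.+1 z =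
   cos_mellin z * (rho_p p z - S) - (right_total p z - right_part p M.+1 z).
  by rewrite mulrBr -E; ring.
apply: le_trans (le_normcD _ _) _; rewrite normcN normcM /A mulrDl; apply: lerD.
  rewrite -mulrA (mulrC (_^-1)); apply: ler_pM; rewrite ?normc_ge0//.
    exact: cos_mellin_bound.
  exact: sum_coef_shift.
have zh' : complex.Re z <= 1 / 2 by rewrite zh.
apply: le_trans (right_total_tail p_gt1 M.+1 zh') _.
have r0 : 0 <= @right_const R p.
  exact: le_trans (normc_ge0 _) (right_total_bound p_gt1 zh').
by rewrite ler_wpM2l// exprS ler_piMl ?exprn_ge0 ?ltW.
Qed.

(** The value 0 at v = 1 is the limit forced by left_mell_decay. *)
Definition continuous_part v : R[i] := if v == 1 then 0 else
  (cos_mellin (mobius v) * rho_p p (mobius v) - right_total p (mobius v)) / c0%:C.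

(** left_mell_decay in the variable v, with 1 / |z| <= |v - 1|. *)
Lemma left_mell_mobius a v : unit_circle v -> v != 1 ->
  normc (left_mell a (mobius v)) <= (2 + 16 * pi * expR a) * normc (v - 1).
Proof.
move=> cv v1; have zh := Re_mobius_circle cv.
have m0 : 0 < normc (mobius v).
  by apply: lt_le_trans (Re_le_normc _); rewrite zh.
have B0 : 0 <= 2 + 16 * pi * expR a by rewrite addr_ge0// !mulr_ge0 ?pi_ge0 ?expR_ge0.
apply: le_trans (ler_wpM2l B0 (mobius_large cv v1)).
by rewrite ler_pdivlMr// mulrC left_mell_decay.
Qed.

Lemma left_mell_differentiable a (z : R[i]^o) : 0 < complex.Re z ->
  differentiable (left_mell a : R[i]^o -> R[i]^o) z.
Proof.
move=> z0; have zm : complex.Re (- (z : R[i])) < 0 by rewrite ReN oppr_lt0.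
have mk : measurable_fun setT (fun y : R => coskernel (a - y)).
  apply: continuous_measurable_fun => y.
  apply: (@continuous_comp _ _ _ (fun y => a - y) (@coskernel R)); last exact: coskernel_cont.
  by apply: cvgB; [exact: cvg_cst|exact: cvg_id].
have kB (y : R) : 0 <= y -> `|coskernel (a - y)| <= 2 by move=> _; exact: coskernel_le.
have /derivable1_diffP h := laplace_derivable mk kB zm.
have s1 : differentiable ((fun z => - z) : R[i]^o -> R[i]^o) z.
  by apply: differentiableN; exact: ex_diff.
exact: (differentiable_comp s1 h).
Qed.

Lemma left_part_cvg M v : unit_circle v -> v != 1 ->
  left_part p M (mobius x) @[x --> (v : R[i]^o)] --> (left_part p M (mobius v) : R[i]^o).
Proof.
move=> cv v1; elim: M => [|M IH].
  have E z : left_part p 0 z = 0 by rewrite /left_part big_geq.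
  rewrite E; under eq_fun do rewrite E. exact: (@ccvg_cst R R[i]^o (nbhs (v : R[i]^o)) _ 0).
have E z : left_part p M.+1 z = left_part p M z + (euler_coef p M)%:C * left_mell (euler_shift p M) z.
  by rewrite /left_part big_nat_recr.
have zh : 0 < complex.Re (mobius v) by rewrite Re_mobius_circle.
have h : left_mell (euler_shift p M) (mobius x) @[x --> (v : R[i]^o)] -->
    (left_mell (euler_shift p M) (mobius v) : R[i]^o).
  exact: (differentiable_continuous
    (differentiable_comp (mobius_differentiable v1) (@left_mell_differentiable _ (mobius v) zh))).
under eq_fun do rewrite E.
rewrite E; apply: (ccvgD IH (ccvgM _ h)).
exact: (@ccvg_cst R R[i]^o (nbhs (v : R[i]^o)) _ _).
Qed.

Lemma left_part_continuous M : continuous_circle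
  (fun v => if v == 1 then 0 else left_part p M (mobius v) / c0%:C).
Proof.
apply/continuous_circleP => v cv.
have near_circle : \forall x \near within unit_circle (nbhs (v : R[i]^o)), unit_circle x.
  exact: withinT.
have [E1|v1] := eqVneq v 1.
  pose B := (\sum_(0 <= m < M) (2 + 16 * pi * expR (@euler_shift R p m))) / c0.
  have B0 : 0 <= B.
    rewrite divr_ge0 ?(ltW c0_gt0)//; apply: sumr_ge0 => m _.
    by rewrite addr_ge0// !mulr_ge0 ?pi_ge0 ?expR_ge0.
  apply: (@squeeze_cvgr _ _ _ _ (fun=> 0) (fun x : R[i]^o => B * normc ((x : R[i]) - v))).
  - apply: filterS near_circle => x cx; rewrite normc_ge0/= subr0; case: ifPn => [_|x1].
      by rewrite (_ : 0 = 0%:C)// normc_real normr0 mulr_ge0// normc_ge0.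
    rewrite normcM -fmorphV normc_real ger0_norm ?invr_ge0 ?(ltW c0_gt0)//.
    rewrite /B mulrAC ler_wpM2r ?invr_ge0 ?(ltW c0_gt0)// /left_part E1.
    elim: M {B B0} => [|M IH].
      by rewrite !big_geq// (_ : 0 = 0%:C)// normc_real normr0 mul0r.
    rewrite !big_nat_recr//= mulrDl; apply: le_trans (le_normcD _ _) _.
    apply: lerD; first exact: IH.
    rewrite normcM normc_real -[leRHS]mul1r; apply: ler_pM; rewrite ?normc_ge0//.
      exact: coef_le.
    exact: left_mell_mobius.
  - exact: cvg_cst.
  - rewrite -[X in _ --> X](mulr0 B); apply: cvgM; first exact: cvg_cst.
    have /cvgc_normc h : (x : R[i]) @[x --> within unit_circle (nbhs (v : R[i]^o))] --> (v : R[i]^o).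
      by apply: cvg_within_filter; exact: cvg_id.
    exact: h.
have h := ccvgM (@left_part_cvg M v cv v1) (@ccvg_cst R R[i]^o (nbhs (v : R[i]^o)) _ (c0%:C)^-1).
have h' : (if (x : R[i]) == 1 then 0 else left_part p M (mobius x) / c0%:C)
    @[x --> (v : R[i]^o)] --> (left_part p M (mobius v) / c0%:C : R[i]^o).
  refine (@cvg_near_eq R R[i]^o (nbhs (v : R[i]^o)) (@nbhs_filter R[i]^o v) _ _ _ _
    (h (@nbhs_filter R[i]^o v) (@nbhs_filter R[i]^o v))).
  by have n1 := near_neq1 v1; apply: filterS n1 => x /negbTE /= ->.
by apply/cvgc_normc; apply: cvg_within_filter; exact: h'.
Qed.

(** A uniform limit, by left_part_approx, of the continuous partial sums. *)
Lemma continuous_part_continuous : continuous_circle continuous_part.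
Proof.
have /andP[q0 q1] := @sqrt_ratio_itv R p p_gt1.
apply: continuous_circle_uniform => e e0.
have : (A / c0 * q ^+ n) @[n --> \oo] --> (0 : R).
  rewrite -[X in _ --> X](mulr0 (A / c0)); apply: cvgM; first exact: cvg_cst.
  by apply: cvg_expr; rewrite ger0_norm ?ltW.
move=> /cvgrPdist_le/(_ _ e0)[M _ /(_ M (leqnn M))]; rewrite sub0r normrN => hM.
exists (fun v => if v == 1 then 0 else left_part p M.+1 (mobius v) / c0%:C).
split; first exact: left_part_continuous.
move=> v cv /=; rewrite /continuous_part; case: eqP => [_|/eqP v1].
  by rewrite subr0 (_ : 0 = 0%:C)// normc_real normr0 ltW.
apply: le_trans (le_trans (ler_norm _) hM).
rewrite -mulrBl normcM -fmorphV normc_real ger0_norm ?invr_ge0 ?(ltW c0_gt0)//.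
rewrite mulrAC ler_wpM2r ?invr_ge0 ?(ltW c0_gt0)//.
by apply: left_part_approx; exact: Re_mobius_circle.
Qed.


Definition holomorphic_part v : R[i] := right_total p (mobius v) / c0%:C.

Lemma holomorphic_part_differentiable (v : R[i]^o) : (v : R[i]) != 1 -> normc v <= 1 ->
  differentiable (holomorphic_part : R[i]^o -> R[i]^o) v.
Proof.
move=> v1 nv.
have zh : complex.Re (mobius v) < 1.
  move: nv; rewrite le_eqVlt => /orP[/eqP/unit_circleP/Re_mobius_circle ->|/Re_mobius_disk]; lra.
apply: (@differentiableM R[i] R[i]^o (fun x => right_total p (mobius x) : R[i]^o)
  (cst (c0%:C)^-1)); last exact: differentiable_cst.
exact: (differentiable_comp (mobius_differentiable v1)
  (right_total_differentiable p_gt1 (z := mobius v) zh)).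
Qed.

Lemma holomorphic_part_bound v : complex.Re (mobius v) <= 1 / 2 ->
  normc (holomorphic_part v) <= @right_const R p / c0.
Proof.
move=> zh; rewrite normcM -fmorphV normc_real ger0_norm ?invr_ge0 ?(ltW c0_gt0)//.
by rewrite ler_wpM2r ?invr_ge0 ?(ltW c0_gt0)// right_total_bound.
Qed.

Lemma holomorphic_part_cvg v : unit_circle v -> v != 1 ->
  holomorphic_part x @[x --> (v : R[i]^o)] --> (holomorphic_part v : R[i]^o).
Proof.
move=> /unit_circleP cv v1.
have nv : normc v <= 1 by rewrite cv.
exact: (differentiable_continuous (@holomorphic_part_differentiable v v1 nv)).
Qed.

Lemma holomorphic_part_Hinfty : Hinfty_circle holomorphic_part.
Proof.
split.
  apply: (@Linfty_circle_neq1 R _ (@right_const R p / c0)).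
    move=> t /cis_neq1 t1; apply: cvg_comp (@cis_cvg R t) _.
    exact: holomorphic_part_cvg (cis_unit t) t1.
  by move=> v cv _; apply: holomorphic_part_bound; rewrite Re_mobius_circle.
exists holomorphic_part; split.
  split=> [v|].
    rewrite /unit_disk/= normcP -[1]/(1%:C) ltcR => v1.
    apply/derivable1_diffP; apply: holomorphic_part_differentiable; last exact: ltW.
    by apply: contraTneq v1 => ->; rewrite (_ : 1 = 1%:C)// normc_real normr1 ltxx.
  exists (@right_const R p / c0) => v; rewrite /unit_disk/= !normcP -[1]/(1%:C) ltcR lecR => v1.
  by apply: holomorphic_part_bound; rewrite ltW// Re_mobius_disk.
apply: ae_circle_neq1 => v cv v1.
have h : (r%:C * v : R[i]) @[r --> (1 : R)^'-] --> (v : R[i]^o).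
  have h1 : r%:C @[r --> (1 : R)^'-] --> ((1 : R[i]) : R[i]^o).
    by apply/cvgc_ReIm; split => /=; [exact: cvg_within|exact: cvg_cst].
  rewrite -[X in _ --> X]mul1r; apply: (ccvgM h1); exact: (@ccvg_cst R R (1 : R)^'- _ v).
exact: cvg_comp h (holomorphic_part_cvg cv v1).
Qed.

Lemma continuous_part_bound : exists B : R, forall v, unit_circle v -> normc (continuous_part v) <= B.
Proof.
pose D := 48 * expR (- @euler_shift R p 0 / 2).
have D0 : 0 <= D by rewrite mulr_ge0// expR_ge0.
have AD z : complex.Re z = 1 / 2 ->
    normc (cos_mellin z * rho_p p z - right_total p z) <= A + D.
  move=> zh; have := left_part_approx 0 zh; rewrite expr0 mulr1.
  have : normc (left_part p 1 z) <= D.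
    rewrite /left_part big_nat1 normcM normc_real -[leRHS]mul1r.
    by apply: ler_pM; rewrite ?normc_ge0//; [exact: coef_le|exact: left_mell_bound].
  move: (cos_mellin z * _ - _) (left_part _ _ _) => a b.
  by have := le_normcD (a - b) b; rewrite subrK; lra.
exists ((A + D) / c0) => v cv; rewrite /continuous_part; case: eqP => _.
  rewrite (_ : 0 = 0%:C)// normc_real normr0 divr_ge0 ?(ltW c0_gt0)//.
  exact: le_trans (normc_ge0 _) (AD _ (Re_mobius_circle cv)).
rewrite normcM -fmorphV normc_real ger0_norm ?invr_ge0 ?(ltW c0_gt0)//.
by rewrite ler_wpM2r ?invr_ge0 ?(ltW c0_gt0)// AD// Re_mobius_circle.
Qed.

Lemma C_plus_Hinfty_product : C_plus_Hinfty (fun v : R[i] => kappa v * kappa_p p v).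
Proof.
pose u (v : R[i]) := kappa v * kappa_p p v.
have uE v : unit_circle v -> v != 1 -> u v = continuous_part v + holomorphic_part v.
  move=> cv v1; rewrite /u /kappa /kappa_p -/(mobius v) rho_inftyE ?Re_mobius_circle//.
  rewrite /continuous_part (negbTE v1) /holomorphic_part -/c0.
  ring.
have [B Bl] := continuous_part_bound.
split.
  apply: (@Linfty_circle_neq1 R _ (B + @right_const R p / c0)).
    move=> t t2; have t1 := cis_neq1 t2.
    rewrite -/(u _) uE//; last exact: cis_unit.
    have hr : holomorphic_part (cis s) @[s --> t] --> (holomorphic_part (cis t) : R[i]^o).
      by apply: cvg_comp (@cis_cvg R t) _; exact: holomorphic_part_cvg (cis_unit t) t1.
    have hl := @continuous_circle_cis R _ continuous_part_continuous t.
    have op : open (`]0, 2 * pi[%classic : set R) by exact: interval_open.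
    have near_t : \forall s \near t, `]0, 2 * pi[%classic s by apply: open_nbhs_nbhs; split.
    apply: (@cvg_near_eq _ _ _ _ _ (fun s => continuous_part (cis s) + holomorphic_part (cis s))).
      by apply: filterS near_t => s /= /cis_neq1 s1; rewrite -uE//; exact: cis_unit.
    exact (@ccvgD R R (nbhs t) _ (fun s => continuous_part (cis s)) (fun s => holomorphic_part (cis s)) _ _ hl hr).
  move=> v cv v1; rewrite -/(u v) uE//; apply: le_trans (le_normcD _ _) _.
  by apply: lerD; [exact: Bl|apply: holomorphic_part_bound; rewrite Re_mobius_circle].
exists continuous_part, holomorphic_part; split.
- exact: continuous_part_continuous.
- exact: holomorphic_part_Hinfty.
- exact: ae_circle_neq1.
Qed.

End Assembly.

Theorem proposition4p5 (R : realType) (p : nat) (hp : prime p) :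
  C_plus_Hinfty (fun v : complex R => kappa v * kappa_p p v).
Proof. exact: C_plus_Hinfty_product (prime_gt1 hp). Qed.
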